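(* Assume that the distribution of $X$ is determined by its mean $\mu\in\Theta$, that the variance of $X$ is a positive continuous function of $\mu\in\Theta$, and that $\mathbb{E}[|X|^3]<\infty$ for $\mu\in\Theta$. Let $\mathcal{V}(\theta)$ denote the variance of $X$ when its mean is $\theta$, if $\theta\in\Theta$, and $\mathcal{V}(\theta)=0$ if $\theta\notin\Theta$. Let $\{\delta_n\}_{n\in\mathbb{N}}\subset(0,1)$ with $\Phi\big(\sqrt{\ln\frac1{\delta_n}}\big)\to1-\frac\delta2$ as $n\to\infty$, let $\rho\in[0,1]$, and let $m_\varepsilon$ be positive integers with $m_\varepsilon\to\infty$ and $\varepsilon^2m_\varepsilon\to0$ as $\varepsilon\downarrow0$. Let $\mathbf{n}$ (depending on $\varepsilon$) be the smallest integer $n\ge m_\varepsilon$ such that $$\mathcal{V}\big(Y_n+\rho[\mathscr{U}(Y_n,\varepsilon)-Y_n]\big)\le\frac{n[\mathscr{U}(Y_n,\varepsilon)-Y_n]^2}{\ln\frac1{\delta_n}}\quad\text{and}\quad\mathcal{V}\big(Y_n+\rho[\mathscr{L}(Y_n,\varepsilon)-Y_n]\big)\le\frac{n[\mathscr{L}(Y_n,\varepsilon)-Y_n]^2}{\ln\frac1{\delta_n}}.$$ Let $\widehat{\boldsymbol\mu}=Y_{\mathbf{n}}$ and $\boldsymbol{\mathcal{I}}=(\mathcal{L}(\widehat{\boldsymbol\mu},\varepsilon),\mathcal{U}(\widehat{\boldsymbol\mu},\varepsilon))$. Then for every $\mu\in\Theta$: (I) $\Pr\{\mathbf{n}<\infty\}=1$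 and $\mathbb{E}[\mathbf{n}]<\infty$. (II) $\Pr\{\lim_{\varepsilon\downarrow0}\mathbf{n}/\mathcal{N}(\varepsilon,\delta,\mu,\nu)=1\}=1$. (III) $\lim_{\varepsilon\downarrow0}\Pr\{\mu\in\boldsymbol{\mathcal{I}}\}=1-\delta$. (IV) $\lim_{\varepsilon\downarrow0}\mathbb{E}[\mathbf{n}]/\mathcal{N}(\varepsilon,\delta,\mu,\nu)=1$.
   Context: $X$ is a real random variable with mean $\mu=\mathbb{E}[X]$ and variance $\nu=\mathbb{E}[|X-\mu|^2]$; the set of possible values of $\mu$ is an interval $\Theta\subseteq\mathbb{R}$. $X_1,X_2,\dots$ are i.i.d. samples of $X$ and $Y_n=\frac1n\sum_{i=1}^nX_i$. ''The distribution of $X$ is determined by $\mu$'' means that there is a family of distributions indexed by the mean $\mu\in\Theta$; $\Pr$ and $\mathbb{E}$ are taken under the distribution with mean $\mu$, and then $\nu=\mathcal{V}(\mu)$. $\Phi$ is the standard normal distribution function, $\delta\in(0,1)$ is fixed, and $\mathcal{Z}=\Phi^{-1}(1-\delta/2)$. $\mathscr{L}(z,\varepsilon)$ and $\mathscr{U}(z,\varepsilon)$, for $z\in\mathbb{R}$, $\varepsilon>0$, are real functions such that: (i) they are continuous functions of $z$ and $\varepsilon>0$; (ii) for every $\varepsilon>0$, $\mathscr{L}(z,\varepsilon)\le z\le\mathscr{U}(z,\varepsilon)$ for all $z\in\mathbb{R}$ and $\mathscr{L}(\mu,\varepsilon)<\mu<\mathscr{U}(\mu,\varepsilon)$ for all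 $\mu\in\Theta$; (iii) for every $\mu\in\Theta$, as $(z,\varepsilon)\to(\mu,0)$ with $\varepsilon\downarrow0$, $\frac{z-\mathscr{L}(z,\varepsilon)}{\varepsilon}$ and $\frac{\mathscr{U}(z,\varepsilon)-z}{\varepsilon}$ both converge to $\kappa(\mu)>0$, where $\kappa$ is a continuous function of $\mu$. The functions $\mathcal{L}(z,\varepsilon)$, $\mathcal{U}(z,\varepsilon)$ are in the same class in the sense that for every $\mu\in\Theta$, as $z\to\mu$, $\varepsilon\downarrow0$ jointly, $\frac{z-\mathcal{L}(z,\varepsilon)}{\varepsilon}$ and $\frac{\mathcal{U}(z,\varepsilon)-z}{\varepsilon}$ also both converge to $\kappa(\mu)$. $\mathcal{N}(\varepsilon,\delta,\mu,\nu)=\dfrac{\nu\mathcal{Z}^2}{[\kappa(\mu)\varepsilon]^2}$. For all $\varepsilon>0$ the sample sizes $\mathbf{n}$ are defined from the same sequence $X_1,X_2,\dots$.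
   Formalization: Proved for μ in the interior of Θ (at an endpoint of Θ, (II) fails); (I) is proved for all small ε, and for a given ε>0 only if 𝒱 is bounded near μ+ρ[𝒰(μ,ε)−μ] and μ+ρ[ℒ(μ,ε)−μ] (script bounds of the stopping rule), since E[n] can otherwise be infinite. *)

(* Defs.v *)
(* MathComp-Analysis *)
From HB Require Import structures.
From mathcomp Require Import all_boot all_order all_algebra finmap.
From mathcomp Require Import all_classical all_reals all_analysis.
Export numFieldNormedType.Exports.

Set Implicit Arguments.
Unset Strict Implicit.
Unset Printing Implicit Defensive.

Import Order.TTheory GRing.Theory Num.Theory.

Local Open Scope classical_set_scope.
Local Open Scope ring_scope.

Definition Phi (R : realType) (x : R) : R :=
  fine (normal_prob 0 1 `]-oo, x]).

(* Phi is injective, so that [xget] can only pick the solution of [Phi x = p];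
   the value is 0 when p is outside of ]0, 1[. *)
Definition Phi_inv (R : realType) (p : R) : R := xget 0 [set x | Phi x = p].

Section samples.
Context d (T : measurableType d) (R : realType).
Implicit Types (P : probability T R) (X : {mfun T >-> R})
  (Xs : nat -> {mfun T >-> R}).

Definition mutually_independent P Xs : Prop :=
  forall (J : {fset nat}) (A : nat -> set R),
    (forall j, measurable (A j)) ->
    P (\bigcap_(j in [set` J]) (Xs j @^-1` A j)) =
    (\prod_(j <- J) P (Xs j @^-1` A j))%E.

Definition iid_samples P X Xs : Prop :=
  (forall i (A : set R), measurable A ->
     distribution P (Xs i) A = distribution P X A) /\
  mutually_independent P Xs.

(* The samples are indexed from 0: [Xs i] is the (i + 1)-st sample. *)
Definition sample_mean Xs (n : nat) (w : T) : R :=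
  (\sum_(i < n) Xs i w) / n%:R.

Definition variance_fun (Theta : set R) (Pr : R -> probability T R) X
    (t : R) : R :=
  if t \in Theta then fine (variance (Pr t) X) else 0.

End samples.

Section interval_bounds.
Context (R : realType).
Implicit Types (Theta : set R) (kappa : R -> R) (L U : R -> R -> R).

Definition bounds_cvg Theta kappa L U : Prop :=
  forall mu, Theta mu ->
    (p.1 - L p.1 p.2) / p.2 @[p --> (nbhs mu, 0^'+)] --> kappa mu /\
    (U p.1 p.2 - p.1) / p.2 @[p --> (nbhs mu, 0^'+)] --> kappa mu.

Definition bounds_class Theta kappa L U : Prop :=
  [/\ forall z e, 0 < e ->
        {for (z, e), continuous (fun p : R * R => L p.1 p.2)} /\
        {for (z, e), continuous (fun p : R * R => U p.1 p.2)},
      forall e, 0 < e -> forall z, L z e <= z <= U z e,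
      forall e, 0 < e -> forall mu, Theta mu -> L mu e < mu < U mu e &
      bounds_cvg Theta kappa L U].

End interval_bounds.

Definition first_index (p : pred nat) : option nat :=
  if pselect (exists n, p n) is left h then Some (ex_minn h) else None.

Definition index_ereal (R : realType) (o : option nat) : \bar R :=
  if o is Some n then (n%:R)%:E else +oo%E.

Definition stop_rule (R : realType) (V : R -> R) (rho : R) (delta_ : nat -> R)
    (L U : R -> R -> R) (e y : R) (n : nat) : bool :=
  (V (y + rho * (U y e - y)) <= n%:R * (U y e - y) ^+ 2 / ln (1 / delta_ n)) &&
  (V (y + rho * (L y e - y)) <= n%:R * (L y e - y) ^+ 2 / ln (1 / delta_ n)).

(* [None] means that sampling never stops. *)
Definition sample_size (R : realType) (T : Type) (V : R -> R) (rho : R)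
    (delta_ : nat -> R) (L U : R -> R -> R) (m_ : R -> nat)
    (Y : nat -> T -> R) (e : R) (w : T) : option nat :=
  first_index (fun n => (m_ e <= n)%N &&
                        stop_rule V rho delta_ L U e (Y n w) n).

(* The estimate and the interval are only formed when sampling stops. *)
Definition covered (R : realType) (T : Type) (N : T -> option nat)
    (Y : nat -> T -> R) (cL cU : R -> R -> R) (e mu : R) : set T :=
  [set w | exists2 n, N w = Some n & cL (Y n w) e < mu < cU (Y n w) e].

Definition target_size (R : realType) (Z kappa_mu nu e : R) : R :=
  nu * Z ^+ 2 / (kappa_mu * e) ^+ 2.

(* Main.v *)
(* Let S_n be the centred sums. Third moments bound E|S_n|^3 by C n^(3/2), so
   that \sum_n P(|Y_n - mu| > g) < oo for every g > 0 (complete convergence).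
   When Y_n is close to mu, n >= m_e and e is small, the limits defining kappa
   and the continuity of V show that the stopping condition fails for
   n < (1 - eta) NN e and holds for n >= (1 + eta) NN e. Hence the sample size
   exceeds n only if Y_n is far from mu or n < (1 + eta) NN e, and summing the
   probabilities of these events gives (I) and (IV); Borel-Cantelli gives (II).
   For (III), the sample size lies near NN e with high probability, and
   Ottaviani's maximal inequality allows one to replace the stopped sum by S_a
   with a = floor((1 - eta) NN e) fixed; the probability of coverage is then
   close to P(|S_a| <= Z s sqrt a), which converges by the central limit
   theorem. The latter is proved by Stein's method for compactly supported
   Lipschitz test functions. *)
Require Import Defs.
From HB Require Import structures.
From mathcomp Require Import all_boot all_order all_algebra finmap.
From mathcomp Require Import all_classical all_reals all_analysis.
From mathcomp Require Import measurable_realfun ring lra.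

Set Implicit Arguments.
Unset Strict Implicit.
Unset Printing Implicit Defensive.

Import Order.TTheory GRing.Theory Num.Theory.

Local Open Scope classical_set_scope.
Local Open Scope ring_scope.

(** * Independent samples *)

(** The sample size depends on the samples, so no limit theorem applies to the stopped mean
    directly, and the stopping condition need not be monotone in n. This is why the analysis rests
    on a deterministic window around [NN e]: randomness then enters only through means far from
    [mu]. Finiteness of the expected size requires the probabilities of these events to be summable.
    Chebyshev's inequality gives only a bound in 1/n, while the third moment gives n^(-3/2). The
    mean is taken in the interior of [Theta] because [V] is 0 outside of [Theta]: at an end point
    that belongs to [Theta], [V] jumps, and means falling outside would satisfy the rule at once.
    For a fixed [e] the limits defining [kappa] say nothing; there it is enough that [V] is bounded
    near the two points at which the rule evaluates it, since the other side of each inequality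
    grows linearly in n. For the coverage, a is placed at the lower end of the window so that S_a
    and the stopped sum differ by a sum of later samples over a short range. The maximum over that
    range is controlled by variances alone, and a is not random. *)

Section independence.
Context d (T : measurableType d) (R : realType) (P : probability T R).

(** Pi-lambda argument: for fixed [B], the measurable sets independent of [B] form a Dynkin system,
    which contains the pi-system [G]. *)
Lemma g_sigma_indep (G : set (set T)) (B : set T) :
  setI_closed G -> G `<=` measurable -> measurable B ->
  (forall A, G A -> P (A `&` B) = P A * P B)%E ->
  forall A, <<s G >> A -> measurable A /\ (P (A `&` B) = P A * P B)%E.
Proof.
move=> GI Gm mB GB A; rewrite -setI_closed_g_dynkin_g_sigma_algebra//.
pose H := [set A | measurable A /\ (P (A `&` B) = P A * P B)%E].
suff : <<d G >> `<=` H by move=> /(_ A).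
apply: smallest_sub; last by move=> E GE; split; [exact: Gm|exact: GB].
split => [|E [mE EB]|F tF FH].
- by split; rewrite ?setTI ?probability_setT ?mul1e.
- split; first exact: measurableC.
  rewrite setIC -setDE measureD//; last first.
    by rewrite (le_lt_trans (probability_le1 _ _)) ?ltry.
  rewrite (_ : _ (B `&` E) = P E * P B)%E; last by rewrite setIC.
  rewrite probability_setC// -[LHS]/(P B - P E * P B)%E.
  have aux (a b : \bar R) : a \is a fin_num -> b \is a fin_num ->
      (b - a * b = (1 - a) * b)%E.
    by move: a b => [a| |] [b| |]// _ _; congr EFin; ring.
  by apply: aux; rewrite fin_num_measure.
- have mF n : measurable (F n) by have [] := FH n.
  split; first exact: bigcup_measurable.
  rewrite setI_bigcupl measure_bigcup//; last 2 first.
  - by move=> i _; exact: measurableI.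
  - by under eq_fun do rewrite setIC; exact: trivIset_setIl.
  rewrite measure_bigcup// muleC.
  rewrite -(fineK (fin_num_measure P _ mB)) -nneseriesZl//.
  apply: eq_eseriesr => i _; rewrite fineK ?fin_num_measure// muleC.
  by have [] := FH i.
Qed.

Definition indep_rv (U V : T -> R) :=
  forall A B, measurable A -> measurable B ->
    (P (U @^-1` A `&` V @^-1` B) = P (U @^-1` A) * P (V @^-1` B))%E.

Section product.
Variables (U V : {mfun T >-> R}).
Hypothesis UV : indep_rv U V.

Let h w : R * R := (U w, V w).

Let mh : measurable_fun [set: T] h.
Proof. exact: measurable_fun_pair. Qed.

HB.instance Definition _ := isMeasurableFun.Build _ _ _ _ h mh.

Let joint A : measurable A -> (distribution P U \x distribution P V)%E A = distribution P h A.
Proof. by apply: product_measure_unique => A' B' mA mB; exact: UV. Qed.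

(** By uniqueness of the product measure, independence makes the joint law of [(U, V)] the product
    of the two laws. Both claims are then Tonelli and Fubini for the product of the coordinates on
    [R * R]. *)
Lemma indep_rv_integrableM :
  P.-integrable setT (EFin \o U) -> P.-integrable setT (EFin \o V) ->
  P.-integrable setT (EFin \o (fun w => U w * V w)) /\
  \int[P]_w (U w * V w) = (\int[P]_w U w) * \int[P]_w V w.
Proof.
move=> iU iV.
have iU' : (distribution P U).-integrable setT (EFin : R -> \bar R).
  exact: integrable_pushforward.
have iV' : (distribution P V).-integrable setT (EFin : R -> \bar R).
  exact: integrable_pushforward.
pose g (z : R * R) : \bar R := (z.1 * z.2)%:E.
have mg : measurable_fun [set: R * R] g.
  by apply/measurable_EFinP; apply: measurable_funM.
have ig : (distribution P U \x distribution P V)%E.-integrable setT g.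
  apply/integrable12ltyP => //=.
  rewrite [X in (X < _)%E](_ : _ = \int[distribution P U]_x (`|x|%:E * \int[distribution P V]_y (`|y|%:E)))%E.
    rewrite ge0_integralZr//; first last.
      exact: integral_ge0.
      by apply/measurable_EFinP.
    apply: lte_mul_pinfty.
    - exact: integral_ge0.
    - exact: (integrable_fin_num measurableT (integrable_abse iU')).
    - exact: (integrable_lty measurableT (integrable_abse iV')).
  apply: eq_integral => x _.
  rewrite -ge0_integralZl//; last by apply/measurable_EFinP.
  by apply: eq_integral => y _; rewrite /g/= normrM EFinM.
have ih : P.-integrable setT (g \o h).
  apply/integrableP; split; first exact: measurableT_comp.
  have /integrableP[_] := ig.
  rewrite (eq_measure_integral (distribution P h)); last by move=> A mA _; exact: joint.
  rewrite ge0_integral_distribution//.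
  exact: measurableT_comp.
split; first exact: ih.
have : (\int[P]_w (g \o h) w = \int[P]_w (U w)%:E * \int[P]_w (V w)%:E)%E.
  rewrite -(integral_distribution mg ih)/=.
  rewrite (eq_measure_integral (distribution P U \x distribution P V)%E); last first.
    by move=> A mA _; apply: esym; exact: joint.
  rewrite -integral12_prod_meas1//= /fubini_F /g/=.
  under eq_integral do (under eq_integral do rewrite EFinM; rewrite integralZl//).
  rewrite (_ : \int[P]_w (U w)%:E = \int[distribution P U]_x x%:E)%E; last first.
    by rewrite integral_distribution.
  rewrite (_ : \int[P]_w (V w)%:E = \int[distribution P V]_x x%:E)%E; last first.
    by rewrite integral_distribution.
  have /fineK <- := integrable_fin_num measurableT iV'.
  by rewrite integralZr.
rewrite /Rintegral /= => ->.
by rewrite fineM// integrable_fin_num.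
Qed.

End product.
End independence.

(** * Sigma-algebras generated by disjoint families of samples *)

Section sample_sigma_algebras.
Context d (T : measurableType d) (R : realType) (P : probability T R).
Variable Xs : nat -> {mfun T >-> R}.
Hypothesis indep : mutually_independent P Xs.
Implicit Types (J K : set nat) (f g : T -> R).

(** A pi-system generating the sigma-algebra of the samples with index in [J]. Only finitely many
    coordinates are constrained, because mutual independence speaks of finite sets of indices. *)
Definition cylinders J : set (set T) :=
  [set E | exists2 F : {fset nat}, [set` F] `<=` J &
     exists2 A : nat -> set R, (forall j, measurable (A j)) &
       E = \bigcap_(j in [set` F]) (Xs j @^-1` A j)].

(** Filling the missing coordinates with [setT] brings cylinders over [F] and over [G] to a common
    set of indices, where independence applies coordinate by coordinate. *)
Definition extend_cylinder (F : {fset nat}) (A : nat -> set R) (j : nat) : set R :=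
  if j \in F then A j else setT.

Let measurable_extend F A j :
  (forall j, measurable (A j)) -> measurable (extend_cylinder F A j).
Proof. by move=> mA; rewrite /extend_cylinder; case: ifP. Qed.

Let extend_cylinderE (F G : {fset nat}) A :
  \bigcap_(j in [set` F]) (Xs j @^-1` A j) =
  \bigcap_(j in [set` (F `|` G)%fset]) (Xs j @^-1` extend_cylinder F A j).
Proof.
rewrite eqEsubset; split=> w wA j /=; rewrite /extend_cylinder.
- by move=> _; case: ifPn => // jF; exact: wA.
- move=> jF; have /= := wA j; rewrite /extend_cylinder inE jF/=; exact.
Qed.

Let bigcapI (F : {fset nat}) (A B : nat -> set R) :
  \bigcap_(j in [set` F]) (Xs j @^-1` A j) `&`
  \bigcap_(j in [set` F]) (Xs j @^-1` B j) =
  \bigcap_(j in [set` F]) (Xs j @^-1` (A j `&` B j)).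
Proof. by rewrite -bigcapI. Qed.

Let cylinderI (F G : {fset nat}) A B :
  \bigcap_(j in [set` F]) (Xs j @^-1` A j) `&`
  \bigcap_(j in [set` G]) (Xs j @^-1` B j) =
  \bigcap_(j in [set` (F `|` G)%fset])
    (Xs j @^-1` (extend_cylinder F A j `&` extend_cylinder G B j)).
Proof.
by rewrite -bigcapI -(extend_cylinderE F G) fsetUC -(extend_cylinderE G F).
Qed.

Lemma cylinders_setI J : setI_closed (cylinders J).
Proof.
move=> _ _ [F FJ [A mA ->]] [G GJ [B mB ->]].
exists (F `|` G)%fset; first by move=> j /=; rewrite inE => /orP[/FJ|/GJ].
exists (fun j => extend_cylinder F A j `&` extend_cylinder G B j) => //.
by move=> j; apply: measurableI; exact: measurable_extend.
Qed.

Lemma cylinders_measurable J : cylinders J `<=` measurable.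
Proof.
move=> _ [F FJ [A mA ->]]; apply: fin_bigcap_measurable; first exact: finite_fset.
by move=> j _; rewrite -[_ @^-1` _]setTI; exact: measurable_funPT.
Qed.

Lemma cylinders_indep J K A B : J `&` K = set0 -> cylinders J A ->
  cylinders K B -> (P (A `&` B) = P A * P B)%E.
Proof.
move=> JK [F FJ [{}A mA ->]] [G GK [{}B mB ->]]; rewrite cylinderI.
rewrite [in X in (X * _)%E](extend_cylinderE F G).
rewrite [in X in (_ * X)%E](extend_cylinderE G F) fsetUC.
rewrite !indep => [|j|j|j]; last 3 first.
- exact: measurable_extend.
- exact: measurable_extend.
- by apply: measurableI; exact: measurable_extend.
rewrite -big_split/=; apply: eq_bigr => j _; rewrite /extend_cylinder.
case: ifPn => [jF|_]; last by rewrite setTI preimage_setT probability_setT mul1e.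
case: ifPn => [jG|_]; last by rewrite setIT preimage_setT probability_setT mule1.
suff : (J `&` K) j by rewrite JK.
by split; [exact: FJ|exact: GK].
Qed.

(** The pi-lambda argument is used once per side: first [A] is extended against cylinders over [K],
    then [B] against the resulting [A]. *)
Lemma g_sigma_cylinders_indep J K A B : J `&` K = set0 ->
  <<s cylinders J >> A -> <<s cylinders K >> B ->
  [/\ measurable A, measurable B & (P (A `&` B) = P A * P B)%E].
Proof.
move=> JK sA sB.
have step C : cylinders K C -> (P (A `&` C) = P A * P C)%E.
  move=> KC; have mC := cylinders_measurable KC.
  apply: (g_sigma_indep (@cylinders_setI J) (@cylinders_measurable J) mC _ sA).2.
  by move=> E JE; exact: cylinders_indep JE KC.
have mA : measurable A.
  apply: (g_sigma_indep (P := P) (@cylinders_setI J) (@cylinders_measurable J)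
    measurableT _ sA).1.
  by move=> E _; rewrite setIT probability_setT mule1.
have step' C : cylinders K C -> (P (C `&` A) = P C * P A)%E.
  by move=> KC; rewrite setIC muleC; exact: step.
have [mB BA] := g_sigma_indep (@cylinders_setI K) (@cylinders_measurable K) mA step' sB.
by split=> //; rewrite setIC BA muleC.
Qed.

(** Expresses that [f] is a function of the samples indexed by [J], without exhibiting that
    function. *)
Definition samples_measurable J f :=
  @measurable_fun _ _ (g_sigma_algebraType (cylinders J)) R setT f.

Lemma samples_measurable_id J j : J j -> samples_measurable J (Xs j).
Proof.
move=> Jj _ A mA; rewrite setTI; apply: sub_gen_smallest.
exists [fset j]%fset; first by move=> i /=; rewrite inE => /eqP ->.
exists (fun=> A) => //; rewrite eqEsubset; split=> w /= wA.
  by move=> i /=; rewrite inE => /eqP ->.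
by apply: wA; rewrite /= inE.
Qed.

Lemma samples_measurable_sub J f : samples_measurable J f ->
  measurable_fun setT f.
Proof.
move=> mf _ A mA.
have := mf measurableT _ mA; rewrite !setTI => sA.
(* [setT] lies in the sigma-algebra generated over the empty set of indices; the independence lemma
   for this pair also returns measurability in [T]. *)
have sT := @measurableT _ (g_sigma_algebraType (cylinders set0)).
by have [] := @g_sigma_cylinders_indep J set0 _ setT (setI0 _) sA sT.
Qed.

Lemma samples_measurable_indep J K f g : J `&` K = set0 ->
  samples_measurable J f -> samples_measurable K g -> indep_rv P f g.
Proof.
move=> JK mf mg A B mA mB.
have := mf measurableT _ mA; have := mg measurableT _ mB; rewrite !setTI => sB sA.
by have [] := g_sigma_cylinders_indep JK sA sB.
Qed.

Lemma samples_integrableM J K f g : J `&` K = set0 ->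
  samples_measurable J f -> samples_measurable K g ->
  P.-integrable setT (EFin \o f) -> P.-integrable setT (EFin \o g) ->
  P.-integrable setT (EFin \o (fun w => f w * g w)) /\
  \int[P]_w (f w * g w) = (\int[P]_w f w) * \int[P]_w g w.
Proof.
move=> JK mf mg.
have fP := isMeasurableFun.Build _ _ _ _ f (samples_measurable_sub mf).
have gP := isMeasurableFun.Build _ _ _ _ g (samples_measurable_sub mg).
pose f' : {mfun T >-> R} := HB.pack f fP.
pose g' : {mfun T >-> R} := HB.pack g gP.
exact: (@indep_rv_integrableM _ _ _ P f' g' (samples_measurable_indep JK mf mg)).
Qed.

End sample_sigma_algebras.

(** Second-order Taylor expansion of the cube of the absolute value at [a]. The exact linear term is
    kept because its mean vanishes when [b] is centred and independent of [a]. *)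
Lemma normr_cubeD (R : realDomainType) (a b : R) :
  `|a + b| ^+ 3 <= `|a| ^+ 3 + 3 * (a * `|a|) * b + 3 * `|a| * b ^+ 2 + `|b| ^+ 3.
Proof.
wlog a0 : a b / 0 <= a.
  move=> H; have [/H//|a0] := leP 0 a.
  have := H (- a) (- b); rewrite oppr_ge0 => /(_ (ltW a0)).
  by rewrite -opprD !normrN sqrrN => h; apply: le_trans h _; lra.
rewrite (ger0_norm a0).
have [b0|b0] := leP 0 b; first by rewrite !ger0_norm ?addr_ge0// /expr2; lra.
rewrite (ltr0_norm b0).
have [ab|ab] := leP 0 (a + b); first by rewrite ger0_norm//; nra.
rewrite ltr0_norm//.
(* When [a + b < 0] the right side exceeds the left by [2 * a * (a ^+ 2 + 3 * a * b + 3 * b ^+ 2)],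
   which is half of [a * (2 * a + 3 * b) ^+ 2] plus [3 / 2 * a * b ^+ 2]. *)
have := mulr_ge0 a0 (sqr_ge0 (2 * a + 3 * b)); have := mulr_ge0 a0 (sqr_ge0 b); lra.
Qed.

(** * Integrability of powers up to the third *)

Section integrability.
Context d (T : measurableType d) (R : realType) (P : probability T R).
Implicit Types f g : T -> R.
Local Notation intg f := (P.-integrable [set: T] (EFin \o (f : T -> R))).

Lemma integrable_normr_le f g : measurable_fun setT f ->
  (forall w, `|f w| <= g w) -> intg g -> intg f.
Proof.
move=> mf fg ig; apply: (@le_integrable _ _ _ _ _ _ _ (EFin \o g)) => //.
  exact/measurable_EFinP.
move=> w _; rewrite /= lee_fin; apply: le_trans (fg w) _; exact: ler_norm.
Qed.

Lemma integrable_bounded_fun f (M : R) : measurable_fun setT f ->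
  (forall w, `|f w| <= M) -> intg f.
Proof.
move=> mf fM; apply: (integrable_normr_le mf fM).
exact: finite_measure_integrable_cst.
Qed.

Lemma integrable_addr f g : intg f -> intg g -> intg (fun w => f w + g w).
Proof. by move=> hf hg; exact: (integrableD measurableT hf hg). Qed.

Lemma integrable_mull f (c : R) : intg f -> intg (fun w => c * f w).
Proof. by move=> hf; exact: (integrableZl measurableT c hf). Qed.

Lemma Rintegral_cst1 (c : R) : \int[P]_w c = c.
Proof. by rewrite Rintegral_cst// -[X in _ * X]/(fine (P setT)) probability_setT mulr1. Qed.

Definition cube_integrable f := measurable_fun setT f /\ intg (fun w => `|f w| ^+ 3).

Lemma cube_integrableD f g : cube_integrable f -> cube_integrable g ->
  cube_integrable (fun w => f w + g w).
Proof.
move=> [mf f3] [mg g3]; split; first exact: measurable_funD.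
apply: (@integrable_normr_le _ (fun w => 4 * `|f w| ^+ 3 + 4 * `|g w| ^+ 3)).
- apply: measurable_funX; apply: measurableT_comp => //; exact: measurable_funD.
- move=> w; rewrite ger0_norm ?exprn_ge0//.
  rewrite (@le_trans _ _ ((`|f w| + `|g w|) ^+ 3))//.
    by rewrite lerXn2r ?nnegrE ?addr_ge0// ler_normD.
  have := normr_ge0 (f w); have := normr_ge0 (g w).
  move: `|f w| `|g w| => x y x0 y0.
  (* [4 * (x ^+ 3 + y ^+ 3) - (x + y) ^+ 3] equals [3 * (x + y) * (x - y) ^+ 2]. *)
  have := mulr_ge0 (addr_ge0 x0 y0) (sqr_ge0 (x - y)); lra.
- by apply: integrable_addr; exact: integrable_mull.
Qed.

Lemma cube_integrable_cst (c : R) : cube_integrable (fun=> c).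
Proof. by split=> //; exact: finite_measure_integrable_cst. Qed.

Lemma cube_integrable_le f g : measurable_fun setT g ->
  (forall w, `|g w| <= 1 + `|f w| ^+ 3) -> cube_integrable f -> intg g.
Proof.
move=> mg gf [mf f3]; apply: (integrable_normr_le mg gf).
apply: integrable_addr => //; exact: finite_measure_integrable_cst.
Qed.

Lemma cube_integrable1 f : cube_integrable f -> intg f.
Proof.
move=> [mf f3]; apply: (@cube_integrable_le f) => // w.
have := normr_ge0 (f w); move: `|f w| => x x0; have [x1|x1] := leP x 1.
  by rewrite (le_trans x1)// lerDl exprn_ge0.
have : x * 1 <= x * (x * x) by rewrite ler_wpM2l//; nra.
by rewrite !exprS expr0 !mulr1; lra.
Qed.

Lemma cube_integrable_norm f : cube_integrable f -> intg (fun w => `|f w|).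
Proof. by move=> /cube_integrable1 /integrable_norm. Qed.

Let sqr_le_cube (x : R) : x ^+ 2 <= 1 + `|x| ^+ 3.
Proof.
rewrite -real_normK ?num_real//.
have := normr_ge0 x; move: `|x| => {}x x0; have [x1|x1] := leP x 1.
  by rewrite ler_wpDr ?exprn_ge0 ?exprn_ile1.
by rewrite ler_wpDl// ler_eXn2l.
Qed.

Lemma cube_integrable2 f : cube_integrable f -> intg (fun w => f w ^+ 2).
Proof.
move=> [mf f3]; apply: (@cube_integrable_le f) => // [|w].
  exact: measurable_funX.
by rewrite ger0_norm ?sqr_ge0//; exact: sqr_le_cube.
Qed.

Lemma cube_integrable_signed2 f : cube_integrable f ->
  intg (fun w => f w * `|f w|).
Proof.
move=> [mf f3]; apply: (@cube_integrable_le f) => // [|w].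
  by apply: measurable_funM => //; exact: measurableT_comp.
by rewrite normrM normr_id -expr2 real_normK ?num_real//; exact: sqr_le_cube.
Qed.

End integrability.

(** * Sums of centred samples *)

Section centered_sums.
Context d (T : measurableType d) (R : realType) (P : probability T R).
Variable Xs : nat -> {mfun T >-> R}.
Implicit Types (mu s beta : R).
Local Notation intg f := (P.-integrable [set: T] (EFin \o (f : T -> R))).

(** All that the limit theorems below use of the samples: independence and common moments. Identical
    distribution enters only when [iid_centered] builds this record. *)
Record centered_iid mu s beta : Prop := CenteredIid {
  ciid_indep : mutually_independent P Xs;
  ciid_sd_gt0 : 0 < s;
  ciid_cube : forall i, cube_integrable P (fun w => Xs i w - mu);
  ciid_mean : forall i, \int[P]_w (Xs i w - mu) = 0;
  ciid_var : forall i, \int[P]_w ((Xs i w - mu) ^+ 2) = s ^+ 2;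
  ciid_abs3 : forall i, \int[P]_w (`|Xs i w - mu| ^+ 3) = beta }.

Definition csum mu (a b : nat) (w : T) : R := \sum_(a <= i < b) (Xs i w - mu).

Variables (mu s beta : R).
Hypothesis H : centered_iid mu s beta.

Let indep := ciid_indep H.

Lemma samples_measurable_centered J i : J i ->
  samples_measurable Xs J (fun w => Xs i w - mu).
Proof.
move=> Ji; apply: (@measurable_funB _ (g_sigma_algebraType (cylinders Xs J))).
  exact: samples_measurable_id.
exact: measurable_cst.
Qed.

Lemma samples_measurable_sum J (r : seq nat) (Q : pred nat) :
  (forall i, i \in r -> Q i -> J i) ->
  samples_measurable Xs J (fun w => \sum_(i <- r | Q i) (Xs i w - mu)).
Proof.
move=> rJ; rewrite /samples_measurable.
under eq_fun do rewrite big_seq_cond big_mkcond/=.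
apply: (@measurable_sum _ (g_sigma_algebraType (cylinders Xs J))) => i.
have [/andP[ir Qi]|_] := boolP ((i \in r) && Q i); last exact: measurable_cst.
by apply: samples_measurable_centered; exact: rJ.
Qed.

Lemma samples_measurable_csum (J : set nat) (a b : nat) :
  (forall i, (a <= i < b)%N -> J i) -> samples_measurable Xs J (csum mu a b).
Proof.
by move=> abJ; apply: samples_measurable_sum => i; rewrite mem_index_iota => /abJ.
Qed.

Lemma cube_integrable_sum (r : seq nat) (Q : pred nat) :
  cube_integrable P (fun w => \sum_(i <- r | Q i) (Xs i w - mu)).
Proof.
elim: r => [|i r ih].
  under eq_fun do rewrite big_nil; exact: cube_integrable_cst.
under eq_fun do rewrite big_cons; have [_|//] := boolP (Q i).
by apply: cube_integrableD => //; exact: ciid_cube H i.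
Qed.

Lemma cube_integrable_csum (a b : nat) : cube_integrable P (csum mu a b).
Proof. exact: cube_integrable_sum. Qed.

Lemma csum_recr (a b : nat) : (a <= b)%N ->
  csum mu a b.+1 = fun w => csum mu a b w + (Xs b w - mu).
Proof. by move=> ab; apply/funext => w; rewrite /csum big_nat_recr. Qed.

Lemma csum_sub (a b : nat) w : (a <= b)%N ->
  csum mu 0 b w - csum mu 0 a w = csum mu a b w.
Proof. by move=> ab; rewrite /csum (big_cat_nat _ ab)//= addrAC subrr add0r. Qed.

Let csum_indep (a b : nat) (f g : R -> R) :
  measurable_fun setT f -> measurable_fun setT g ->
  intg (fun w => f (csum mu a b w)) -> intg (fun w => g (Xs b w - mu)) ->
  intg (fun w => f (csum mu a b w) * g (Xs b w - mu)) /\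
  \int[P]_w (f (csum mu a b w) * g (Xs b w - mu)) =
  (\int[P]_w f (csum mu a b w)) * \int[P]_w g (Xs b w - mu).
Proof.
move=> mf mg; apply: (@samples_integrableM _ _ _ P Xs indep
  [set i | (i < b)%N] [set i | (b <= i)%N]).
- by rewrite -subset0 => i /= [ib bi]; move: (leq_trans ib bi); rewrite ltnn.
- apply: (@measurableT_comp _ _ _ (g_sigma_algebraType _) _ _ f) => //.
  by apply: samples_measurable_csum => i /andP[_].
- apply: (@measurableT_comp _ _ _ (g_sigma_algebraType _) _ _ g) => //.
  by apply: samples_measurable_centered => /=.
Qed.

Lemma csum_var (a n : nat) : \int[P]_w (csum mu a (a + n) w ^+ 2) = n%:R * s ^+ 2.
Proof.
elim: n => [|n ih].
  rewrite addn0 /csum; under eq_Rintegral do rewrite big_geq// expr0n/=.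
  by rewrite Rintegral_cst1 mul0r.
rewrite addnS csum_recr ?leq_addr//.
have iS := cube_integrable_csum a (a + n).
have iX := ciid_cube H (a + n).
have mid : measurable_fun [set: R] (@id R) by exact: measurable_id.
have [ip Ep] := @csum_indep a (a + n) id id mid mid
  (cube_integrable1 iS) (cube_integrable1 iX).
under eq_Rintegral do rewrite sqrrD -mulr_natl -addrA.
rewrite RintegralD//; last 2 first.
- exact: cube_integrable2.
- by apply: integrable_addr; [exact: integrable_mull|exact: cube_integrable2].
rewrite RintegralD//; last 2 first.
- exact: integrable_mull.
- exact: cube_integrable2.
rewrite RintegralZl// Ep ih (ciid_mean H) mulr0 mulr0 add0r (ciid_var H).
by rewrite -[n.+1%:R]natr1; ring.
Qed.

Lemma csum_abs (a n : nat) : \int[P]_w `|csum mu a (a + n) w| <= s * Num.sqrt n%:R.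
Proof.
have s0 := ciid_sd_gt0 H.
have iS := cube_integrable_csum a (a + n).
have [->|n0] := posnP n.
  rewrite addn0 /csum; under eq_Rintegral do rewrite big_geq// normr0.
  by rewrite Rintegral_cst1 sqrtr0 mulr0.
have r0 : 0 < Num.sqrt n%:R :> R by rewrite sqrtr_gt0 ltr0n.
have rr : Num.sqrt n%:R ^+ 2 = n%:R :> R by rewrite sqr_sqrtr.
have c0 : 0 < s * Num.sqrt n%:R by rewrite mulr_gt0.
set c := s * _ in c0 *.
(* AM-GM: [2 c |x| <= x ^ 2 + c ^ 2] *)
apply: (@le_trans _ _ (\int[P]_w ((2 * c)^-1 * csum mu a (a + n) w ^+ 2 + c / 2))).
  apply: le_Rintegral => //.
  - exact: cube_integrable_norm.
  - apply: integrable_addr; last exact: finite_measure_integrable_cst.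
    by apply: integrable_mull; exact: cube_integrable2.
  - move=> w _; rewrite -(@ler_pM2l _ (2 * c)) ?mulr_gt0//.
    have := sqr_ge0 (`|csum mu a (a + n) w| - c).
    rewrite mulrDr [_ * (_^-1 * _)]mulVKf ?gt_eqF ?mulr_gt0// sqrrB real_normK ?num_real//.
    by move: (csum mu _ _ w) => x; rewrite -mulr_natl; lra.
rewrite RintegralD//; last 2 first.
- by apply: integrable_mull; exact: cube_integrable2.
- exact: finite_measure_integrable_cst.
rewrite [X in X + _]RintegralZl//; last by exact: (cube_integrable2 iS).
rewrite csum_var Rintegral_cst1 -rr -exprMn [Num.sqrt _ * s]mulrC -/c.
rewrite (_ : _ + _ = c)//; field; exact: lt0r_neq0.
Qed.

(** Induction through [normr_cubeD]: by independence the linear term has mean 0 and the quadratic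
    one has mean [3 * s ^+ 2] times the mean of [|S_n|], hence at most [3 * s ^+ 3 * sqrt n]; the
    last one contributes [beta]. *)
Lemma csum_cube (n : nat) : \int[P]_w (`|csum mu 0 n w| ^+ 3) <=
  n%:R * (3 * s ^+ 3 * Num.sqrt n%:R + beta).
Proof.
have s0 := ciid_sd_gt0 H.
elim: n => [|n ih].
  rewrite /csum; under eq_Rintegral do rewrite big_geq// normr0 expr0n/=.
  by rewrite Rintegral_cst1 mul0r.
have iS := cube_integrable_csum 0 n.
have iX := ciid_cube H n.
have mnorm : measurable_fun setT (fun x : R => x * `|x|).
  by apply: measurable_funM => //; exact: measurableT_comp.
have mid : measurable_fun [set: R] (@id R) by exact: measurable_id.
have [ip Ep] := @csum_indep 0 n _ id mnorm mid
  (cube_integrable_signed2 iS) (cube_integrable1 iX).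
have msq : measurable_fun setT (fun x : R => x ^+ 2) by exact: measurable_funX.
have mn : measurable_fun setT (fun x : R => `|x|) by exact: measurableT_comp.
have [iq Eq] := @csum_indep 0 n _ _ mn msq
  (cube_integrable_norm iS) (cube_integrable2 iX).
apply: (@le_trans _ _ (\int[P]_w (`|csum mu 0 n w| ^+ 3 +
  (3 * (csum mu 0 n w * `|csum mu 0 n w| * (Xs n w - mu)) +
  (3 * (`|csum mu 0 n w| * (Xs n w - mu) ^+ 2) + `|Xs n w - mu| ^+ 3))))).
  apply: le_Rintegral => //.
  - exact: (cube_integrable_csum _ _).2.
  - apply: integrable_addr; first exact: iS.2.
    apply: integrable_addr; first exact: integrable_mull.
    by apply: integrable_addr; [exact: integrable_mull|exact: iX.2].
  - move=> w _; rewrite csum_recr//; apply: le_trans (normr_cubeD _ _) _.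
    by rewrite !addrA !mulrA.
rewrite RintegralD//; last 2 first.
- exact: iS.2.
- apply: integrable_addr; first exact: integrable_mull.
  by apply: integrable_addr; [exact: integrable_mull|exact: iX.2].
rewrite RintegralD//; last 2 first.
- exact: integrable_mull.
- by apply: integrable_addr; [exact: integrable_mull|exact: iX.2].
rewrite RintegralD//; last 2 first.
- exact: integrable_mull.
- exact: iX.2.
rewrite !RintegralZl// Ep Eq (ciid_mean H) (ciid_var H) (ciid_abs3 H) !mulr0 add0r.
have := csum_abs 0 n; rewrite add0n; move: (\int[P]_w `|csum mu 0 n w|) => y yn.
have sS : Num.sqrt n%:R <= Num.sqrt n.+1%:R :> R by rewrite ler_sqrt ?ler_nat// ltr0n.
have : y * s ^+ 2 <= s * Num.sqrt n%:R * s ^+ 2 by rewrite ler_wpM2r ?sqr_ge0.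
have : n.+1%:R * (3 * s ^+ 3) * Num.sqrt n%:R <= n.+1%:R * (3 * s ^+ 3) * Num.sqrt n.+1%:R.
  by rewrite ler_wpM2l// mulr_ge0// mulr_ge0// exprn_ge0// ltW.
move: ih yn sS; rewrite -[n.+1%:R]natr1.
set r : R := Num.sqrt n%:R; set r' : R := Num.sqrt _; set z : R := \int[P]_w _.
move: r r' z (n%:R) => r r' z N; lra.
Qed.

End centered_sums.

Section comparison_sets.
Context d (T : measurableType d) (R : realType) (f g : T -> R).
Hypotheses (mf : measurable_fun setT f) (mg : measurable_fun setT g).

Lemma measurable_set_ler : measurable [set w | f w <= g w].
Proof.
have mt : measurable [set true] by [].
by have := measurable_fun_ler mf mg measurableT mt; rewrite setTI.
Qed.

Lemma measurable_set_ltr : measurable [set w | f w < g w].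
Proof.
have mt : measurable [set true] by [].
by have := measurable_fun_ltr mf mg measurableT mt; rewrite setTI.
Qed.

End comparison_sets.

Section markov.
Context d (T : measurableType d) (R : realType) (P : probability T R).

Lemma markov_Rintegral (f : T -> R) (c : R) : 0 < c ->
  P.-integrable [set: T] (EFin \o f) -> (forall w, 0 <= f w) ->
  (P [set w | c <= f w]%R <= (c^-1 * \int[P]_w f w)%:E)%E.
Proof.
move=> c0 fi f0; have mf : measurable_fun setT f.
  by apply/measurable_EFinP; exact: measurable_int fi.
have mA : measurable [set w | c <= f w].
  exact: measurable_set_ler.
have -> : P [set w | c <= f w] = (\int[P]_w \1_[set w | c <= f w] w)%:E.
  rewrite /Rintegral integral_indic// setIT fineK//.
  exact: (fin_num_measure P).
rewrite lee_fin -RintegralZl//; apply: le_Rintegral => //.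
- exact: integrable_indic.
- exact: integrable_mull.
- move=> w _; rewrite indicE; have [|_] := boolP (w \in _).
    by rewrite inE/= => cf; rewrite ler_pdivlMl// mulr1.
  by rewrite mulr_ge0// invr_ge0 ltW.
Qed.

End markov.

(** * Complete convergence of the sample means *)

Section complete_convergence.
Context d (T : measurableType d) (R : realType) (P : probability T R).
Variables (Xs : nat -> {mfun T >-> R}) (mu s beta : R).
Hypothesis H : centered_iid P Xs mu s beta.

Lemma sample_mean_csum n w : (0 < n)%N ->
  sample_mean Xs n w - mu = csum Xs mu 0 n w / n%:R.
Proof.
move=> n0; rewrite /sample_mean /csum big_mkord sumrB sumr_const card_ord.
by rewrite mulrBl -[mu *+ n]mulr_natr mulfK// pnatr_eq0 -lt0n.
Qed.

Lemma measurable_sample_mean n : measurable_fun [set: T] (sample_mean Xs n).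
Proof. by apply: measurable_funM => //; exact: measurable_sum. Qed.

Definition mean_far (g : R) (n : nat) : set T :=
  [set w | g < `|sample_mean Xs n w - mu|].

Lemma measurable_mean_far n (g : R) :
  measurable (mean_far g n).
Proof.
apply: measurable_set_ltr => //; apply: measurableT_comp => //; apply: measurable_funB => //.
exact: measurable_sample_mean.
Qed.

(** Markov's inequality for the third moment: a moment of order n^(3/2) is divided by n^3. *)
Lemma sample_mean_tail n (g : R) : (0 < n)%N -> 0 < g ->
  (P (mean_far g n) <=
   ((3 * s ^+ 3 + beta) / g ^+ 3 / (n%:R * Num.sqrt n%:R))%:E)%E.
Proof.
move=> n0 g0; have n0' : 0 < n%:R :> R by rewrite ltr0n.
have c0 : 0 < (g * n%:R) ^+ 3 by rewrite exprn_gt0// mulr_gt0.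
have iS := cube_integrable_csum H 0 n.
apply: (@le_trans _ _ (P [set w | (g * n%:R) ^+ 3 <= `|csum Xs mu 0 n w| ^+ 3]%R)).
  apply: le_measure; rewrite ?inE//.
  - exact: measurable_mean_far.
  - apply: measurable_set_ler => //; apply: measurable_funX; apply: measurableT_comp => //; by exact: iS.1.
  - move=> w; rewrite /mean_far /= sample_mean_csum// normrM [ `|n%:R^-1| ]ger0_norm//.
    rewrite ltr_pdivlMr// => /ltW h.
    by rewrite lerXn2r ?nnegrE ?mulr_ge0// ltW.
have := markov_Rintegral c0 iS.2 (fun w => exprn_ge0 3 (normr_ge0 _)).
move/le_trans; apply; rewrite lee_fin.
have s0 := ciid_sd_gt0 H.
have beta0 : 0 <= beta.
  by rewrite -(ciid_abs3 H 0); apply: Rintegral_ge0 => w _; rewrite exprn_ge0.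
have r0 : 0 < Num.sqrt n%:R :> R by rewrite sqrtr_gt0.
have rr : Num.sqrt n%:R ^+ 2 = n%:R :> R by rewrite sqr_sqrtr.
have r1 : 1 <= Num.sqrt n%:R :> R by rewrite -[leLHS]sqrtr1 ler_sqrt// ler1n.
apply: (@le_trans _ _ (((g * n%:R) ^+ 3)^-1 *
   (n%:R * (3 * s ^+ 3 * Num.sqrt n%:R + beta * Num.sqrt n%:R)))).
  rewrite ler_pM2l ?invr_gt0//; apply: le_trans (csum_cube H n) _.
  by rewrite ler_pM2l// lerD2l ler_peMr.
rewrite le_eqVlt; apply/orP; left; apply/eqP.
move: rr r0; move: (Num.sqrt n%:R) => r <- r0; field.
by rewrite !gt_eqF.
Qed.

(** Meant for [a = sqrt n] and [b = sqrt (n + 1)]: the difference of inverses is the inverse of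
    [(a + b) * (a * b)], and [a <= b]. It turns the sum of the (n+1)^(-3/2) into a telescoping
    one. *)
Let inv_cube_le (a b : R) : 0 < a -> 0 < b -> b ^+ 2 = a ^+ 2 + 1 ->
  (b ^+ 2 * b)^-1 <= 2 * (a^-1 - b^-1).
Proof.
move=> a0 b0 ba.
have ab : a <= b by rewrite -(@ler_pXn2r _ 2) ?nnegrE ?ltW// ba; lra.
have -> : a^-1 - b^-1 = ((a + b) * (a * b))^-1.
  have : (b - a) * (a + b) = 1 by lra.
  have abn0 : a + b != 0 by rewrite gt_eqF// addr_gt0.
  move=> h; have {}h : b - a = (a + b)^-1 by apply: (mulIf abn0); rewrite h mulVf.
  by rewrite invfM -h; field; rewrite !gt_eqF.
rewrite -[leLHS]mul1r -ler_pdivrMr ?invr_gt0 ?mulr_gt0 ?addr_gt0// invrK.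
rewrite mul1r ler_pdivrMl ?mulr_gt0 ?exprn_gt0//.
have : 0 <= a * (b - a) by rewrite mulr_ge0 ?subr_ge0// ltW.
move/(mulr_ge0 (ltW b0)); have : 0 <= b * b * (b - a) by rewrite !mulr_ge0 ?subr_ge0// ltW.
lra.
Qed.

Lemma complete_convergence (g : R) : 0 < g ->
  (\sum_(k <oo) P (mean_far g k) < +oo)%E.
Proof.
move=> g0; pose C := (3 * s ^+ 3 + beta) / g ^+ 3.
have C0 : 0 <= C.
  apply: divr_ge0; last by rewrite exprn_ge0 ?ltW.
  apply: addr_ge0; first by rewrite mulr_ge0// exprn_ge0// ltW// (ciid_sd_gt0 H).
  by rewrite -(ciid_abs3 H 0); apply: Rintegral_ge0 => w _; rewrite exprn_ge0.
pose p k := P (mean_far g k).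
(* The 2 covers the terms of index 0 and 1 by the trivial bound on probabilities; the rest
   telescopes. *)
have bound n : (\sum_(0 <= k < n.+2) p k <=
    (2 + 2 * C * (1 - (Num.sqrt n.+1%:R)^-1))%:E)%E.
  elim: n => [|n ih].
    rewrite big_nat_recr//= big_nat1 sqrtr1 invr1 subrr mulr0 addr0.
    rewrite (_ : 2%:E = 1 + 1)%E; last by rewrite -EFinD.
    by apply: leeD; apply: probability_le1; exact: measurable_mean_far.
  rewrite big_nat_recr//=; apply: le_trans (leeD ih (sample_mean_tail _ g0)) _ => //.
  rewrite -EFinD lee_fin -/C.
  have a0 : 0 < Num.sqrt n.+1%:R :> R by rewrite sqrtr_gt0 ltr0n.
  have b0 : 0 < Num.sqrt n.+2%:R :> R by rewrite sqrtr_gt0 ltr0n.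
  have aa : Num.sqrt n.+1%:R ^+ 2 = n.+1%:R :> R by rewrite sqr_sqrtr.
  have bb : Num.sqrt n.+2%:R ^+ 2 = n.+2%:R :> R by rewrite sqr_sqrtr.
  have := inv_cube_le a0 b0; rewrite aa bb natr1 => /(_ erefl).
  move/(ler_wpM2l C0); move: (_^-1) (_^-1) (_^-1) => x y z; lra.
apply: (@le_lt_trans _ _ (2 + 2 * C)%:E); last exact: ltry.
apply: lime_le; first by apply: is_cvg_nneseries.
near=> n; have n2 : (n = n.-2.+2)%N.
  by rewrite -subn2 -addn2 subnK//; near: n; exists 2.
rewrite n2; apply: le_trans (bound _) _; rewrite lee_fin.
have : 0 <= (Num.sqrt n.-2.+1%:R)^-1 :> R by rewrite invr_ge0.
move/(mulr_ge0 C0); lra.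
Unshelve. all: by end_near. Qed.

End complete_convergence.

(** * Chebyshev's and Ottaviani's inequalities for partial sums *)

Section maximal_inequality.
Context d (T : measurableType d) (R : realType) (P : probability T R).
Variables (Xs : nat -> {mfun T >-> R}) (mu s beta : R).
Hypothesis H : centered_iid P Xs mu s beta.
Local Notation csum := (csum Xs mu).

Lemma csum_tail (a n : nat) (c : R) : 0 < c ->
  (P [set w | c <= `|csum a (a + n) w|]%R <= (n%:R * s ^+ 2 / c ^+ 2)%:E)%E.
Proof.
move=> c0; have iS := cube_integrable_csum H a (a + n).
apply: (@le_trans _ _ (P [set w | c ^+ 2 <= csum a (a + n) w ^+ 2]%R)).
  apply: le_measure; rewrite ?inE.
  - by apply: measurable_set_ler => //; apply: measurableT_comp => //; exact: iS.1.
  - by apply: measurable_set_ler => //; apply: measurable_funX; exact: iS.1.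
  - move=> w /= cw; rewrite -[leRHS]real_normK ?num_real//.
    by rewrite lerXn2r ?nnegrE// ltW.
have := markov_Rintegral (exprn_gt0 2 c0) (cube_integrable2 iS) (fun w => sqr_ge0 _).
by rewrite (csum_var H) mulrC.
Qed.

(* Ottaviani: at the first time [k] at which [|csum a k|] reaches [2 c], the
   independent remainder [csum k (a + n)] stays below [c] with probability at
   least 1/2, and then [|csum a (a + n)|] is at least [c]. *)
Lemma ottaviani (a n : nat) (c : R) : 0 < c -> 2 * (n%:R * s ^+ 2) <= c ^+ 2 ->
  (P [set w | exists2 i, (i <= n)%N & (2 * c <= `|csum a (a + i) w|)%R] <=
   (2 * (n%:R * s ^+ 2 / c ^+ 2))%:E)%E.
Proof.
move=> c0 nc; have c20 : 0 < c ^+ 2 by rewrite exprn_gt0.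
pose D i := [set w | 2 * c <= `|csum a (a + i) w|].
pose G i := [set w | `|csum (a + i) (a + n) w| < c].
pose past i := cylinders Xs [set j | (j < a + i)%N].
have sD i j : (j <= i)%N -> @measurable _ (g_sigma_algebraType (past i)) (D j).
  move=> ji; apply: (@measurable_set_ler _ (g_sigma_algebraType (past i)) R (fun=> 2 * c)).
    exact: measurable_cst.
  apply: (@measurableT_comp _ _ _ (g_sigma_algebraType (past i))) => //.
  by apply: samples_measurable_csum => k /andP[_ /leq_trans]; apply; rewrite leq_add2l.
(* [seqDU D i] says that [i] is the first index at which [D] holds. It is decided by the samples
   before [a + i], whereas [G i] involves only those from [a + i] on. *)
have sF i : @measurable _ (g_sigma_algebraType (past i)) (seqDU D i).
  apply: (@measurableD _ (g_sigma_algebraType (past i))); first exact: sD.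
  by apply: (@bigsetU_measurable _ (g_sigma_algebraType (past i))) => j _; apply: sD; exact: ltnW.
have sG i : @measurable _ (g_sigma_algebraType (cylinders Xs [set j | (a + i <= j)%N])) (G i).
  set GT := g_sigma_algebraType _.
  apply: (@measurable_set_ltr _ GT R (fun w => `|csum (a + i) (a + n) w|)).
    apply: (@measurableT_comp _ _ _ GT) => //.
    by apply: samples_measurable_csum => k /andP[].
  exact: measurable_cst.
have FG i : [/\ measurable (seqDU D i), measurable (G i) &
    (P (seqDU D i `&` G i) = P (seqDU D i) * P (G i))%E].
  apply: (@g_sigma_cylinders_indep _ _ _ P Xs (ciid_indep H) [set j | (j < a + i)%N]
    [set j | (a + i <= j)%N]); [|exact: sF|exact: sG].
  by rewrite -subset0 => j /= [ji ij]; move: (leq_trans ji ij); rewrite ltnn.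
have mF i : measurable (seqDU D i) by have [] := FG i.
have mG i : measurable (G i) by have [] := FG i.
have PG i : (i <= n)%N -> (2^-1%:E <= P (G i))%E.
  move=> ik; rewrite -(setCK (G i)) probability_setC; last exact: measurableC.
  have -> : ~` G i = [set w | c <= `|csum (a + i) (a + n) w|].
    by apply/seteqP; split=> w; rewrite /G /= leNgt => /negP.
  have := csum_tail (a + i) (n - i) c0; rewrite -addnA subnKC// => tl.
  apply: le_trans (leeB (lexx 1%E) tl).
  rewrite -EFinB lee_fin.
  have : (n - i)%:R * s ^+ 2 / c ^+ 2 <= 2^-1.
    rewrite ler_pdivrMr//; have : (n - i)%:R * s ^+ 2 <= n%:R * s ^+ 2.
      by rewrite ler_wpM2r ?sqr_ge0// ler_nat leq_subr.
    lra.
  lra.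
have -> : [set w | exists2 i, (i <= n)%N & 2 * c <= `|csum a (a + i) w|] =
    \big[setU/set0]_(i < n.+1) seqDU D i.
  rewrite -bigsetU_seqDU -bigcup_mkord; apply/seteqP; split=> w.
    by move=> [i ik Di]; exists i.
  by move=> [i /= ik Di]; exists i.
rewrite (measure_bigsetU _ mF); last exact: trivIset_seqDU.
have -> : (2 * (n%:R * s ^+ 2 / c ^+ 2))%:E = (2%:E * (n%:R * s ^+ 2 / c ^+ 2)%:E)%E.
  by rewrite -EFinM.
apply: (@le_trans _ _ (2%:E * P (\big[setU/set0]_(i < n.+1) (seqDU D i `&` G i)))%E).
  rewrite (@measure_bigsetU _ _ _ _ (fun i => seqDU D i `&` G i)); last 2 first.
  - by move=> i; exact: measurableI.
  - exact/trivIset_setIr/trivIset_seqDU.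
  rewrite ge0_sume_distrr//; apply: lee_sum => i _.
  rewrite [X in (_ <= 2%:E * X)%E](_ : _ = P (seqDU D i) * P (G i))%E; last first.
    by have [] := FG i.
  have PGi : (1 <= 2%:E * P (G i))%E.
    rewrite (_ : 1 = 2%:E * 2^-1%:E)%E; last by rewrite -EFinM mulfV.
    by apply: lee_wpmul2l => //; apply: PG; rewrite -ltnS.
  rewrite muleCA -[leLHS]mule1; exact: lee_wpmul2l.
apply: lee_pmul => //; apply: le_trans (csum_tail a n c0); apply: le_measure.
- by rewrite inE; apply: bigsetU_measurable => i _; exact: measurableI.
- rewrite inE; apply: measurable_set_ler => //; apply: measurableT_comp => //.
  exact: (cube_integrable_csum H _ _).1.
rewrite -(bigcup_mkord _ (fun i => seqDU D i `&` G i)) => w [i /= ik [Fw Gw]] /=.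
have Dw := subset_seqDU Fw; move: Dw Gw; rewrite /D /G /= => Dw Gw.
have E : csum a (a + n) w = csum a (a + i) w + csum (a + i) (a + n) w.
  by rewrite /csum -big_cat_nat//= ?leq_addr// leq_add2l.
rewrite E; move: Dw Gw; move: (csum a (a + i) w) (csum (a + i) _ w) => x y.
by have := ler_normB (x + y) y; rewrite addrK; lra.
Qed.

End maximal_inequality.

(** * The central limit theorem *)

Section calculus.
Context (R : realType).
Implicit Types f g h : R -> R.

Lemma lipschitz_continuous h (K : R) :
  (forall x y, `|h x - h y| <= K * `|x - y|) -> continuous h.
Proof.
move=> hK x; apply/cvgrPdist_lt => e e0.
have K0 : 0 < `|K| + 1 by rewrite ltr_wpDl.
apply/nbhs_ballP; exists (e / (`|K| + 1)) => [|y]; first exact: divr_gt0.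
rewrite /ball/= ltr_pdivlMr// mulrC; apply: le_lt_trans.
by apply: le_trans (hK x y) _; rewrite ler_wpM2r// (le_trans (ler_norm K))// lerDl.
Qed.

(** The distance form of the location of [c] covers both orders of [x] and [y]. *)
Lemma mean_value f g (x y : R) : (forall x : R, is_derive x 1 f (g x)) ->
  exists2 c, `|c - x| <= `|y - x| & f y - f x = g c * (y - x).
Proof.
move=> fg; have cf : continuous f.
  by move=> z; apply: differentiable_continuous; apply/derivable1_diffP; case: (fg z).
have [xy|/ltW yx] := leP x y.
  have [c] := MVT_segment xy (fun x _ => fg x) (continuous_subspaceT cf).
  rewrite in_itv/= => /andP[xc cy] fE; exists c => //.
  by rewrite !ger0_norm ?subr_ge0 ?lerB.
have [c] := MVT_segment yx (fun x _ => fg x) (continuous_subspaceT cf).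
rewrite in_itv/= => /andP[xc cy] fE; exists c; last by rewrite -opprB fE -mulrN opprB.
by rewrite !ler0_norm ?subr_le0// !opprB lerB.
Qed.

Lemma derive_bounded_lipschitz f g (K : R) : (forall x : R, is_derive x 1 f (g x)) ->
  (forall x, `|g x| <= K) -> forall x y, `|f x - f y| <= K * `|x - y|.
Proof.
move=> fg gK x y; have [c _ ->] := mean_value y x fg.
by rewrite normrM ler_wpM2r.
Qed.

(** A single use of the mean value theorem suffices; it costs a factor 2 over the optimal [K / 2],
    which is harmless for a convergence statement. *)
Lemma taylor1_lipschitz f g (K : R) : (forall x : R, is_derive x 1 f (g x)) ->
  (forall x y, `|g x - g y| <= K * `|x - y|) ->
  forall x t, `|f (x + t) - f x - t * g x| <= K * t ^+ 2.
Proof.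
move=> fg gK x t; have [c] := mean_value x (x + t) fg.
rewrite addrAC subrr add0r => ct ->.
rewrite [t * _]mulrC -mulrBl normrM -[t ^+ 2]real_normK ?num_real// expr2 mulrA.
rewrite ler_wpM2r//; apply: le_trans (gK c x) _.
have K0 : 0 <= K by have := le_trans (normr_ge0 _) (gK 1 0); rewrite subr0 normr1 mulr1.
by rewrite ler_wpM2l.
Qed.

Lemma is_derive_measurable f g : (forall x : R, is_derive x 1 f (g x)) ->
  measurable_fun [set: R] f.
Proof.
move=> fg; apply: continuous_measurable_fun => z.
by apply: differentiable_continuous; apply/derivable1_diffP; case: (fg z).
Qed.

End calculus.

(** * Stein's equation for the standard normal law *)

Section stein_equation.
Context (R : realType).
Local Notation phi := (@normal_pdf R 0 1).
Local Notation lebesgue := (@lebesgue_measure R).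

Record test_fun (h : R -> R) (B M K : R) : Prop := TestFun {
  test_supp : forall x, B <= `|x| -> h x = 0;
  test_bound : forall x, `|h x| <= M;
  test_lip : forall x y, `|h x - h y| <= K * `|x - y| }.

Let peak : R := normal_peak 1.
Let peak_gt0 : 0 < peak. Proof. exact: normal_peak_gt0 (oner_neq0 _). Qed.

Lemma normal_pdf01E (x : R) : phi x = peak * expR (- (x ^+ 2 / 2)).
Proof. by rewrite normal_pdfE ?oner_neq0// /normal_fun subr0 expr1n mulNr. Qed.

Lemma test_integrable (h : R -> R) (B M K : R) : test_fun h B M K ->
  lebesgue.-integrable setT (EFin \o (fun x => h x * phi x)).
Proof.
move=> [_ hM hK]; have i1 := integrable_normal_pdf 0 (1 : R).
have mh : measurable_fun setT h.
  exact: continuous_measurable_fun (lipschitz_continuous hK).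
apply: (@le_integrable _ _ _ lebesgue setT measurableT _ (fun x => M%:E * (phi x)%:E)%E) => //.
- by apply/measurable_EFinP; apply: measurable_funM => //; exact: measurable_normal_pdf.
- move=> x _; rewrite -[leRHS]/(`|M * phi x|%:E) lee_fin !normrM ler_wpM2r//.
  by rewrite (le_trans (hM x))// ler_norm.
- exact: integrableZl.
Qed.

(* Solves [f' - x f = h] by [f = (\int_-oo^x h phi) / phi]: since [h phi] has
   integral 0, [f] has compact support, hence all the bounds. *)
Lemma stein_solution (h : R -> R) (B M K : R) : 0 < B -> test_fun h B M K ->
  \int[lebesgue]_x (h x * phi x) = 0 ->
  exists (f g : R -> R) (M' K' : R),
    [/\ forall x : R, is_derive x 1 f (g x), forall x, `|f x| <= M',
        forall x, `|g x| <= M', forall x y, `|g x - g y| <= K' * `|x - y| &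
        forall x, g x - x * f x = h x].
Proof.
move=> B0 ht hphi; have ih := test_integrable ht; have [hs hM hK] := ht.
have M0 : 0 <= M := le_trans (normr_ge0 _) (hM 0).
have K0 : 0 <= K by have := le_trans (normr_ge0 _) (hK 1 0); rewrite subr0 normr1 mulr1.
pose F (x : R) : R := \int[lebesgue]_(t in `]-oo, x]) (h t * phi t).
have ihx (x : R) : lebesgue.-integrable `]-oo, x] (EFin \o (fun x => h x * phi x)).
  exact: integrableS ih.
have dF (x : R) : is_derive x 1 F (h x * phi x).
  have xx1 : x < x + 1 by rewrite ltrDl.
  have ch : {for x, continuous (fun x : R => h x * phi x)}.
    apply: continuousM; first exact: lipschitz_continuous hK x.
    exact: continuous_normal_pdf.
  have FTC := continuous_FTC1 xx1 (ihx (x + 1)).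
  have [dFx F'x] : derivable F x 1 /\ F^`()%classic x = h x * phi x.
    by apply: FTC => //; rewrite ltNyr.
  by apply: DeriveDef; [exact: dFx|rewrite -derive1E; exact: F'x].
have FM (x : R) : `|F x| <= M.
  apply: le_trans (le_normr_Rintegral _ (ihx x)) _ => //.
  apply: (@le_trans _ _ (\int[lebesgue]_(t in `]-oo, x]) (M * phi t))).
    apply: le_Rintegral => //.
    - exact: (integrable_norm (ihx x)).
    - apply: (@integrableS _ _ _ _ setT) => //.
      by apply: (integrableZl measurableT M (integrable_normal_pdf 0 1)).
    - move=> t _; rewrite normrM [ `|phi t| ]ger0_norm ?normal_pdf_ge0//.
      by rewrite ler_wpM2r// normal_pdf_ge0.
  rewrite RintegralZl//; last by apply: integrableS (integrable_normal_pdf 0 1).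
  rewrite ler_piMr// -lee_fin /Rintegral.
  have := probability_le1 (normal_prob 0 (1 : R)) (measurable_itv `]-oo, x]).
  rewrite fineK// (@fin_num_measure _ _ _ (normal_prob 0 (1 : R)))//.
(* To the right of the support of [h] the integral is already the full one, which is 0; to the left
   the integrand vanishes. *)
have F0 (x : R) : B <= `|x| -> F x = 0.
  rewrite ler_normr => /orP[Bx|xB].
    rewrite -hphi /F Rintegral_mkcond; apply: eq_Rintegral => t _.
    rewrite patchE; case: ifPn => //; rewrite notin_setE /= in_itv/= => /negP.
    rewrite -ltNge => xt; rewrite hs ?mul0r// ler_normr; apply/orP; left.
    by rewrite (le_trans Bx)// ltW.
  rewrite /F -[RHS](@Rintegral_cst1 _ _ _ (normal_prob 0 (1 : R)) 0) Rintegral_cst// mul0r.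
  transitivity (\int[lebesgue]_(t in `]-oo, x]) (0 : R)).
    apply: eq_Rintegral => t; rewrite inE/= in_itv/= => tx.
    by rewrite hs ?mul0r// ler_normr lerNr (le_trans tx) ?orbT// lerNr.
  by rewrite Rintegral_cst ?mul0r.
(* [e] is the inverse of the normal density. It increases with the absolute value, so [e B] bounds
   it on the interval outside of which [F] vanishes. *)
pose e (x : R) : R := peak^-1 * expR (x ^+ 2 / 2).
have de (x : R) : is_derive x 1 e (x * e x).
  rewrite /e; apply: is_derive_eq.
  by rewrite /GRing.scale/=; field; rewrite gt_eqF.
have phie (x : R) : phi x * e x = 1.
  by rewrite normal_pdf01E /e mulrACA mulfV ?gt_eqF// mul1r -expRD addNr expR0.
pose f (x : R) : R := F x * e x; pose g (x : R) : R := h x + x * f x.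
have df (x : R) : is_derive x 1 f (g x).
  rewrite /f; apply: is_derive_eq; rewrite /GRing.scale/= /g /f.
  by rewrite [e x * _]mulrC -[h x * _ * _]mulrA phie mulr1; ring.
pose M1 := M * e B.
have e0 (x : R) : 0 <= e x by rewrite mulr_ge0 ?expR_ge0// invr_ge0 ltW.
have M10 : 0 <= M1 by rewrite mulr_ge0.
have f0 (x : R) : B <= `|x| -> f x = 0 by move=> /F0 Fx; rewrite /f Fx mul0r.
have fM (x : R) : `|f x| <= M1.
  have [/f0 ->|xB] := leP B `|x|; first by rewrite normr0.
  have eB : `|e x| <= e B.
    rewrite ger0_norm// -[e x]/(peak^-1 * expR (x ^+ 2 / 2)).
    rewrite -[e B]/(peak^-1 * expR (B ^+ 2 / 2)); apply: ler_wpM2l.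
      by rewrite invr_ge0; exact: ltW peak_gt0.
    rewrite ler_expR ler_pM2r ?invr_gt0//.
    by rewrite -(@real_normK _ x) ?num_real// lerXn2r ?nnegrE// ltW.
  by rewrite normrM; exact: ler_pM.
have xfM (x : R) : `|x * f x| <= B * M1.
  have [/f0 ->|/ltW xB] := leP B `|x|; first by rewrite mulr0 normr0 mulr_ge0// ltW.
  by rewrite normrM ler_pM.
have gM (x : R) : `|g x| <= M + B * M1 by apply: le_trans (ler_normD _ _) _; exact: lerD.
have xgM (x : R) : `|x * g x| <= B * (M + B * M1).
  have [Bx|/ltW xB] := leP B `|x|; last by rewrite normrM ler_pM.
  have B0' := ltW B0.
  have BM : 0 <= B * (M + B * M1).
    by apply: mulr_ge0 => //; apply: addr_ge0 => //; exact: mulr_ge0.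
  by rewrite /g hs// f0// mulr0 addr0 mulr0 normr0.
have dxf (x : R) : is_derive x 1 (fun x : R => x * f x) (f x + x * g x).
  by apply: is_derive_eq; rewrite /GRing.scale/=; ring.
(* The first constant bounds both [f] and [g]. The second bounds the slope of [g = h + x * f]: [K]
   for [h], and a bound on the derivative [f + x * g] for the other term. *)
exists f, g, (M1 + (M + B * M1)), (K + (M1 + B * (M + B * M1))); split => //.
- move=> x; rewrite ler_wpDr//; apply: addr_ge0 => //; apply: mulr_ge0 => //.
  exact: ltW.
- by move=> x; rewrite ler_wpDl.
- move=> x y; rewrite /g opprD addrACA mulrDl.
  apply: le_trans (ler_normD _ _) _; apply: lerD; first exact: hK.
  apply: derive_bounded_lipschitz => // z.
  by apply: le_trans (ler_normD _ _) _; exact: lerD.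
- by move=> x; rewrite /g addrK.
Qed.

End stein_equation.

(** * Stein's method for the normalized sums *)

Section stein_method.
Context d (T : measurableType d) (R : realType) (P : probability T R).
Variables (Xs : nat -> {mfun T >-> R}) (mu s beta : R).
Hypothesis H : centered_iid P Xs mu s beta.
Local Notation intg f := (P.-integrable [set: T] (EFin \o (f : T -> R))).
Local Notation lebesgue := (@lebesgue_measure R).

Definition normalized_sum (n : nat) (w : T) : R :=
  csum Xs mu 0 n w / (s * Num.sqrt n%:R).

Lemma measurable_normalized_sum n : measurable_fun setT (normalized_sum n).
Proof. by apply: measurable_funM => //; exact: (cube_integrable_csum H 0 n).1. Qed.

Let abs_centered_le i : \int[P]_w `|Xs i w - mu| <= s.
Proof.
have := csum_abs H i 1; rewrite sqrtr1 mulr1 addn1 /csum.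
by under eq_Rintegral do rewrite big_nat1.
Qed.

(** Leave-one-out step: [V] is the normalized sum without sample [i], [x] the contribution of that
    sample, and [(s / c) ^+ 2] the variance of [x]. The two error terms come from the Taylor
    remainder of [f] and from replacing [g (V + x)] by [g V]. *)
Let stein_step (f g : R -> R) (M K : R) (J : set nat) (i : nat) (V : T -> R) (c : R) :
  (forall x : R, is_derive x 1 f (g x)) -> (forall x, `|f x| <= M) ->
  (forall x, `|g x| <= M) -> (forall x y, `|g x - g y| <= K * `|x - y|) ->
  samples_measurable Xs J V -> ~ J i -> 0 < c ->
  let x w := c^-1 * (Xs i w - mu) in
  let h w := x w * f (V w + x w) - (s / c) ^+ 2 * g (V w + x w) in
  intg h /\
  `|\int[P]_w h w| <= K * beta / c ^+ 3 + K * (s / c) ^+ 3.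
Proof.
move=> fg fM gM gK mV Ji c0 x h.
have s0 := ciid_sd_gt0 H; have cube := ciid_cube H i.
have K0 : 0 <= K by have := le_trans (normr_ge0 _) (gK 1 0); rewrite subr0 normr1 mulr1.
have mf : measurable_fun [set: R] f := is_derive_measurable fg.
have mg : measurable_fun [set: R] g.
  exact: continuous_measurable_fun (lipschitz_continuous gK).
have mV' : measurable_fun setT V := samples_measurable_sub (ciid_indep H) mV.
have sx : samples_measurable Xs [set i] x.
  apply: (@measurable_funM _ (g_sigma_algebraType (cylinders Xs [set i]))).
    exact: measurable_cst.
  exact: samples_measurable_centered.
have mx : measurable_fun setT x := samples_measurable_sub (ciid_indep H) sx.
have ix : intg x by exact/integrable_mull/cube_integrable1.
have ix2 : intg (fun w => x w ^+ 2).
  under eq_fun do rewrite exprMn; exact/integrable_mull/cube_integrable2.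
have ix3 : intg (fun w => `|x w| ^+ 3).
  under eq_fun do rewrite normrM exprMn; apply: integrable_mull; exact: cube.2.
have Ex : \int[P]_w x w = 0.
  by rewrite RintegralZl ?(ciid_mean H) ?mulr0//; exact: cube_integrable1.
have Ex2 : \int[P]_w (x w ^+ 2) = (s / c) ^+ 2.
  under eq_Rintegral do rewrite exprMn.
  rewrite RintegralZl// ?(ciid_var H); last exact: cube_integrable2.
  by rewrite exprMn exprVn mulrC.
have Ex3 : \int[P]_w (`|x w| ^+ 3) = beta / c ^+ 3.
  under eq_Rintegral do rewrite normrM exprMn.
  rewrite RintegralZl// ?(ciid_abs3 H); last exact: cube.2.
  by rewrite gtr0_norm ?invr_gt0// exprVn mulrC.
have Ex1 : \int[P]_w `|x w| <= s / c.
  under eq_Rintegral do rewrite normrM.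
  rewrite RintegralZl//; last exact: cube_integrable_norm.
  by rewrite gtr0_norm ?invr_gt0// mulrC ler_pM2r ?invr_gt0//; exact: abs_centered_le.
have JI : J `&` [set i] = set0.
  by rewrite -subset0 => j [Jj /= ji]; rewrite ji in Jj.
have sf : samples_measurable Xs J (f \o V).
  exact: (@measurableT_comp _ _ _ (g_sigma_algebraType _) _ _ f).
have sg : samples_measurable Xs J (g \o V).
  exact: (@measurableT_comp _ _ _ (g_sigma_algebraType _) _ _ g).
have ifV : intg (f \o V).
  apply: (@integrable_bounded_fun _ _ _ _ _ M); first exact: (measurableT_comp mf mV').
  by move=> w; exact: fM.
have igV : intg (g \o V).
  apply: (@integrable_bounded_fun _ _ _ _ _ M); first exact: (measurableT_comp mg mV').
  by move=> w; exact: gM.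
have [iA EA] := samples_integrableM (ciid_indep H) JI sf sx ifV ix.
have sx2 : samples_measurable Xs [set i] (fun w => x w ^+ 2 - (s / c) ^+ 2).
  apply: (@measurable_funB _ (g_sigma_algebraType (cylinders Xs [set i]))).
    exact: (@measurable_funX _ (g_sigma_algebraType (cylinders Xs [set i]))).
  exact: measurable_cst.
have ix2' : intg (fun w => x w ^+ 2 - (s / c) ^+ 2).
  by apply: integrable_addr => //; exact: finite_measure_integrable_cst.
have [iB EB] := samples_integrableM (ciid_indep H) JI sg sx2 igV ix2'.
rewrite Ex mulr0 in EA.
rewrite RintegralB// ?Ex2 ?Rintegral_cst1 ?subrr ?mulr0 in EB; last first.
  exact: finite_measure_integrable_cst.
(* [D] collects the remainders. What is left of [h] is [f V * x] plus [g V] times the centred square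
   of [x], and both have mean 0 by independence. *)
pose D w := x w * (f (V w + x w) - f (V w) - x w * g (V w)) -
  (s / c) ^+ 2 * (g (V w + x w) - g (V w)).
have mVx : measurable_fun setT (fun w => V w + x w) by exact: measurable_funD.
have mD : measurable_fun setT D.
  have mfV := measurableT_comp mf mV'; have mgV := measurableT_comp mg mV'.
  have mfVx := measurableT_comp mf mVx; have mgVx := measurableT_comp mg mVx.
  apply: measurable_funB; apply: measurable_funM => //.
    apply: measurable_funB; first exact: measurable_funB.
    exact: measurable_funM.
  exact: measurable_funB.
have Dle w : `|D w| <= K * `|x w| ^+ 3 + (s / c) ^+ 2 * K * `|x w|.
  apply: le_trans (ler_normB _ _) _; apply: lerD; rewrite normrM.
    have := taylor1_lipschitz fg gK (V w) (x w).
    rewrite -[x w ^+ 2]real_normK ?num_real// => /(ler_wpM2l (normr_ge0 (x w))).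
    by move/le_trans; apply; rewrite mulrCA -exprS.
  rewrite ger0_norm ?sqr_ge0// -mulrA ler_wpM2l ?sqr_ge0//.
  by apply: le_trans (gK _ _) _; rewrite addrAC subrr add0r.
have ile : intg (fun w => K * `|x w| ^+ 3 + (s / c) ^+ 2 * K * `|x w|).
  by apply: integrable_addr; apply: integrable_mull => //; exact: integrable_norm.
have iD : intg D := integrable_normr_le mD Dle ile.
have hE : h = fun w => (f \o V) w * x w +
    ((g \o V) w * (x w ^+ 2 - (s / c) ^+ 2) + D w).
  by apply/funext => w; rewrite /h /D /=; ring.
split.
  by rewrite hE; apply: integrable_addr => //; exact: integrable_addr.
rewrite hE RintegralD//; last exact: integrable_addr.
rewrite RintegralD// EA EB !add0r.
apply: le_trans (le_normr_Rintegral _ iD) _ => //.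
apply: le_trans (le_Rintegral _ (integrable_norm iD) ile (fun w _ => Dle w)) _ => //.
rewrite RintegralD//; last 2 first.
- exact: integrable_mull.
- by apply: integrable_mull; exact: integrable_norm.
rewrite !RintegralZl// ?Ex3; last exact: integrable_norm.
have := ler_wpM2l (mulr_ge0 (sqr_ge0 (s / c)) K0) Ex1.
by move: (s / c) (\int[P]_w `|x w|) => y z; lra.
Qed.

(** The quantity splits into [n] leave-one-out terms because [(s / c) ^+ 2 = 1 / n]. Each has a mean
    of order n^(-3/2), which leaves n^(-1/2) in total. *)
Lemma stein_bound (f g : R -> R) (M K : R) (n : nat) :
  (forall x : R, is_derive x 1 f (g x)) -> (forall x, `|f x| <= M) ->
  (forall x, `|g x| <= M) -> (forall x y, `|g x - g y| <= K * `|x - y|) ->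
  (0 < n)%N ->
  `|\int[P]_w (normalized_sum n w * f (normalized_sum n w) - g (normalized_sum n w))|
    <= K * (beta / s ^+ 3 + 1) / Num.sqrt n%:R.
Proof.
move=> fg fM gM gK n0; have s0 := ciid_sd_gt0 H.
have r0 : 0 < Num.sqrt n%:R :> R by rewrite sqrtr_gt0 ltr0n.
have rr : Num.sqrt n%:R ^+ 2 = n%:R :> R by rewrite sqr_sqrtr.
pose c := s * Num.sqrt n%:R; have c0 : 0 < c by rewrite mulr_gt0.
have sc : s / c = (Num.sqrt n%:R)^-1 by rewrite /c invfM mulrA mulfV ?mul1r// gt_eqF.
pose x i w := c^-1 * (Xs i w - mu).
pose V i w := c^-1 * \sum_(0 <= j < n | j != i) (Xs j w - mu).
have WE i w : (i < n)%N -> normalized_sum n w = V i w + x i w.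
  move=> ni; rewrite /normalized_sum -/c /V /x -mulrDr mulrC; congr (_ * _).
  by rewrite /csum (bigD1_seq i) ?mem_index_iota ?iota_uniq//= addrC.
pose h i w := x i w * f (V i w + x i w) - (s / c) ^+ 2 * g (V i w + x i w).
have hstep i : intg (h i) /\
    `|\int[P]_w h i w| <= K * beta / c ^+ 3 + K * (s / c) ^+ 3.
  apply: (@stein_step f g M K [set j | j != i]) => //; last by move=> /=; rewrite eqxx.
  apply: (@measurable_funM _ (g_sigma_algebraType (cylinders Xs _))).
    exact: measurable_cst.
  exact: samples_measurable_sum.
have hE w : normalized_sum n w * f (normalized_sum n w) - g (normalized_sum n w) =
    \sum_(0 <= i < n) h i w.
  transitivity (\sum_(0 <= i < n) (x i w * f (normalized_sum n w) -
      (s / c) ^+ 2 * g (normalized_sum n w))).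
    rewrite sumrB -mulr_suml -mulr_sumr sumr_const_nat subn0 sc exprVn rr.
    congr (_ * _ - _); first by rewrite /normalized_sum mulrC.
    by rewrite -[RHS]mulr_natr mulrAC mulVf ?mul1r// pnatr_eq0 -lt0n.
  by apply: eq_big_nat => i /andP[_ ni]; rewrite /h -!WE.
have sumE m : \int[P]_w (\sum_(0 <= i < m) h i w) = \sum_(0 <= i < m) \int[P]_w h i w /\
    intg (fun w => \sum_(0 <= i < m) h i w).
  elim: m => [|m [ih ihi]].
    split; first by rewrite big_geq//; under eq_Rintegral do rewrite big_geq//; exact: Rintegral_cst1.
    under eq_fun do rewrite big_geq//; exact: finite_measure_integrable_cst.
  split; last first.
    under eq_fun do rewrite big_nat_recr//=.
    by apply: integrable_addr => //; exact: (hstep m).1.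
  under eq_Rintegral do rewrite big_nat_recr//=.
  by rewrite RintegralD// ?ih ?big_nat_recr//; exact: (hstep m).1.
under eq_Rintegral do rewrite hE; rewrite (sumE n).1.
apply: le_trans (ler_norm_sum _ _ _) _.
apply: (@le_trans _ _ (\sum_(0 <= i < n) (K * beta / c ^+ 3 + K * (s / c) ^+ 3))).
  by apply: ler_sum => i _; exact: (hstep i).2.
rewrite sumr_const_nat subn0 -[leLHS]mulr_natr sc /c.
rewrite le_eqVlt; apply/orP; left; apply/eqP.
by move: rr r0; move: (Num.sqrt n%:R) => r <- r0; field; rewrite !gt_eqF.
Qed.

Lemma test_fun_cvg0 (h : R -> R) (B M K : R) : 0 < B -> test_fun h B M K ->
  \int[lebesgue]_x (h x * normal_pdf 0 1 x) = 0 ->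
  exists C : R, forall n, (0 < n)%N ->
    `|\int[P]_w h (normalized_sum n w)| <= C / Num.sqrt n%:R.
Proof.
move=> B0 ht h0; have [f [g [M' [K' [fg fM gM gK hE]]]]] := stein_solution B0 ht h0.
exists (K' * (beta / s ^+ 3 + 1)) => n n0.
apply: le_trans (stein_bound fg fM gM gK n0).
rewrite -normrN -[- _]mulN1r -RintegralZl//.
  rewrite le_eqVlt; apply/orP; left; apply/eqP; congr `|_|.
  by apply: eq_Rintegral => w _; rewrite -hE; ring.
apply: (@integrable_bounded_fun _ _ _ _ _ M); last by move=> w; exact: test_bound ht _.
apply: measurableT_comp (measurable_normalized_sum n).
exact: continuous_measurable_fun (lipschitz_continuous (test_lip ht)).
Qed.

End stein_method.

(** * Smoothed indicators and the normal measure of symmetric intervals *)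

Section trapezoid.
Context (R : realType).
Local Notation phi := (@normal_pdf R 0 1).
Local Notation lebesgue := (@lebesgue_measure R).
Local Notation N h := (\int[lebesgue]_x ((h : R -> R) x * phi x)).

Definition clamp (a : R) : R := if a <= 0 then 0 else if 1 <= a then 1 else a.

Let clamp_lip a b : `|clamp a - clamp b| <= `|a - b|.
Proof.
rewrite ler_norml; have := ler_norm (a - b); have := ler_norm (b - a).
rewrite [ `|b - a|]distrC /clamp.
by have [] := leP a 0; have [] := leP 1 a; have [] := leP b 0; have [] := leP 1 b;
  move=> *; apply/andP; split; lra.
Qed.

(** A Lipschitz function lying between the indicators of [[-t, t]] and of [[-(t + s), t + s]]; here
    [s] is the width of the slopes, not a standard deviation. *)
Definition trapezoid (t s x : R) : R := clamp ((t + s - `|x|) / s).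

Let clamp_itv a : 0 <= clamp a <= 1.
Proof.
rewrite /clamp; have [_|a0] := leP a 0; first by rewrite lexx ler01.
by have [_|a1] := leP 1 a; rewrite ?ler01 ?lexx ?(ltW a0) ?(ltW a1).
Qed.

Lemma trapezoid_ge0 t s x : 0 <= trapezoid t s x.
Proof. by case/andP: (clamp_itv ((t + s - `|x|) / s)). Qed.

Lemma trapezoid_le1 t s x : trapezoid t s x <= 1.
Proof. by case/andP: (clamp_itv ((t + s - `|x|) / s)). Qed.

Lemma trapezoid1 t s x : 0 < s -> `|x| <= t -> trapezoid t s x = 1.
Proof.
move=> s0 xt; rewrite /trapezoid /clamp.
have -> : 1 <= (t + s - `|x|) / s by rewrite ler_pdivlMr// mul1r; lra.
by case: leP => //; rewrite pmulr_lle0 ?invr_gt0//; lra.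
Qed.

Lemma trapezoid0 t s x : 0 < s -> t + s <= `|x| -> trapezoid t s x = 0.
Proof.
move=> s0 xt; rewrite /trapezoid /clamp.
by have -> : (t + s - `|x|) / s <= 0 by rewrite pmulr_lle0 ?invr_gt0//; lra.
Qed.

Lemma trapezoid_test t s : 0 < s -> test_fun (trapezoid t s) (t + s) 1 s^-1.
Proof.
move=> s0; split => [x|x|x y]; first exact: trapezoid0.
  by rewrite ger0_norm ?trapezoid_ge0 ?trapezoid_le1.
apply: le_trans (clamp_lip _ _) _; rewrite -mulrBl normrM mulrC.
rewrite gtr0_norm ?invr_gt0// ler_pM2l ?invr_gt0//.
rewrite (_ : _ - _ - _ = `|y| - `|x|); last by ring.
by rewrite [leRHS]distrC; exact: ler_dist_dist.
Qed.

Definition normal_ball (t : R) : R := fine (normal_prob 0 1 `[- t, t]).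

Let normal_ballE t : normal_ball t = N (\1_`[-t, t]).
Proof.
rewrite /normal_ball /normal_prob -/(Rintegral _ _ _) Rintegral_mkcond.
apply: eq_Rintegral => x _; rewrite patchE [X in _ = X * _]indicE.
by have [_|_] := boolP (x \in `[- t, t]%classic); rewrite ?mul1r ?mul0r.
Qed.

Let integrable_bounded_phi (h : R -> R) : measurable_fun setT h ->
  (forall x, `|h x| <= 1) -> lebesgue.-integrable setT (EFin \o (fun x => h x * phi x)).
Proof.
move=> mh h1; apply: (@le_integrable _ _ _ lebesgue setT measurableT _ (EFin \o phi)).
- by apply/measurable_EFinP; apply: measurable_funM => //; exact: measurable_normal_pdf.
- move=> x _; rewrite lee_fin normrM ler_piMl//.
- exact: integrable_normal_pdf.
Qed.

Let measurable_trapezoid t s : 0 < s -> measurable_fun setT (trapezoid t s).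
Proof.
move=> s0; apply: continuous_measurable_fun.
exact: lipschitz_continuous (test_lip (trapezoid_test t s0)).
Qed.

Let integrable_trapezoid t s : 0 < s ->
  lebesgue.-integrable setT (EFin \o (fun x => trapezoid t s x * phi x)).
Proof.
move=> s0; apply: integrable_bounded_phi; first exact: measurable_trapezoid.
by move=> x; exact: test_bound (trapezoid_test t s0) x.
Qed.

Let integrable_ball t :
  lebesgue.-integrable setT (EFin \o (fun x => (\1_`[-t, t] : R -> R) x * phi x)).
Proof.
apply: integrable_bounded_phi; first exact: measurable_indic.
by move=> x; rewrite indicE; case: (_ \in _); rewrite ?normr1 ?normr0.
Qed.

Lemma trapezoid_ge_normal_ball t s : 0 < s -> normal_ball t <= N (trapezoid t s).
Proof.
move=> s0; rewrite normal_ballE; apply: le_Rintegral => //.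
- exact: integrable_trapezoid.
- move=> x _; rewrite ler_wpM2r ?normal_pdf_ge0// indicE.
  have [|_] := boolP (x \in _); last exact: trapezoid_ge0.
  by rewrite inE/= in_itv/= -ler_norml => xt; rewrite trapezoid1.
Qed.

Lemma trapezoid_le_normal_ball t s : 0 < s -> N (trapezoid t s) <= normal_ball (t + s).
Proof.
move=> s0; rewrite normal_ballE; apply: le_Rintegral => //.
  exact: integrable_trapezoid.
move=> x _; rewrite ler_wpM2r ?normal_pdf_ge0// indicE.
have [|] := boolP (x \in _); first by rewrite trapezoid_le1.
rewrite notin_setE/= in_itv/= -ler_norml => /negP; rewrite -ltNge => /ltW xt.
by rewrite trapezoid0.
Qed.

Lemma normal_ball_le1 t : normal_ball t <= 1.
Proof.
rewrite /normal_ball -lee_fin fineK; first exact: probability_le1.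
exact: (@fin_num_measure _ _ _ (normal_prob 0 (1 : R))).
Qed.

(** The added region has length [2 * (u - t)] and the density is at most its peak. *)
Lemma normal_ball_lip (t u : R) : 0 <= t -> t <= u ->
  normal_ball u <= normal_ball t + 2 * normal_peak 1 * (u - t).
Proof.
move=> t0 tu; rewrite -lerBlDl !normal_ballE -RintegralB//.
have int1 (v : R) : lebesgue.-integrable setT (EFin \o (\1_`[-v, v] : R -> R)).
  exact: integrable_indic_itv.
have E1 (v : R) : 0 <= v -> \int[lebesgue]_x (\1_`[-v, v] : R -> R) x = 2 * v.
  move=> v0; rewrite /Rintegral integral_indic//= setIT lebesgue_measure_itv/= lte_fin.
  have [vv|vv] := ltP (- v) v; first by rewrite -EFinD/= ; lra.
  have -> : v = 0 by lra.
  by rewrite mulr0.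
have peak0 := @normal_peak_ge0 R 1.
apply: (@le_trans _ _ (\int[lebesgue]_x (normal_peak 1 *
    ((\1_`[-u, u] : R -> R) x - (\1_`[-t, t] : R -> R) x)))).
  apply: le_Rintegral => //.
  - exact: (integrableB measurableT (integrable_ball u) (integrable_ball t)).
  - exact: (integrableZl measurableT (normal_peak 1)
      (integrableB measurableT (int1 u) (int1 t))).
  - move=> x _; rewrite -mulrBl mulrC; apply: ler_wpM2r.
      rewrite !indicE subr_ge0 ler_nat; case: (boolP (x \in `[-t, t]%classic)) => //.
      rewrite !inE/= !in_itv/= => /andP[tx xt].
      by rewrite mem_set//= in_itv/=; apply/andP; split; lra.
    exact: normal_pdf_ub (oner_neq0 _).
rewrite RintegralZl//; last exact: (integrableB measurableT (int1 u) (int1 t)).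
rewrite RintegralB// !E1//; last exact: le_trans tu.
by rewrite le_eqVlt; apply/orP; left; apply/eqP; ring.
Qed.

Lemma probability_ball_cvg1 (P : probability (measurableTypeR R) R) :
  fine (P `[- n%:R, n%:R]%classic) @[n --> \oo] --> (1 : R).
Proof.
pose F (n : nat) : set R := `[- n%:R, n%:R]%classic.
have FT : \bigcup_n F n = setT.
  apply/seteqP; split => // x _; exists (Num.truncn `|x|).+1 => //=.
  by rewrite /F/= in_itv/= -ler_norml ltW// truncnS_gt.
have ndF : nondecreasing_seq F.
  move=> m n mn; apply/subsetPset => x; rewrite /F/= !in_itv/= -!ler_norml.
  by move/le_trans; apply; rewrite ler_nat.
have mF n : measurable (F n) by exact: measurable_itv.
have mUF : measurable (\bigcup_n F n) by rewrite FT.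
have := @nondecreasing_cvg_mu _ _ _ P F mF mUF ndF.
have PT : P (\bigcup_n F n) = 1%E by rewrite FT; exact: probability_setT.
by move=> h; apply: fine_cvg; rewrite -[1%:E]/(1%E) -PT; exact: h.
Qed.

Lemma normal_ball_cvg1 : normal_ball n%:R @[n --> \oo] --> (1 : R).
Proof. exact: (probability_ball_cvg1 (normal_prob 0 (1 : R))). Qed.

End trapezoid.

Lemma probability_Rintegral d (T : measurableType d) (R : realType)
    (P : probability T R) (A : set T) : measurable A ->
  P A = (\int[P]_w (\1_A w : R))%:E.
Proof.
move=> mA; rewrite /Rintegral integral_indic// setIT fineK//.
exact: (fin_num_measure P).
Qed.

(** One radius serves two tails: that of the normal law directly, and that of the normalized sums
    through the Chebyshev bound [A ^- 2]. *)
Lemma normal_ball_concentrated (R : realType) (e1 : R) : 0 < e1 ->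
  exists A, [/\ 0 < A, A ^- 2 <= e1 & 1 - e1 <= normal_ball A].
Proof.
move=> e10; have ball1 : \forall m \near \oo, `|1 - normal_ball (m%:R : R)| <= e1.
  by move/cvgrPdist_le : (@normal_ball_cvg1 R) => /(_ _ e10).
near \oo => m; exists m%:R; split.
- by rewrite ltr0n; near: m; exists 1.
- have m1 : (0 < m)%N by near: m; exists 1.
  rewrite invf_ple ?posrE ?exprn_gt0 ?ltr0n//.
  apply: (@le_trans _ _ m%:R); last by rewrite -natrX ler_nat leq_pmulr.
  by near: m; exact: nbhs_infty_ger.
- have : `|1 - normal_ball m%:R| <= e1.
    by near: m.
  by rewrite ler_norml => /andP[_]; lra.
Unshelve. all: by end_near. Qed.

(** * Central limit theorem on symmetric intervals *)

Section central_limit.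
Context d (T : measurableType d) (R : realType) (P : probability T R).
Variables (Xs : nat -> {mfun T >-> R}) (mu s beta : R).
Hypothesis H : centered_iid P Xs mu s beta.
Implicit Types (t v e A : R).
Local Notation intg f := (P.-integrable [set: T] (EFin \o (f : T -> R))).
Local Notation lebesgue := (@lebesgue_measure R).
Local Notation N h := (\int[lebesgue]_x ((h : R -> R) x * normal_pdf 0 1 x)).
Local Notation W := (normalized_sum Xs mu s).

Let measurable_test_W (h : R -> R) B M K n : test_fun h B M K ->
  measurable_fun setT (fun w => h (W n w)).
Proof.
move=> ht; apply: measurableT_comp (measurable_normalized_sum H n).
exact: continuous_measurable_fun (lipschitz_continuous (test_lip ht)).
Qed.

Let integrable_test_W (h : R -> R) B M K n : test_fun h B M K ->
  intg (fun w => h (W n w)).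
Proof.
move=> ht; apply: (@integrable_bounded_fun _ _ _ _ _ M).
  exact: measurable_test_W ht.
by move=> w; exact: test_bound ht _.
Qed.

Lemma normalized_sum_tail n A : (0 < n)%N -> 0 < A ->
  (P [set w | A <= `|W n w|]%R <= (A ^- 2)%:E)%E.
Proof.
move=> n0 A0; have s0 := ciid_sd_gt0 H.
have r0 : 0 < Num.sqrt n%:R :> R by rewrite sqrtr_gt0 ltr0n.
have rr : Num.sqrt n%:R ^+ 2 = n%:R :> R by rewrite sqr_sqrtr.
have c0 : 0 < s * Num.sqrt n%:R by rewrite mulr_gt0.
have := csum_tail H 0 n (mulr_gt0 A0 c0); rewrite add0n.
have -> : [set w | A * (s * Num.sqrt n%:R) <= `|csum Xs mu 0 n w|] =
    [set w | A <= `|W n w|].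
  apply/seteqP; split=> w /=;
  by rewrite /normalized_sum normrM normfV (gtr0_norm c0) ler_pdivlMr.
move/le_trans; apply; rewrite lee_fin le_eqVlt; apply/orP; left; apply/eqP.
by move: rr r0; move: (Num.sqrt n%:R) => r <- r0; field; rewrite !gt_eqF.
Qed.

(** Chebyshev's inequality gives tightness uniformly in [n], so the mean of a wide trapezoid is
    known to be close to 1 before any limit theorem is available. *)
Lemma trapezoid_tail n A : (0 < n)%N -> 0 < A ->
  1 - A ^- 2 <= \int[P]_w trapezoid A 1 (W n w) <= 1.
Proof.
move=> n0 A0; have ht := trapezoid_test A (@ltr01 R).
have mA : measurable [set w | A <= `|W n w|].
  apply: measurable_set_ler => //; apply: measurableT_comp => //.
  exact: (measurable_normalized_sum H).
apply/andP; split; last first.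
  rewrite -[leRHS](Rintegral_cst1 P); apply: le_Rintegral => //.
  - exact: integrable_test_W ht.
  - exact: finite_measure_integrable_cst.
  - by move=> w _; exact: trapezoid_le1.
have := normalized_sum_tail n0 A0; rewrite (probability_Rintegral P mA) lee_fin.
have i1 := integrable_indic P mA => tl.
apply: (@le_trans _ _ (\int[P]_w (1 - (\1_[set w | A <= `|W n w|] w : R)))).
  rewrite RintegralB//; last exact: finite_measure_integrable_cst.
  by rewrite Rintegral_cst1 lerB.
apply: le_Rintegral => //.
- have ic : intg (fun=> 1) by exact: finite_measure_integrable_cst.
  exact: (integrableB measurableT ic i1).
- exact: integrable_test_W ht.
- move=> w _; rewrite indicE; have [|] := boolP (w \in _).
    by rewrite subrr trapezoid_ge0.
  rewrite notin_setE/= => /negP; rewrite -ltNge => /ltW WA.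
  by rewrite subr0 trapezoid1.
Qed.

(* Subtracting from [h] a multiple of a wide trapezoid makes its Gaussian mean
   vanish, as [test_fun_cvg0] requires. *)
Lemma clt_test (h : R -> R) B K e : 0 < B -> test_fun h B 1 K ->
  (forall x, 0 <= h x) -> 0 < e ->
  \forall n \near \oo, `|\int[P]_w h (W n w) - N h| <= e.
Proof.
move=> B0 hh h0 e0.
(* With [e1 <= 1 / 2] the wide trapezoid has normal mean at least 1/2, so the multiple [th] is at
   most 2. Its replacement then costs at most [2 * e1 <= e / 2], and the other half of [e] is for
   the Stein bound. *)
have [e1 [e10 e14 e12]] : exists e1, [/\ 0 < e1, e1 <= e / 4 & e1 <= 1 / 2].
  exists (Num.min (e / 4) (1 / 2)); split; last by rewrite ge_min lexx orbT.
    by rewrite lt_min !divr_gt0.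
  by rewrite ge_min lexx.
have [A [A0 Ae GA]] := normal_ball_concentrated e10.
have hpsi := trapezoid_test A (@ltr01 R).
have psi1 : 1 - e1 <= N (trapezoid A 1).
  by rewrite (le_trans GA) ?trapezoid_ge_normal_ball.
have psi2 : N (trapezoid A 1) <= 1.
  by apply: le_trans (trapezoid_le_normal_ball _ _) (normal_ball_le1 _).
have ih := test_integrable hh; have ipsi := test_integrable hpsi.
have hphi1 : N h <= 1.
  have i1 := integrable_normal_pdf 0 (1 : R).
  apply: (@le_trans _ _ (\int[lebesgue]_x (normal_pdf 0 1 x : R))); last first.
    by rewrite /Rintegral integral_normal_pdf.
  apply: le_Rintegral => // x _; rewrite ler_piMl ?normal_pdf_ge0//.
  by rewrite (le_trans (ler_norm _))//; exact: test_bound hh x.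
have hphi0 : 0 <= N h.
  by apply: Rintegral_ge0 => x _; rewrite mulr_ge0 ?normal_pdf_ge0.
have psi0 : 0 < N (trapezoid A 1).
  by apply: (lt_le_trans _ psi1); clear hphi0 hphi1; lra.
have [th [th0 th2 hth]] : exists th,
    [/\ 0 <= th, th <= 2 & N h = th * N (trapezoid A 1)].
  exists (N h / N (trapezoid A 1)); split; last by rewrite divfK// gt_eqF.
    by apply: divr_ge0 => //; exact: ltW.
  by rewrite ler_pdivrMr//; apply: le_trans hphi1 _; clear hphi0; lra.
have h1test : test_fun (fun x => h x - th * trapezoid A 1 x)
    (B + (A + 1)) (1 + th * 1) (K + th * 1^-1).
  split => [x Bx|x|x y].
  - rewrite (test_supp hh) ?(test_supp hpsi); first by rewrite mulr0 subr0.
      by apply: le_trans Bx; clear hth hphi0 hphi1; lra.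
    by apply: le_trans Bx; clear hth hphi0 hphi1; lra.
  - apply: le_trans (ler_normB _ _) _; apply: lerD; first exact: test_bound hh x.
    by rewrite normrM (ger0_norm th0) ler_wpM2l//; exact: test_bound hpsi x.
  - rewrite (_ : _ - _ - _ = (h x - h y) -
      th * (trapezoid A 1 x - trapezoid A 1 y)); last by ring.
    apply: le_trans (ler_normB _ _) _; rewrite mulrDl; apply: lerD.
      exact: test_lip hh x y.
    by rewrite normrM (ger0_norm th0) -mulrA ler_wpM2l//; exact: test_lip hpsi x y.
have N1 : N (fun x => h x - th * trapezoid A 1 x) = 0.
  transitivity (\int[lebesgue]_x (h x * normal_pdf 0 1 x -
      th * (trapezoid A 1 x * normal_pdf 0 1 x))).
    by apply: eq_Rintegral => x _; ring.
  rewrite RintegralB//; last exact: (integrableZl measurableT th ipsi).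
  by rewrite RintegralZl// hth subrr.
have B10 : 0 < B + (A + 1) by rewrite !addr_gt0.
have [C hC] := test_fun_cvg0 H B10 h1test N1.
near=> n; have n0 : (0 < n)%N by near: n; exists 1.
have r0 : 0 < Num.sqrt n%:R :> R by rewrite sqrtr_gt0 ltr0n.
have small : C / Num.sqrt n%:R <= e / 2.
  rewrite ler_pdivrMr// mulrC -ler_pdivrMr ?divr_gt0//.
  apply: le_trans (ler_norm _) _; rewrite -sqrtr_sqr ler_sqrt ?ler0n//.
  by near: n; exact: nbhs_infty_ger.
have := hC n n0; rewrite RintegralB//; last 2 first.
- exact: integrable_test_W hh.
- by apply: integrable_mull; exact: integrable_test_W hpsi.
rewrite RintegralZl//; last exact: integrable_test_W hpsi.
have := trapezoid_tail n0 A0; rewrite hth; clear hth N1 hphi0 hphi1.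
move: (\int[P]_w h (W n w)) (\int[P]_w trapezoid A 1 (W n w)) (N (trapezoid A 1)) psi1 psi2.
move: (C / _) small => c small Eh Ep Np psi1 psi2 /andP[Ep1 Ep2] hE.
have d1 : `|Ep - Np| <= e1 by rewrite ler_norml; apply/andP; split; lra.
rewrite (_ : Eh - _ = (Eh - th * Ep) + th * (Ep - Np)); last by ring.
apply: le_trans (ler_normD _ _) _; rewrite normrM (ger0_norm th0).
have : th * `|Ep - Np| <= 2 * e1 by apply: ler_pM.
lra.
Unshelve. all: by end_near. Qed.

Lemma clt_trapezoid t v e : 0 < v -> 0 <= t -> 0 < e ->
  \forall n \near \oo, `|\int[P]_w trapezoid t v (W n w) - N (trapezoid t v)| <= e.
Proof.
move=> v0 t0; apply: (@clt_test _ (t + v) v^-1).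
- by rewrite ltr_wpDl.
- exact: trapezoid_test.
- by move=> x; exact: trapezoid_ge0.
Qed.

(** The indicator is bounded above by a trapezoid with slopes of width [v], chosen so that enlarging
    the radius by [v] changes the normal measure by at most [e / 2]. *)
Lemma clt_upper t e : 0 <= t -> 0 < e ->
  \forall n \near \oo, (P [set w | `|W n w| <= t]%R <= (normal_ball t + e)%:E)%E.
Proof.
move=> t0 e0; have p0 := @normal_peak_ge0 R 1.
pose v := e / 2 / (2 * normal_peak 1 + 1).
have q0 : 0 < 2 * normal_peak 1 + 1 :> R by lra.
have v0 : 0 < v by rewrite !divr_gt0.
have ve : 2 * normal_peak 1 * v <= e / 2.
  have -> : e / 2 = (2 * normal_peak 1 + 1) * v.
    by rewrite /v [RHS]mulrC divfK// gt_eqF.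
  by rewrite ler_pM2r//; lra.
have e20 : 0 < e / 2 by lra.
have := clt_trapezoid v0 t0 e20; apply: filterS => n.
have mA : measurable [set w | `|W n w| <= t].
  apply: measurable_set_ler => //; apply: measurableT_comp => //.
  exact: (measurable_normalized_sum H).
have : \int[P]_w (\1_[set w | `|W n w| <= t] w : R) <= \int[P]_w trapezoid t v (W n w).
  apply: le_Rintegral => //.
  - exact: integrable_indic.
  - exact: integrable_test_W (trapezoid_test t v0).
  - move=> w _; rewrite indicE; have [|_] := boolP (w \in _); last exact: trapezoid_ge0.
    by rewrite inE/= => Wt; rewrite trapezoid1.
rewrite (probability_Rintegral P mA) lee_fin ler_norml => h1 /andP[_ h2].
have := trapezoid_le_normal_ball t v0.
have := @normal_ball_lip R t (t + v) t0; rewrite lerDl (ltW v0) => /(_ isT).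
lra.
Qed.

Lemma clt_lower t e : 0 < t -> 0 < e ->
  \forall n \near \oo, ((normal_ball t - e)%:E <= P [set w | `|W n w| < t]%R)%E.
Proof.
move=> t0 e0; have p0 := @normal_peak_ge0 R 1.
(* Here the trapezoid lies below the indicator and its flat part has radius [t - v]; the cap [t / 2]
   keeps that radius nonnegative. *)
pose v := Num.min (t / 2) (e / 2 / (2 * normal_peak 1 + 1)).
have q0 : 0 < 2 * normal_peak 1 + 1 :> R by lra.
have v0 : 0 < v by rewrite lt_min !divr_gt0.
have vt : v <= t / 2 by rewrite ge_min lexx.
have ve : 2 * normal_peak 1 * v <= e / 2.
  have : v <= e / 2 / (2 * normal_peak 1 + 1) by rewrite ge_min lexx orbT.
  by rewrite ler_pdivlMr//; lra.
have e20 : 0 < e / 2 by lra.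
have tv0 : 0 <= t - v by lra.
have := clt_trapezoid v0 tv0 e20; apply: filterS => n.
have mA : measurable [set w | `|W n w| < t].
  apply: measurable_set_ltr => //; apply: measurableT_comp => //.
  exact: (measurable_normalized_sum H).
have : \int[P]_w trapezoid (t - v) v (W n w) <= \int[P]_w (\1_[set w | `|W n w| < t] w : R).
  apply: le_Rintegral => //.
  - exact: integrable_test_W (trapezoid_test (t - v) v0).
  - exact: integrable_indic.
  - move=> w _; rewrite indicE; have [_|] := boolP (w \in _); first exact: trapezoid_le1.
    by rewrite notin_setE/= => /negP; rewrite -leNgt => Wt; rewrite trapezoid0// subrK.
rewrite (probability_Rintegral P mA) lee_fin ler_norml => h1 /andP[h2 _].
have := trapezoid_ge_normal_ball (t - v) v0.
have := @normal_ball_lip R (t - v) t tv0; rewrite gerBl (ltW v0) => /(_ isT).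
rewrite opprB addrCA subrr addr0; lra.
Qed.

End central_limit.

(** * The normal distribution function and its inverse *)

Section normal_cdf.
Context (R : realType).
Implicit Types (x y t p : R).
Local Notation phi := (@normal_pdf R 0 1).
Local Notation lebesgue := (@lebesgue_measure R).

Let iphi (A : set R) : measurable A -> lebesgue.-integrable A (EFin \o phi).
Proof. by move=> mA; apply: (@integrableS _ _ _ _ setT) => //; exact: integrable_normal_pdf. Qed.

Let PhiE x : Phi x = \int[lebesgue]_(t in `]-oo, x]) phi t.
Proof. by []. Qed.

Lemma Phi_sub x y : x <= y -> Phi y - Phi x = \int[lebesgue]_(t in `[x, y]) phi t.
Proof.
move=> xy; rewrite !PhiE (@Rintegral_itvB _ phi -oo%O (BRight y) x)//.
- by rewrite Rintegral_itv_obnd_cbnd//; exact: iphi.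
- exact: iphi.
Qed.

Let Rintegral_cst_itv x y (c : R) : x <= y -> \int[lebesgue]_(t in `[x, y]) c = c * (y - x).
Proof.
move=> xy; rewrite Rintegral_cst//= lebesgue_measure_itv/= lte_fin.
have [//|yx] := ltP x y.
have -> : y = x by apply/eqP; rewrite eq_le yx.
by rewrite subrr.
Qed.

Let integrable_cst_itv x y (c : R) : lebesgue.-integrable `[x, y] (EFin \o cst c).
Proof.
apply: measurable_bounded_integrable => //.
  by rewrite /= lebesgue_measure_itv/=; case: ifP => _; rewrite ?ltry// -EFinB ltry.
exact: bounded_cst.
Qed.

(** On [[x, y]] the density is at least its value at [|x| + |y|], which is positive. *)
Lemma Phi_lt x y : x < y -> Phi x < Phi y.
Proof.
move=> xy; rewrite -subr_gt0 Phi_sub ?ltW//.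
pose M : R := `|x| + `|y|; pose c : R := normal_peak 1 * expR (- (M ^+ 2 / 2)).
have c0 : 0 < c by rewrite mulr_gt0 ?expR_gt0// normal_peak_gt0// oner_neq0.
apply: (@lt_le_trans _ _ (\int[lebesgue]_(t in `[x, y]) c)).
  by rewrite Rintegral_cst_itv ?ltW// mulr_gt0// subr_gt0.
apply: le_Rintegral => //; [exact: integrable_cst_itv|exact: iphi|].
move=> t; rewrite /= in_itv/= => /andP[xt ty].
rewrite normal_pdf01E ler_wpM2l ?normal_peak_ge0// ler_expR lerN2 ler_pM2r ?invr_gt0//.
rewrite -(@real_normK _ t) ?num_real// lerXn2r ?nnegrE ?addr_ge0//.
rewrite ler_norml; have := ler_norm y; have := ler_norm (- x); rewrite normrN.
by have := normr_ge0 x; have := normr_ge0 y; rewrite /M => *; apply/andP; split; lra.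
Qed.

Lemma Phi_lip x y : `|Phi x - Phi y| <= normal_peak 1 * `|x - y|.
Proof.
wlog xy : x y / x <= y.
  by move=> H; have [/H//|/ltW/H] := leP x y; rewrite distrC [ `|y - x|]distrC.
have -> : `|Phi x - Phi y| = Phi y - Phi x.
  rewrite distrC ger0_norm// subr_ge0; move: xy; rewrite le_eqVlt => /predU1P[->//|].
  by move/Phi_lt/ltW.
rewrite distrC ger0_norm ?subr_ge0// Phi_sub// -Rintegral_cst_itv//.
apply: le_Rintegral => //; [exact: iphi|exact: integrable_cst_itv|].
by move=> t _; exact: normal_pdf_ub (oner_neq0 _).
Qed.

Lemma Phi_opp x : Phi (- x) = 1 - Phi x.
Proof.
have -> : 1 = \int[lebesgue]_(t in `]-oo, +oo[) phi t :> R.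
  by rewrite set_itvNyy /Rintegral integral_normal_pdf.
rewrite PhiE (@Rintegral_itvB _ phi -oo%O +oo%O x)//; last exact: iphi.
rewrite Rintegral_itv_obnd_cbnd; last exact: iphi.
congr fine; transitivity (\int[lebesgue_measure]_(t in `[x, +oo[) ((phi \o -%R) t)%:E)%E.
  apply: ge0_integration_by_substitutionNy => [|t _]; last exact: normal_pdf_ge0.
  apply: continuous_subspaceT; apply: continuous_normal_pdf; exact: oner_neq0.
by apply: eq_integral => t _; rewrite /= !normal_pdf01E sqrrN.
Qed.

Lemma normal_ball_Phi t : 0 <= t -> normal_ball t = 2 * Phi t - 1.
Proof.
move=> t0; transitivity (Phi t - Phi (- t)); last by rewrite Phi_opp; ring.
by rewrite Phi_sub// -[leRHS]opprK lerN2; lra.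
Qed.

Lemma Phi0 : Phi (0 : R) = 1 / 2.
Proof. by have := Phi_opp 0; rewrite oppr0 => h; lra. Qed.

Lemma Phi_invK p : 1 / 2 < p < 1 -> Phi (Phi_inv p) = p.
Proof.
move=> /andP[p2 p1].
suff ex : exists x, Phi x = p by exact: (@xgetPex _ 0 [set x | Phi x = p] ex).
(* With this tolerance, [2 * Phi A - 1 >= 1 - 2 * (1 - p)] reads [Phi A >= p], so [p] lies between
   the values at 0 and at [A]. *)
have q0 : 0 < 2 * (1 - p) by lra.
have [A [A0 _ GA]] := normal_ball_concentrated q0.
have pA : p <= Phi A by have := normal_ball_Phi (ltW A0); lra.
have [x _ xp] : exists2 x, x \in `[0, A] & Phi x = p.
  apply: IVT; first exact: ltW.
    exact/continuous_subspaceT/(lipschitz_continuous Phi_lip).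
  have P0A : Phi 0 <= Phi A by exact/ltW/Phi_lt.
  by rewrite (min_idPl P0A) (max_idPr P0A) Phi0 pA andbT ltW.
by exists x.
Qed.

Lemma Phi_inv_gt0 p : 1 / 2 < p < 1 -> 0 < Phi_inv p.
Proof.
move=> p01; have /andP[p2 _] := p01; rewrite ltNge; apply/negP => Z0.
have : Phi (Phi_inv p) <= Phi 0.
  by move: Z0; rewrite le_eqVlt => /predU1P[->//|/Phi_lt/ltW].
rewrite Phi_invK// Phi0; lra.
Qed.

(** Strict monotonicity is enough: values of [Phi] strictly between those at [Z - e] and [Z + e] are
    only taken between these two points. No inverse function is differentiated or shown
    continuous. *)
Lemma Phi_cvg_inv (u : nat -> R) (Z : R) :
  Phi (u n) @[n --> \oo] --> Phi Z -> u n @[n --> \oo] --> Z.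
Proof.
move=> /cvgrPdist_lt uZ; apply/cvgrPdist_le => e e0.
have d1 : 0 < Phi Z - Phi (Z - e) by rewrite subr_gt0 Phi_lt// gtrBl.
have d2 : 0 < Phi (Z + e) - Phi Z by rewrite subr_gt0 Phi_lt// ltrDl.
have h1 := uZ _ d1; have h2 := uZ _ d2; near=> n.
have u1 : `|Phi Z - Phi (u n)| < Phi Z - Phi (Z - e) by near: n.
have u2 : `|Phi Z - Phi (u n)| < Phi (Z + e) - Phi Z by near: n.
have mono x y : Phi x < Phi y -> x <= y.
  by move=> xy; rewrite leNgt; apply/negP => /Phi_lt; rewrite ltNge (ltW xy).
have l1 : Z - e <= u n by apply: mono; move: u1; rewrite ltr_norml => /andP[_]; lra.
have l2 : u n <= Z + e by apply: mono; move: u2; rewrite ltr_norml => /andP[+ _]; lra.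
by rewrite ler_norml; apply/andP; split; lra.
Unshelve. all: by end_near. Qed.

Lemma ln_inv_cvg (delta_ : nat -> R) p : (forall n, 0 < delta_ n < 1) ->
  1 / 2 < p < 1 ->
  Phi (Num.sqrt (ln (1 / delta_ n))) @[n --> \oo] --> p ->
  ln (1 / delta_ n) @[n --> \oo] --> Phi_inv p ^+ 2.
Proof.
move=> d01 p01; rewrite -{1}(Phi_invK p01) => /Phi_cvg_inv h.
have -> : (fun n => ln (1 / delta_ n)) = (fun n => Num.sqrt (ln (1 / delta_ n)) ^+ 2).
  apply/funext => n; rewrite sqr_sqrtr// ln_ge0// div1r.
  by have /andP[d0 d1] := d01 n; rewrite invf_ge1// ltW.
by rewrite expr2; under eq_fun do rewrite expr2; exact: cvgM.
Qed.

End normal_cdf.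

(** * The stopping rule *)

Section neighbourhoods.
Context (R : realType).

Lemma near_at_right0P (B : set R) : (\forall e \near 0^'+, B e) <->
  exists2 e0 : R, 0 < e0 & forall e, 0 < e < e0 -> B e.
Proof.
split.
  move=> /nbhs_ballP[e0 /= e00 h]; exists e0 => // e /andP[e1 e2].
  by apply: h => //; rewrite /ball/= sub0r normrN gtr0_norm.
move=> [e0 e00 h]; apply/nbhs_ballP; exists e0 => //= e.
rewrite /ball/= sub0r normrN => e1 e2; apply: h.
by rewrite e2/=; move: e1; rewrite gtr0_norm.
Qed.

Lemma near_pair_at_right0P (mu : R) (B : set (R * R)) :
  (\forall p \near (nbhs mu, 0^'+), B p) ->
  exists g e0 : R, [/\ 0 < g, 0 < e0 &
    forall y e, `|y - mu| <= g -> 0 < e < e0 -> B (y, e)].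
Proof.
move=> [[B1 B2] [/= /nbhs_ballP[g /= g0 h1] /near_at_right0P[e0 e00 h2]] B12].
exists (g / 2), e0; split => //; first by rewrite divr_gt0.
move=> y e yg ee; apply: B12; split; last exact: h2.
by apply: h1; rewrite /ball/= distrC (le_lt_trans yg)// ltr_pdivrMr// ltr_pMr// ltr1n.
Qed.

Lemma near_ballP (mu : R) (B : set R) : (\forall y \near mu, B y) ->
  exists2 g : R, 0 < g & forall y, `|y - mu| <= g -> B y.
Proof.
move=> /nbhs_ballP[g /= g0 h]; exists (g / 2); first by rewrite divr_gt0.
move=> y yg; apply: h; rewrite /ball/= distrC (le_lt_trans yg)//.
by rewrite ltr_pdivrMr// ltr_pMr// ltr1n.
Qed.

Lemma near_ooP (B : set nat) : (\forall n \near \oo, B n) ->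
  exists N, forall n, (N <= n)%N -> B n.
Proof. by move=> [N _ h]; exists N => n Nn; exact: h. Qed.

End neighbourhoods.

Section stopping_window.
Context (R : realType).
Variables (V : R -> R) (rho : R) (delta_ : nat -> R) (mu kap Z : R).
Hypothesis rho01 : 0 <= rho <= 1.
Hypothesis delta_01 : forall n, 0 < delta_ n < 1.
Hypothesis ln_delta : ln (1 / delta_ n) @[n --> \oo] --> Z ^+ 2.
Hypothesis Z0 : 0 < Z.

Let ln_gt0 n : 0 < ln (1 / delta_ n).
Proof.
by have /andP[d0 d1] := delta_01 n; rewrite ln_gt0// div1r invf_gt1.
Qed.

Let ln_near t : 0 < t -> exists N, forall n, (N <= n)%N ->
  (1 - t) * Z ^+ 2 <= ln (1 / delta_ n) <= (1 + t) * Z ^+ 2.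
Proof.
move=> t0; have tZ : 0 < t * Z ^+ 2 by rewrite mulr_gt0 ?exprn_gt0.
move/cvgrPdist_le : ln_delta => /(_ _ tZ) /near_ooP[N h]; exists N => n /h.
by rewrite ler_norml => /andP[h1 h2]; apply/andP; split; lra.
Qed.

(** One of the two inequalities of the stopping rule, with [F] standing for the upper or the lower
    bound at a fixed [e]. The bound enters through a square, so both are treated alike. *)
Definition accepts (F : R -> R) (y : R) (k : nat) : bool :=
  V (y + rho * (F y - y)) <= k%:R * (F y - y) ^+ 2 / ln (1 / delta_ k).

(** For fixed [e]: since [F mu] differs from [mu], the squared width stays away from 0 near [mu], so
    the right side grows linearly in [k] while the left side stays bounded. *)
Lemma accepts_bounded (F : R -> R) : {for mu, continuous F} -> F mu != mu ->
  bounded_near V (nbhs (mu + rho * (F mu - mu))) ->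
  exists g K, 0 < g /\ forall k y, (K <= k)%N -> `|y - mu| <= g -> accepts F y k.
Proof.
move=> cF Fmu /ex_bound[M VM].
have cD : F y - y @[y --> mu] --> F mu - mu by apply: cvgB => //; exact: cvg_id.
have cz : y + rho * (F y - y) @[y --> mu] --> mu + rho * (F mu - mu).
  by apply: cvgD; [exact: cvg_id|apply: cvgM => //; exact: cvg_cst].
pose c := (F mu - mu) ^+ 2.
have c0 : 0 < c by rewrite exprn_even_gt0//= subr_eq0.
have cD2 : (F y - y) ^+ 2 @[y --> mu] --> c.
  by rewrite /c expr2; under eq_fun do rewrite expr2; exact: cvgM.
have c20 : 0 < c / 2 by rewrite divr_gt0.
move/cvgrPdist_le : cD2 => /(_ _ c20) /near_ballP[g1 g10 h1].
have [g2 g20 h2] := near_ballP (cz _ VM).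
have [N hN] := ln_near ltr01.
pose M' := (`|M| + 1) * (2 * Z ^+ 2) / (c / 2).
exists (Num.min g1 g2), (maxn N (Num.truncn M').+1); split; first by rewrite lt_min g10.
move=> k y; rewrite geq_max => /andP[Nk Mk]; rewrite le_min => /andP[/h1 y1 /h2 y2].
rewrite /accepts ler_pdivlMr//; move: y2; rewrite /= => /ler_normlP[_ y2].
have /andP[_ l2] := hN _ Nk.
have Mk' : M' <= k%:R.
  by apply/ltW/(lt_le_trans (truncnS_gt _)); rewrite ler_nat.
apply: (@le_trans _ _ ((`|M| + 1) * (2 * Z ^+ 2))).
  apply: (@le_trans _ _ ((`|M| + 1) * ln (1 / delta_ k))).
    rewrite ler_wpM2r//; first exact: ltW.
    by apply: le_trans y2 _; rewrite (le_trans (ler_norm M))// lerDl.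
  by rewrite ler_wpM2l// ?addr_ge0//; apply: le_trans l2 _; rewrite -natr1 addrC.
move: Mk'; rewrite /M' ler_pdivrMr// => /le_trans; apply.
rewrite ler_wpM2l//; move: y1; rewrite ler_norml => /andP[_]; lra.
Qed.

Hypothesis V0 : 0 < V mu.
Hypothesis cV : {for mu, continuous V}.
Hypothesis kap0 : 0 < kap.

Local Notation NN := (target_size Z kap (V mu)).

(** After clearing denominators the rule compares [V * ln (1 / delta_ k)] with [k] times the squared
    width, and each factor other than [k] is within a relative error [t] of its limit. Convergence
    is assumed for the square of the normalized width, to cover both signs. *)
Lemma accepts_window (F : R -> R -> R) (eta : R) : 0 < eta < 1 ->
  ((F p.1 p.2 - p.1) / p.2) ^+ 2 @[p --> (nbhs mu, 0^'+)] --> kap ^+ 2 ->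
  exists g e0 K, [/\ 0 < g, 0 < e0 & forall e y k, 0 < e < e0 ->
    `|y - mu| <= g -> (K <= k)%N ->
    (accepts (F ^~ e) y k -> (1 - eta) * NN e <= k%:R) /\
    ((1 + eta) * NN e <= k%:R -> accepts (F ^~ e) y k)].
Proof.
move=> /andP[eta0 eta1] cF.
(* Small enough for [(1 - eta) * (1 + t) <= (1 - t) ^+ 2] and
   [(1 + t) ^+ 2 <= (1 - t) * (1 + eta)]. *)
pose t := eta / 8; have t0 : 0 < t by rewrite divr_gt0.
have tV : 0 < t * V mu by rewrite mulr_gt0.
have tk : 0 < t * kap ^+ 2 by rewrite mulr_gt0// exprn_gt0.
move/cvgrPdist_le : cV => /(_ _ tV) /near_ballP[g1 g10 h1].
move/cvgrPdist_le : cF => /(_ _ tk) /near_pair_at_right0P[g2 [e2 [g20 e20 h2]]].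
have [N hN] := ln_near t0.
(* The argument of [V] must stay within [g1] of [mu]: half is left for [y], and half for [rho * D],
   whose absolute value is at most [2 * (kap * e)]. *)
exists (Num.min (g1 / 2) g2), (Num.min (g1 / (4 * kap)) e2), N; split.
- by rewrite lt_min g20 divr_gt0.
- by rewrite lt_min e20 divr_gt0// mulr_gt0.
move=> e y k; rewrite lt_min => /and3P[e0 e1 ee2].
rewrite le_min => /andP[yg1 yg2] Nk.
have {}h2 : `|kap ^+ 2 - ((F y e - y) / e) ^+ 2| <= t * kap ^+ 2.
  by apply: (h2 y e) => //; rewrite e0.
pose D := F y e - y; pose X := (kap * e) ^+ 2.
have X0 : 0 < X by rewrite exprn_gt0// mulr_gt0.
have /andP[D1 D2] : (1 - t) * X <= D ^+ 2 <= (1 + t) * X.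
  have e20' : 0 < e ^+ 2 by rewrite exprn_gt0.
  move: h2; rewrite -(ler_pM2r e20') -[X in _ * X <= _](gtr0_norm e20') -normrM.
  rewrite mulrBl -exprMn -exprMn divfK ?gt_eqF// -mulrA -exprMn -/D -/X.
  by rewrite ler_norml => /andP[d1 d2]; apply/andP; split; lra.
have t1 : t <= 1 / 8 by rewrite /t; lra.
have Dle : `|D| <= 2 * (kap * e).
  rewrite -(@ler_pXn2r _ 2) ?nnegrE//; last by rewrite mulr_ge0// ltW// mulr_gt0.
  rewrite real_normK ?num_real// exprMn -/X; apply: le_trans D2 _.
  by rewrite ler_wpM2r ?(ltW X0)//; lra.
have /andP[v1 v2] : (1 - t) * V mu <= V (y + rho * D) <= (1 + t) * V mu.
  have : `|y + rho * D - mu| <= g1.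
    rewrite addrAC; apply: le_trans (ler_normD _ _) _.
    have : `|rho * D| <= 2 * (kap * e).
      have /andP[r0 r1] := rho01; rewrite normrM (ger0_norm r0).
      by apply: le_trans Dle; rewrite ler_piMl.
    move: e1; rewrite ltr_pdivlMr ?mulr_gt0//; lra.
  by move=> /h1; rewrite ler_norml => /andP[d1 d2]; apply/andP; split; lra.
have /andP[l1 l2] := hN _ Nk.
pose A := V mu * Z ^+ 2; have A0 : 0 < A by rewrite mulr_gt0// exprn_gt0.
have NE c : (c * NN e <= k%:R) = (c * A <= k%:R * X).
  by rewrite /target_size -/A -/X mulrA ler_pdivrMr.
rewrite !NE /accepts ler_pdivlMr// -/D.
have t2 : t = eta / 8 by [].
have t'0 : 0 <= 1 - t by lra.
move: (ln_gt0 k) l1 l2 v1 v2.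
move: (ln _) (V (y + rho * D)) => l v l0 l1 l2 v1 v2.
have Vl1 : (1 - t) ^+ 2 * A <= v * l.
  rewrite [leLHS](_ : _ = (1 - t) * V mu * ((1 - t) * Z ^+ 2)); last by rewrite /A; ring.
  apply: ler_pM => //; apply: mulr_ge0; [exact: t'0|exact: ltW V0|exact: t'0|].
  exact: sqr_ge0.
have Vl2 : v * l <= (1 + t) ^+ 2 * A.
  rewrite [leRHS](_ : _ = (1 + t) * V mu * ((1 + t) * Z ^+ 2)); last by rewrite /A; ring.
  apply: ler_pM => //; last exact: ltW.
  by apply: le_trans v1; apply: mulr_ge0 => //; exact: ltW V0.
split => [ok|kX].
  have kD : k%:R * D ^+ 2 <= k%:R * ((1 + t) * X) by rewrite ler_wpM2l.
  rewrite -(@ler_pM2l _ (1 + t)); last by lra.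
  apply: (@le_trans _ _ ((1 - t) ^+ 2 * A)); last first.
    by apply: le_trans Vl1 _; apply: le_trans ok _; apply: le_trans kD _; lra.
  by rewrite [leLHS]mulrA ler_pM2r//; nra.
apply: le_trans Vl2 _; apply: (@le_trans _ _ ((1 - t) * ((1 + eta) * A))).
  by rewrite [leRHS]mulrA ler_pM2r//; nra.
apply: (@le_trans _ _ ((1 - t) * (k%:R * X))).
  by rewrite ler_wpM2l//; lra.
by rewrite mulrCA ler_wpM2l.
Qed.

End stopping_window.

Section stop_rule_window.
Context (R : realType).
Variables (V : R -> R) (rho : R) (delta_ : nat -> R) (mu kap Z : R).
Variables (L U : R -> R -> R) (m_ : R -> nat).
Hypothesis rho01 : 0 <= rho <= 1.
Hypothesis delta_01 : forall n, 0 < delta_ n < 1.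
Hypothesis ln_delta : ln (1 / delta_ n) @[n --> \oo] --> Z ^+ 2.
Hypothesis Z0 : 0 < Z.

Lemma stop_rule_accepts (e y : R) (k : nat) :
  stop_rule V rho delta_ L U e y k =
  accepts V rho delta_ (U ^~ e) y k && accepts V rho delta_ (L ^~ e) y k.
Proof. by []. Qed.

Lemma stop_rule_bounded (e : R) :
  {for mu, continuous (U ^~ e)} -> {for mu, continuous (L ^~ e)} ->
  L mu e < mu < U mu e ->
  bounded_near V (nbhs (mu + rho * (U mu e - mu))) ->
  bounded_near V (nbhs (mu + rho * (L mu e - mu))) ->
  exists (g : R) K, 0 < g /\ forall k y, (K <= k)%N -> `|y - mu| <= g ->
    stop_rule V rho delta_ L U e y k.
Proof.
move=> cU cL /andP[Lmu muU] bU bL.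
have [|g1 [K1 [g10 h1]]] :=
  accepts_bounded delta_01 ln_delta Z0 cU _ bU; first by rewrite gt_eqF.
have [|g2 [K2 [g20 h2]]] :=
  accepts_bounded delta_01 ln_delta Z0 cL _ bL; first by rewrite lt_eqF.
exists (Num.min g1 g2), (maxn K1 K2); split; first by rewrite lt_min g10.
move=> k y; rewrite geq_max le_min => /andP[k1 k2] /andP[y1 y2].
by rewrite stop_rule_accepts h1// h2.
Qed.

Hypothesis V0 : 0 < V mu.
Hypothesis cV : {for mu, continuous V}.
Hypothesis kap0 : 0 < kap.
Hypothesis L_cvg : (p.1 - L p.1 p.2) / p.2 @[p --> (nbhs mu, 0^'+)] --> kap.
Hypothesis U_cvg : (U p.1 p.2 - p.1) / p.2 @[p --> (nbhs mu, 0^'+)] --> kap.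
Hypothesis m_cvg : m_ e @[e --> 0^'+] --> \oo.
Hypothesis m_small : e ^+ 2 * (m_ e)%:R @[e --> 0^'+] --> (0 : R).

Local Notation NN := (target_size Z kap (V mu)).

Lemma stop_rule_window (eta : R) : 0 < eta < 1 ->
  exists2 g : R, 0 < g & \forall e \near 0^'+, forall k (y : R), (m_ e <= k)%N ->
    `|y - mu| <= g ->
    (stop_rule V rho delta_ L U e y k -> (1 - eta) * NN e <= k%:R) /\
    ((1 + eta) * NN e <= k%:R -> stop_rule V rho delta_ L U e y k).
Proof.
move=> eta01.
have cU2 : ((U p.1 p.2 - p.1) / p.2) ^+ 2 @[p --> (nbhs mu, 0^'+)] --> kap ^+ 2.
  by rewrite expr2; under eq_fun do rewrite expr2; exact: cvgM.
have cL2 : ((L p.1 p.2 - p.1) / p.2) ^+ 2 @[p --> (nbhs mu, 0^'+)] --> kap ^+ 2.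
  rewrite expr2; under eq_fun do rewrite -sqrrN -mulNr opprB expr2.
  exact: cvgM.
have [g1 [e1 [K1 [g10 e10 h1]]]] :=
  accepts_window rho01 delta_01 ln_delta Z0 V0 cV kap0 eta01 cU2.
have [g2 [e2 [K2 [g20 e20 h2]]]] :=
  accepts_window rho01 delta_01 ln_delta Z0 V0 cV kap0 eta01 cL2.
exists (Num.min g1 g2); first by rewrite lt_min g10.
(* As [m_ e] tends to infinity, the lower bounds required of [k] reduce to a smallness condition on
   [e]. *)
have m1 : \forall e \near 0^'+, (K1 <= m_ e)%N := m_cvg (nbhs_infty_ge K1).
have m2 : \forall e \near 0^'+, (K2 <= m_ e)%N := m_cvg (nbhs_infty_ge K2).
near=> e => k y mk; rewrite le_min => /andP[y1 y2].
have e0 : 0 < e by near: e; exact: nbhs_right_gt.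
have ee1 : 0 < e < e1 by rewrite e0; near: e; exact: nbhs_right_lt.
have ee2 : 0 < e < e2 by rewrite e0; near: e; exact: nbhs_right_lt.
have k1 : (K1 <= k)%N.
  by apply: leq_trans mk; near: e.
have k2 : (K2 <= k)%N.
  by apply: leq_trans mk; near: e.
have [s1 t1] := h1 _ _ _ ee1 y1 k1; have [s2 t2] := h2 _ _ _ ee2 y2 k2.
rewrite stop_rule_accepts; split => [/andP[/s1]//|kk].
by rewrite t1// t2.
Unshelve. all: by end_near. Qed.

Lemma target_size_cvgy : NN e @[e --> 0^'+] --> +oo.
Proof.
apply/cvgryPge => A.
pose c := V mu * Z ^+ 2 / kap ^+ 2.
have c0 : 0 < c by rewrite !(divr_gt0, mulr_gt0, exprn_gt0).
have A0 : 0 < `|A| + 1 by rewrite ltr_wpDl.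
near=> e.
have e0 : 0 < e by near: e; exact: nbhs_right_gt.
have e1 : e < 1 by near: e; exact: nbhs_right_lt.
have ec : e < c / (`|A| + 1) by near: e; apply: nbhs_right_lt; rewrite divr_gt0.
rewrite /target_size exprMn invfM mulrA -/c ler_pdivlMr ?exprn_gt0//.
move: ec; rewrite ltr_pdivlMr// => ec; apply: le_trans (ltW ec).
rewrite mulrC; apply: (@le_trans _ _ (e ^+ 2 * (`|A| + 1))).
  by rewrite ler_wpM2l// ?sqr_ge0// (le_trans (ler_norm _))// lerDl.
by rewrite ler_wpM2r// ?(ltW A0)// expr2 ler_piMl ?ltW.
Unshelve. all: by end_near. Qed.

(** [e ^+ 2 * NN e] is a positive constant while [e ^+ 2 * m_ e] tends to 0; the imposed minimal
    size therefore cannot delay stopping beyond the target. *)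
Lemma min_size_target : \forall e \near 0^'+, (m_ e)%:R <= NN e.
Proof.
pose c := V mu * Z ^+ 2 / kap ^+ 2.
have c0 : 0 < c by rewrite !(divr_gt0, mulr_gt0, exprn_gt0).
move/cvgrPdist_le : m_small => /(_ _ c0) h; near=> e.
have e0 : 0 < e by near: e; exact: nbhs_right_gt.
have : `|0 - e ^+ 2 * (m_ e)%:R| <= c by near: e.
rewrite sub0r normrN ger0_norm ?mulr_ge0 ?sqr_ge0// => he.
by rewrite /target_size exprMn invfM mulrA -/c ler_pdivlMr ?exprn_gt0// mulrC.
Unshelve. all: by end_near. Qed.

End stop_rule_window.

(** * First stopping indices and their expectation *)

Section first_index.
Context (p : pred nat).

Lemma first_index_leq k : p k -> exists2 n, first_index p = Some n & (n <= k)%N.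
Proof.
move=> pk; rewrite /first_index; case: pselect => [h|[]]; last by exists k.
by exists (ex_minn h) => //; case: ex_minnP => n _; exact.
Qed.

Lemma first_index_sat n : first_index p = Some n -> p n.
Proof.
by rewrite /first_index; case: pselect => // h [<-]; case: ex_minnP.
Qed.

Lemma first_index_min n k : first_index p = Some n -> (k < n)%N -> ~~ p k.
Proof.
rewrite /first_index; case: pselect => // h [<-].
by case: ex_minnP => j _ jmin; apply: contraTN => /jmin; rewrite -leqNgt.
Qed.

Lemma first_index_None k : first_index p = None -> ~~ p k.
Proof.
by rewrite /first_index; case: pselect => // h _; apply/negP => pk; apply: h; exists k.
Qed.

End first_index.

Section first_time.
Context d (T : measurableType d) (R : realType) (P : probability T R).
Variable p : T -> pred nat.
Hypothesis mp : forall k, measurable [set w | p w k].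

(** The event that the size exceeds [k], [None] included. The bound on [j] is inclusive, so that
    tail sums start at [k = 0]. *)
Definition not_before (k : nat) : set T := [set w | forall j, (j <= k)%N -> ~~ p w j].

Lemma measurable_not_before k : measurable (not_before k).
Proof.
rewrite (_ : not_before k = \bigcap_(j in [set j | (j <= k)%N]) ~` [set w | p w j]).
  by apply: bigcap_measurable => // [|j _]; [exists 0|exact: measurableC].
by apply/seteqP; split => w h j /h /negP.
Qed.

Let N w := first_index (p w).

(** Tail-sum formula holding at every point, the value [+oo] included; it yields both measurability
    and the expectation. *)
Lemma index_ereal_nneseries w :
  index_ereal R (N w) = (\sum_(k <oo) (\1_(not_before k) w)%:E)%E.
Proof.
have t0 (k : nat) : (0 <= (\1_(not_before k) w)%:E :> \bar R)%E by rewrite lee_fin.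
have sum1 n : (forall k, (k < n)%N -> not_before k w) ->
    (\sum_(0 <= k < n) (\1_(not_before k) w)%:E = n%:R%:E :> \bar R)%E.
  move=> h; rewrite (eq_big_nat _ _ (F2 := fun=> 1%E)); last first.
    by move=> k /andP[_ kn]; rewrite indicE mem_set//; exact: h.
  by rewrite sumEFin big_const_nat subn0 iter_addr addr0.
have := @first_index_min (p w); have := @first_index_sat (p w).
have := @first_index_None (p w); rewrite /N.
case: first_index => [n|] h1 h2 h3 /=.
  rewrite (@nneseries_split _ _ 0 n)// add0n eseries0 ?adde0 ?sum1//.
    by move=> k kn j jk; apply: (h3 _ _ erefl); exact: leq_ltn_trans kn.
  move=> k nk _; rewrite indicE memNset//= => /(_ _ nk).
  by rewrite h2.
apply/esym/eqyP => A A0; apply: (@le_trans _ _ (Num.truncn A).+1%:R%:E).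
  by rewrite lee_fin ltW// truncnS_gt.
rewrite -sum1 => [|k _ j _]; first exact: nneseries_lim_ge.
exact: h1.
Qed.

Lemma measurable_index_ereal : measurable_fun setT (fun w => index_ereal R (N w)).
Proof.
rewrite (_ : (fun w => _) = fun w => (\sum_(k <oo) (\1_(not_before k) w)%:E)%E).
  apply: ge0_emeasurable_sum => // k _; apply/measurable_EFinP.
  exact: measurable_indic (measurable_not_before k).
by apply/funext => w; rewrite index_ereal_nneseries.
Qed.

Lemma integral_index_ereal :
  (\int[P]_w index_ereal R (N w) = \sum_(k <oo) P (not_before k))%E.
Proof.
rewrite (eq_integral (fun w => (\sum_(k <oo) (\1_(not_before k) w)%:E)%E)); last first.
  by move=> w _; rewrite index_ereal_nneseries.
rewrite integral_nneseries//; last first.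
  move=> k; apply/measurable_EFinP.
  exact: measurable_indic (measurable_not_before k).
apply: eq_eseriesr => k _.
by rewrite integral_indic// ?setIT//; exact: measurable_not_before.
Qed.

(** The first [K] tail probabilities are bounded by 1, the later ones by those of [B]. *)
Lemma integral_index_le (B : nat -> set T) (K : nat) :
  (forall k, measurable (B k)) ->
  (forall k w, (K <= k)%N -> not_before k w -> B k w) ->
  (\int[P]_w index_ereal R (N w) <= K%:R%:E + \sum_(K <= k <oo) P (B k))%E.
Proof.
move=> mB hB; rewrite integral_index_ereal (@nneseries_split _ _ 0 K)// add0n.
apply: leeD.
  apply: (@le_trans _ _ (\sum_(0 <= k < K) 1%E)%E).
    apply: lee_sum => k _; apply: probability_le1; exact: measurable_not_before.
  by rewrite sumEFin big_const_nat subn0 iter_addr addr0.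
apply: lee_lim; [exact: is_cvg_nneseries|exact: is_cvg_nneseries|].
apply: nearW => n; rewrite big_nat_cond [leRHS]big_nat_cond.
apply: lee_sum => k /andP[/andP[Kk _] _].
by apply: le_measure; rewrite ?inE//; [exact: measurable_not_before|move=> w; exact: hB].
Qed.

(* Sampling cannot stop before [a] outside of the union of the [B k], [m <= k]. *)
Lemma integral_index_ge (B : nat -> set T) (m a : nat) :
  (forall k, measurable (B k)) ->
  (forall k w, (k < a)%N -> p w k -> (m <= k)%N /\ B k w) ->
  (a%:R%:E * (1 - \sum_(m <= k <oo) P (B k)) <= \int[P]_w index_ereal R (N w))%E.
Proof.
move=> mB hB; rewrite integral_index_ereal.
pose C := \bigcup_(k in [set k | (m <= k)%N]) B k.
have mC : measurable C by exact: bigcup_measurable.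
have PC : (P C <= \sum_(m <= k <oo) P (B k))%E.
  apply: measure_sigma_subadditive_tail => // w [k mk Bk]; exists k => //=.
  by rewrite ltnNge mk.
apply: (@le_trans _ _ (\sum_(0 <= k < a) P (not_before k))%E); last exact: nneseries_lim_ge.
apply: (@le_trans _ _ (\sum_(0 <= k < a) P (~` C))%E); last first.
  rewrite big_nat_cond [leRHS]big_nat_cond; apply: lee_sum => k /andP[/andP[_ ka] _].
  apply: le_measure; rewrite ?inE//; [exact: measurableC|exact: measurable_not_before|].
  move=> w nC j jk; apply/negP => pj.
  have [mj Bj] := hB _ _ (leq_ltn_trans jk ka) pj.
  by apply: nC; exists j.
have PCf : P (~` C) \is a fin_num by rewrite fin_num_measure//; exact: measurableC.
have qE : ((fine (P (~` C)))%:E = 1 - P C)%E by rewrite fineK// probability_setC.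
rewrite -(fineK PCf) sumEFin big_const_nat subn0 iter_addr addr0 -[leRHS]/((fine (P (~` C)) *+ a)%:E).
rewrite -[fine _ *+ a]mulr_natl EFinM [X in (_ <= _ * X)%E]qE lee_wpmul2l ?lee_fin//.
by rewrite leeD2l// leeN2.
Qed.

Lemma first_index_fin_ae :
  (\int[P]_w index_ereal R (N w) < +oo)%E ->
  P [set w | (index_ereal R (N w) < +oo)%E] = 1%E.
Proof.
move=> h.
have i0 w : (0 <= index_ereal R (N w))%E by rewrite index_ereal_nneseries nneseries_ge0.
have /integrable_ae : P.-integrable setT (fun w => index_ereal R (N w)).
  apply/integrableP; split; first exact: measurable_index_ereal.
  by under eq_integral do rewrite gee0_abs//.
move=> /(_ measurableT) [A [mA A0 hA]].
apply/eqP; rewrite eq_le probability_le1/=; last first.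
  rewrite -[X in measurable X]setTI; apply: emeasurable_fun_infty_o => //.
  exact: measurable_index_ereal.
rewrite -[1%E]adde0 -oppe0 -A0 -probability_setC//; apply: le_measure; rewrite ?inE//.
- exact: measurableC.
- rewrite -[X in measurable X]setTI; apply: emeasurable_fun_infty_o => //.
  exact: measurable_index_ereal.
- move=> w nA /=; rewrite -ge0_fin_numE//; apply: contrapT => nf; apply: nA.
  by apply: hA => /= /(_ I).
Qed.

End first_time.

Lemma cvge1_squeeze (R : realType) (I : Type) (F : set_system I) (FF : Filter F)
    (f : I -> \bar R) :
  (forall t : R, 0 < t < 1 -> \forall x \near F, ((1 - t)%:E <= f x <= (1 + t)%:E)%E) ->
  f x @[x --> F] --> 1%E.
Proof.
move=> h; apply/fine_cvgP; split.
  have := h (1 / 2) ltac:(lra); apply: filterS => x /andP[h1 h2].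
  by rewrite fin_numElt (lt_le_trans (ltNyr _) h1) (le_lt_trans h2 (ltry _)).
apply/cvgrPdist_le => t t0; pose u := Num.min t (1 / 2).
have u01 : 0 < u < 1.
  by rewrite lt_min t0/= divr_gt0//= gt_min; apply/orP; right; lra.
apply: filterS (h u u01) => x /=; case: (f x) => [r| |]/=.
- rewrite !lee_fin => /andP[h1 h2]; 
  apply: (@le_trans _ _ u); last by rewrite ge_min lexx.
  by rewrite ler_norml; apply/andP; split; lra.
- by rewrite leye_eq andbF.
- by [].
Qed.

(** * Asymptotics of the sample size and of the coverage *)

Section stopped_sum_arith.
Context (R : realType).
Variables (s Z th h N q r a n Sa Sn : R).
Hypotheses (s0 : 0 < s) (Z0 : 0 < Z) (th01 : 0 < th <= 1 / 2).
Hypotheses (q0 : 0 < q) (qq : q ^+ 2 = N).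
Hypothesis (h01 : 0 < h <= th / 32).
Hypotheses (rN : r * q = s * Z) (n0 : 0 < n).
Hypothesis (SnSa : `|Sn - Sa| <= 2 * (th * s * q)).

Let N0 : 0 < N. Proof. by rewrite -qq exprn_gt0. Qed.
Let r0 : 0 < r.
Proof. by rewrite -(pmulr_lgt0 _ q0) rN mulr_gt0. Qed.
Let sq0 : 0 < s * q. Proof. exact: mulr_gt0. Qed.
Let thZ : 0 < th * Z. Proof. by have /andP[t0 _] := th01; exact: mulr_gt0. Qed.
Let rNE : r * N = Z * (s * q).
Proof. by rewrite -qq expr2 mulrA rN; ring. Qed.

(** Here [q] is [sqrt N] and [r] the half-width of the interval. Coverage gives
    [|Sn| <= (1 + h) * r * n], with [r * N = Z * (s * q)]; adding the oscillation and dividing by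
    [s * sqrt a], which is at least [(1 - 2 * h) * (s * q)], costs a multiple of [th]. The factor
    [4 * Z + 4] absorbs all of these losses. *)
Lemma stopped_sum_le :
  (1 - 2 * h) * N <= a -> n <= (1 + 2 * h) * N -> `|Sn / n| <= (1 + h) * r ->
  `|Sa / (s * Num.sqrt a)| <= Z + (4 * Z + 4) * th.
Proof.
have [/andP[t0 t1] /andP[h0 h1]] := (th01, h01); have [Z1 tZ] := (Z0, thZ).
move=> aN nN; rewrite normrM normfV (gtr0_norm n0) ler_pdivrMr// => Snr.
have a0 : 0 < a by apply: lt_le_trans aN; rewrite mulr_gt0//; lra.
have sa : (1 - 2 * h) * q <= Num.sqrt a.
  rewrite -(@ler_pXn2r _ 2) ?nnegrE ?sqrtr_ge0//; last by rewrite mulr_ge0 ?(ltW q0)//; lra.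
  rewrite sqr_sqrtr ?(ltW a0)// exprMn qq; apply: le_trans aN.
  by rewrite ler_wpM2r ?(ltW N0)//; nra.
have s_sa : 0 < s * Num.sqrt a by rewrite mulr_gt0// sqrtr_gt0.
rewrite normrM normfV (gtr0_norm s_sa) ler_pdivrMr//.
have D0 : 0 <= Z + (4 * Z + 4) * th by lra.
apply: (@le_trans _ _ ((Z + (4 * Z + 4) * th) * ((1 - 2 * h) * (s * q)))); last first.
  by rewrite ler_wpM2l// mulrCA ler_wpM2l// ltW.
have Sn1 : `|Sn| <= (1 + h) * (1 + 2 * h) * (Z * (s * q)).
  apply: (le_trans Snr); rewrite -rNE.
  rewrite [leRHS](_ : _ = (1 + h) * r * ((1 + 2 * h) * N)); last by ring.
  by rewrite ler_wpM2l// mulr_ge0 ?(ltW r0)//; lra.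
have Sa1 : `|Sa| <= `|Sn| + `|Sn - Sa|.
  by rewrite -[X in `|X| <= _](subKr Sn) (le_trans (ler_normB _ _)).
apply: (le_trans Sa1); apply: (le_trans (lerD Sn1 SnSa)).
rewrite [leLHS](_ : _ = ((1 + h) * (1 + 2 * h) * Z + 2 * th) * (s * q)); last first.
  by ring.
rewrite [leRHS]mulrA ler_wpM2r ?(ltW sq0)//.
have e1 : (1 + h) * (1 + 2 * h) <= 1 + th / 8 by nra.
have e2 : (1 + h) * (1 + 2 * h) * Z <= (1 + th / 8) * Z by rewrite ler_wpM2r// ltW.
have e3 : (Z + (4 * Z + 4) * th) * (1 - th / 2) <= (Z + (4 * Z + 4) * th) * (1 - 2 * h).
  by rewrite ler_wpM2l//; lra.
have e4 : th * Z <= Z / 2 by rewrite mulrC; nra.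
have e5 : th * (th * Z) <= th * (Z / 2) by rewrite ler_wpM2l// ltW.
have e6 : th * th <= th / 2 by nra.
nra.
Qed.

(** Converse direction, where [sqrt a <= q] and the margin [(4 * Z + 4) * th] pays for the
    oscillation and for the two factors [1 - h]. *)
Lemma stopped_sum_ge :
  0 < a -> a <= N -> (1 - h) * N <= n ->
  `|Sa / (s * Num.sqrt a)| < Z - (4 * Z + 4) * th -> `|Sn / n| <= (1 - h) * r.
Proof.
have [/andP[t0 t1] /andP[h0 h1]] := (th01, h01); have [Z1 tZ] := (Z0, thZ).
move=> a0 aN nN; set u := Z - _ => Sau.
have u0 : 0 < u by apply: le_lt_trans Sau.
have s_sa : 0 < s * Num.sqrt a by rewrite mulr_gt0// sqrtr_gt0.
move: Sau; rewrite normrM normfV (gtr0_norm s_sa) ltr_pdivrMr// => Sau.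
rewrite normrM normfV (gtr0_norm n0) ler_pdivrMr//.
have Sa1 : `|Sa| <= u * (s * q).
  apply: (le_trans (ltW Sau)); rewrite ler_wpM2l ?(ltW u0)// ler_wpM2l ?(ltW s0)//.
  by rewrite -(ger0_norm (ltW q0)) -sqrtr_sqr ler_wsqrtr// qq.
have Sn1 : `|Sn| <= `|Sa| + `|Sn - Sa|.
  by rewrite -[X in `|X| <= _](subrKC Sa) ler_normD.
apply: (le_trans Sn1); apply: (le_trans (lerD Sa1 SnSa)).
apply: (@le_trans _ _ ((1 - h) * ((1 - h) * (Z * (s * q))))).
  rewrite [leLHS](_ : _ = (u + 2 * th) * (s * q)); last by ring.
  rewrite [leRHS](_ : _ = (1 - h) * (1 - h) * Z * (s * q)); last by ring.
  rewrite ler_wpM2r ?(ltW sq0)// /u.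
  have e1 : (1 - th) * Z <= (1 - h) * (1 - h) * Z by rewrite ler_wpM2r ?(ltW Z0)//; nra.
  lra.
rewrite -rNE -mulrA ler_wpM2l//; first by lra.
by rewrite mulrCA ler_wpM2l// ltW.
Qed.

End stopped_sum_arith.

Section stopping_asymptotics.
Context d (T : measurableType d) (R : realType) (P : probability T R).
Variables (Xs : nat -> {mfun T >-> R}) (mu s beta : R).
Hypothesis H : centered_iid P Xs mu s beta.
Variables (stop : R -> R -> nat -> bool) (m_ : R -> nat) (N : R -> R).

Definition stops (e : R) (w : T) : pred nat :=
  fun n => (m_ e <= n)%N && stop e (sample_mean Xs n w) n.

Local Notation size_ e w := (first_index (stops e w)).
Local Notation esize e w := (index_ereal R (size_ e w)).

Hypothesis mstop : forall (e : R) k, 0 < e -> measurable [set y | stop e y k].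

Lemma measurable_stops e k : 0 < e -> measurable [set w | stops e w k].
Proof.
move=> e0; rewrite /stops; have [mk|mk] := leqP (m_ e) k => /=; last first.
  by rewrite (_ : [set _ | _] = set0)//; apply/seteqP; split.
by have := measurable_sample_mean Xs k measurableT (mstop k e0); rewrite setTI.
Qed.

(** Not having stopped by a large [k] forces the mean at the single index [k] to be far from [mu],
    so the tail of the size is bounded by a convergent series. *)
Lemma stopping_size_fin (e g : R) (K : nat) : 0 < e -> 0 < g ->
  (forall k (y : R), (K <= k)%N -> `|y - mu| <= g -> stop e y k) ->
  P [set w | (esize e w < +oo)%E] = 1%E /\ (\int[P]_w esize e w < +oo)%E.
Proof.
move=> e0 g0 h; have ms k := measurable_stops k e0.
suff le : (\int[P]_w esize e w < +oo)%E by split => //; exact: first_index_fin_ae.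
pose K' := maxn (m_ e) K.
apply: (@le_lt_trans _ _ (K'%:R%:E + \sum_(K' <= k <oo) P (mean_far Xs mu g k))%E).
  apply: integral_index_le => // [k|k w]; first exact: measurable_mean_far.
  rewrite geq_max => /andP[mk Kk] /(_ k (leqnn _)); rewrite /stops mk/=.
  by apply: contraNP => /negP; rewrite -leNgt => /h; exact.
apply: lte_add_pinfty; first exact: ltry.
apply: le_lt_trans (complete_convergence H g0).
by rewrite [leRHS](@nneseries_split _ _ 0 K')// add0n leeDr// sume_ge0.
Qed.

(** Two implications rather than an equivalence: between the two thresholds the rule may hold or
    fail, in no particular order. *)
Definition in_window (eta g e : R) : Prop :=
  forall k (y : R), (m_ e <= k)%N -> `|y - mu| <= g ->
    (stop e y k -> (1 - eta) * N e <= k%:R) /\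
    ((1 + eta) * N e <= k%:R -> stop e y k).

Local Notation stopping_window eta g := (\forall e \near 0^'+, in_window eta g e).

Hypothesis window : forall eta : R, 0 < eta < 1 ->
  exists2 g : R, 0 < g & stopping_window eta g.
Hypothesis m_cvg : m_ e @[e --> 0^'+] --> \oo.
Hypothesis m_le : \forall e \near 0^'+, (m_ e)%:R <= N e.
Hypothesis N_cvg : N e @[e --> 0^'+] --> +oo.

Lemma N_ge (c : R) : \forall e \near 0^'+, c <= N e.
Proof. by move/cvgryPge : N_cvg; exact. Qed.

Lemma m_ge K : \forall e \near 0^'+, (K <= m_ e)%N.
Proof. exact: m_cvg (nbhs_infty_ge K). Qed.

Lemma stopping_size_fin_near : \forall e \near 0^'+,
  P [set w | (esize e w < +oo)%E] = 1%E /\ (\int[P]_w esize e w < +oo)%E.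
Proof.
have [g g0 hg] := window (ltac:(lra) : (0 : R) < 1 / 2 < 1).
near=> e.
have e0 : 0 < e by near: e; exact: nbhs_right_gt.
have he : in_window (1 / 2) g e by near: e.
apply: (@stopping_size_fin e g (maxn (m_ e) (Num.truncn ((1 + 1 / 2) * N e)).+1)) => //.
move=> k y; rewrite geq_max => /andP[mk tk] yg; have [_] := he k y mk yg; apply.
by apply/ltW/(lt_le_trans (truncnS_gt _)); rewrite ler_nat.
Unshelve. all: by end_near. Qed.

(** A statement about single paths, for all of them at once. The upper bound has [2 * eta] because
    the witness index is rounded up, which costs at most 1 and hence at most [eta * N e]. *)
Lemma stopping_size_bracket (eta g : R) : 0 < eta < 1 -> stopping_window eta g ->
  \forall e \near 0^'+, forall w,
  (forall k, (m_ e <= k)%N -> `|sample_mean Xs k w - mu| <= g) ->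
  exists n, [/\ size_ e w = Some n, (m_ e <= n)%N, (1 - eta) * N e <= n%:R &
                n%:R <= (1 + 2 * eta) * N e].
Proof.
move=> /andP[eta0 eta1] hg; near=> e => w hw.
have he : in_window eta g e by near: e.
have mN : (m_ e)%:R <= N e by near: e.
have N1 : 1 / eta <= N e by near: e; exact: N_ge.
have {}N1 : 1 <= eta * N e by rewrite mulrC -ler_pdivrMr.
have N0 : 0 <= N e by apply: le_trans mN.
pose b := (Num.truncn ((1 + eta) * N e)).+1.
have Nb : (1 + eta) * N e < b%:R by exact: truncnS_gt.
have bN : b%:R <= (1 + 2 * eta) * N e.
  have : (Num.truncn ((1 + eta) * N e))%:R <= (1 + eta) * N e.
    by rewrite truncn_le mulr_ge0//; lra.
  by rewrite /b -[_.+1%:R]natr1; lra.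
have mb : (m_ e <= b)%N.
  by rewrite -(ler_nat R); apply: (le_trans mN); apply: le_trans (ltW Nb); nra.
have sb : stops e w b.
  rewrite /stops mb/=; have [_] := he b (sample_mean Xs b w) mb (hw _ mb); apply.
  exact: ltW.
have [n nE nb] := first_index_leq sb.
have /andP[mn sn] := first_index_sat nE.
exists n; split => //; first by have [+ _] := he n (sample_mean Xs n w) mn (hw _ mn); exact.
by apply: le_trans bN; rewrite ler_nat.
Unshelve. all: by end_near. Qed.

(** Borel-Cantelli is applied to the radii [1 / (j + 1)], whose countability leaves a single null
    set. *)
Lemma mean_near_ae : {ae P, forall w, forall g, 0 < g ->
  exists K, forall k, (K <= k)%N -> `|sample_mean Xs k w - mu| <= g}.
Proof.
have : {ae P, forall w, forall j : nat,
  exists K, forall k, (K <= k)%N -> `|sample_mean Xs k w - mu| <= j.+1%:R^-1}.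
  apply: ae_foralln => j.
  have j0 : (0 : R) < j.+1%:R^-1 by rewrite invr_gt0.
  exists (lim_sup_set (mean_far Xs mu j.+1%:R^-1)); split.
  - apply: bigcapT_measurable => k; apply: bigcup_measurable => i _.
    exact: measurable_mean_far.
  - apply: lim_sup_set_cvg0 (complete_convergence H j0) => k.
    exact: measurable_mean_far.
  - move=> w /= nw k _; apply: contrapT => nk; apply: nw; exists k => i ki.
    rewrite leNgt; apply/negP => gi; apply: nk; exists i => //.
apply: filterS => w hw g g0.
have [K hK] := hw (Num.truncn g^-1); exists K => k /hK /le_trans; apply.
by rewrite invf_ple ?posrE// ltW// truncnS_gt.
Qed.

(** On a good path all means from some [K] on are close to [mu], and [m_ e] eventually exceeds [K].
    The null set comes from the means alone, so letting [e] vary over a continuum adds no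
    exceptional set. *)
Lemma stopping_ratio_ae : {ae P, forall w,
  (esize e w / (N e)%:E)%E @[e --> 0^'+] --> 1%E}.
Proof.
apply: filterS mean_near_ae => w hw; apply: cvge1_squeeze => t /andP[t0 t1].
have t2 : 0 < t / 2 < 1 by apply/andP; split; lra.
have [g g0 hg] := window t2.
have [K hK] := hw g g0.
have br := stopping_size_bracket t2 hg.
near=> e.
have N0 : 1 <= N e by near: e; exact: N_ge.
have {}N0 : 0 < N e by lra.
have Km : (K <= m_ e)%N by near: e; exact: m_ge.
have : forall w,
  (forall k, (m_ e <= k)%N -> `|sample_mean Xs k w - mu| <= g) ->
  exists n, [/\ size_ e w = Some n, (m_ e <= n)%N, (1 - t / 2) * N e <= n%:R &
                n%:R <= (1 + 2 * (t / 2)) * N e] by near: e.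
move=> /(_ w) [k mk|n [-> _ n1 n2]]; first by apply: hK; exact: leq_trans mk.
rewrite /= inver gt_eqF// lee_pdivlMr// lee_pdivrMr// -!EFinM !lee_fin.
by apply/andP; split; nra.
Unshelve. all: by end_near. Qed.

Lemma stopping_mean_ratio :
  ((\int[P]_w esize e w) / (N e)%:E)%E @[e --> 0^'+] --> 1%E.
Proof.
apply: cvge1_squeeze => t /andP[t0 t1].
have t2 : 0 < t / 4 < 1 by apply/andP; split; lra.
have [g g0 hg] := window t2.
have cc := complete_convergence H g0.
have tail := nneseries_tail_cvg cc (fun _ _ => measure_ge0 _ _).
pose S k := (\sum_(k <= j <oo) P (mean_far Xs mu g j))%E.
have S0 k : (0 <= S k)%E by apply: nneseries_ge0.
have SleS0 k : (S k <= S 0%N)%E.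
  by rewrite /S [leRHS](@nneseries_split _ _ 0 k)// add0n leeDr// sume_ge0.
have Sfin k : S k \is a fin_num by rewrite ge0_fin_numE// (le_lt_trans (SleS0 k)).
have t40 : 0 < t / 4 by lra.
have {tail} : \forall k \near \oo, fine (S k) <= t / 4.
  move/fine_cvgP : tail => [_] /cvgrPdist_le /(_ _ t40); apply: filterS => k /=.
  by rewrite sub0r normrN; apply: le_trans; exact: ler_norm.
move=> /near_ooP[K hK].
near=> e.
have e0 : 0 < e by near: e; exact: nbhs_right_gt.
have ms k := measurable_stops k e0.
have N1 : 1 <= N e by near: e; exact: N_ge.
have N0 : 0 < N e by lra.
have Km : (K <= m_ e)%N by near: e; exact: m_ge.
have mN : (m_ e)%:R <= N e by near: e.
have N2 : 4 / t <= N e by near: e; exact: N_ge.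
have {}N2 : 4 <= t * N e by rewrite mulrC -ler_pdivrMr.
(* The complete convergence series is a constant in the upper bound; it is absorbed in
   [t / 4 * N e], like the rounding error 1 through [N2]. *)
have N3 : 4 * fine (S 0%N) / t <= N e by near: e; exact: N_ge.
have {}N3 : 4 * fine (S 0%N) <= t * N e by rewrite [leRHS]mulrC -ler_pdivrMr.
have he : in_window (t / 4) g e by near: e.
rewrite /= inver gt_eqF// lee_pdivlMr// lee_pdivrMr// -!EFinM; apply/andP; split.
  pose a := Num.truncn ((1 - t / 4) * N e).
  have aN : (1 - t / 4) * N e < a.+1%:R by exact: truncnS_gt.
  apply: (@le_trans _ _ (a%:R%:E * (1 - S (m_ e)))%E); last first.
    apply: integral_index_ge => // [k|k w ka]; first exact: measurable_mean_far.
    move=> /andP[mk sk]; split => //; rewrite /mean_far/= ltNge; apply/negP => yg.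
    have [/(_ sk) + _] := he k _ mk yg.
    apply/negP; rewrite -ltNge; apply: (@lt_le_trans _ _ a%:R); first by rewrite ltr_nat.
    by rewrite truncn_le mulr_ge0//; lra.
  rewrite -(fineK (Sfin (m_ e))) -EFinB -EFinM lee_fin.
  have := hK _ Km; have := fine_ge0 (S0 (m_ e)); move: aN.
  rewrite -[a.+1%:R]natr1; move: (fine _) (a%:R : R) => x y h1 h2 h3.
  have y0 : 0 <= y by nra.
  apply: (@le_trans _ _ (y * (1 - t / 4))); last by rewrite ler_wpM2l//; lra.
  nra.
pose b := (Num.truncn ((1 + t / 4) * N e)).+1.
have Nb : (1 + t / 4) * N e < b%:R by exact: truncnS_gt.
have bN : b%:R <= (1 + t / 4) * N e + 1.
  have : (Num.truncn ((1 + t / 4) * N e))%:R <= (1 + t / 4) * N e.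
    by rewrite truncn_le mulr_ge0//; lra.
  by rewrite /b -[_.+1%:R]natr1; lra.
have mb : (m_ e <= b)%N.
  by rewrite -(ler_nat R); apply: (le_trans mN); apply: le_trans (ltW Nb); nra.
apply: (@le_trans _ _ (b%:R%:E + S b)%E).
  apply: integral_index_le => // [k|k w bk]; first exact: measurable_mean_far.
  have mk : (m_ e <= k)%N := leq_trans mb bk.
  move=> /(_ k (leqnn _)); rewrite /stops mk/=.
  apply: contraNP => /negP; rewrite -leNgt => yg.
  have [_ ] := he k _ mk yg; apply; apply/ltW/(lt_le_trans Nb).
  by rewrite ler_nat.
apply: (@le_trans _ _ (b%:R%:E + S 0%N)%E); first by rewrite leeD2l.
rewrite -(fineK (Sfin 0%N)) -EFinD lee_fin; lra.
Unshelve. all: by end_near. Qed.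

Variables (hit : R -> R -> bool) (Z : R) (r : R -> R).
Hypothesis mhit : forall e : R, 0 < e -> measurable [set y | hit e y].
Hypothesis Z0 : 0 < Z.
Hypothesis r_scale : forall e, 0 < e -> r e * Num.sqrt (N e) = s * Z.
Hypothesis hit_window : forall eta : R, 0 < eta < 1 ->
  exists2 g : R, 0 < g & \forall e \near 0^'+, forall y, `|y - mu| <= g ->
    (`|y - mu| <= (1 - eta) * r e -> hit e y) /\
    (hit e y -> `|y - mu| <= (1 + eta) * r e).

Definition hits (e : R) : set T :=
  [set w | exists2 n, size_ e w = Some n & hit e (sample_mean Xs n w)].

Lemma measurable_hits e : 0 < e -> measurable (hits e).
Proof.
move=> e0.
have mh n : measurable [set w | hit e (sample_mean Xs n w)].
  by have := measurable_sample_mean Xs n measurableT (mhit e0); rewrite setTI.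
rewrite (_ : hits e = \bigcup_n (([set w | stops e w n] `&`
    (\bigcap_(j in [set j | (j < n)%N]) ~` [set w | stops e w j])) `&`
    [set w | hit e (sample_mean Xs n w)])).
  apply: bigcupT_measurable => n; apply: measurableI => //; apply: measurableI.
    exact: measurable_stops.
  by apply: bigcap_measurableType => j _; exact/measurableC/measurable_stops.
apply/seteqP; split => w.
  move=> [n nE hn]; exists n => //; split => //; split; first exact: first_index_sat nE.
  by move=> j /= jn; exact/negP/(first_index_min nE).
move=> [n _ [[sn hn] hit_n]]; exists n => //.
have [n' n'E n'n] := first_index_leq sn; rewrite n'E; congr Some; apply/eqP.
by rewrite eqn_leq n'n leqNgt; apply/negP => /hn; apply; exact: first_index_sat n'E.
Qed.

(* Outside of [bad], the sample size is close to [N e] and, by Ottaviani's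
   inequality, the stopped sum is close to the sum of a fixed number [a] of
   terms, to which the central limit theorem applies. *)
Lemma hits_comparison (th : R) (K : nat) : 0 < th <= 1 / 2 ->
  \forall e \near 0^'+, exists a bad, [/\ (K <= a)%N, measurable bad,
    (P bad <= (2 * th)%:E)%E,
    hits e `\` bad `<=`
      [set w | `|normalized_sum Xs mu s a w| <= Z + (4 * Z + 4) * th]%R &
    [set w | `|normalized_sum Xs mu s a w| < Z - (4 * Z + 4) * th]%R `\` bad
      `<=` hits e].
Proof.
move=> th01; have /andP[t0 t1] := th01.
have s0 := ciid_sd_gt0 H.
(* With oscillation level [c = th * s * q] and at most [4 * h * N e] later samples, Ottaviani's
   bound is [8 * h / th ^+ 2], which this choice makes equal to [th]. *)
pose h := th ^+ 3 / 8.
have h0 : 0 < h by rewrite divr_gt0 ?exprn_gt0.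
have h1 : h <= th / 32.
  rewrite /h -[th ^+ 3]/(th * (th * th)).
  have th2 : th * th <= 1 / 4 by nra.
  have : th * (th * th) <= th * (1 / 4) by rewrite ler_wpM2l// ltW.
  by lra.
have hE : h * 8 = th ^+ 3 by rewrite /h divfK.
have h01 : 0 < h <= th / 32 by rewrite h0.
have h_le2 : 1 / 2 <= 1 - h by lra.
have h_lt1 : h < 1 by lra.
have th_lt1 : th < 1 by lra.
have h02 : 0 < h < 1 by rewrite h0.
have [g1 g10 hg1] := window h02.
have [g2 g20 hg2] := hit_window h02.
pose g := Num.min g1 g2.
have g0 : 0 < g by rewrite lt_min g10.
have cc := complete_convergence H g0.
have tail := nneseries_tail_cvg cc (fun _ _ => measure_ge0 _ _).
have [K1 hK1] : exists K1, forall k, (K1 <= k)%N ->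
    (\sum_(k <= j <oo) P (mean_far Xs mu g j) <= th%:E)%E.
  apply/near_ooP; move/fine_cvgP : tail => [f1 /cvgrPdist_le /(_ _ t0) f2].
  near=> k; have f1k : (\sum_(k <= j <oo) P (mean_far Xs mu g j))%E \is a fin_num by near: k.
  rewrite -(fineK f1k) lee_fin (le_trans (ler_norm _))// -normrN -sub0r.
  by near: k.
have br := stopping_size_bracket h02 hg1.
near=> e.
have e0 : 0 < e by near: e; exact: nbhs_right_gt.
have he1 : in_window h g1 e by near: e.
have he2 : forall y, `|y - mu| <= g2 ->
    (`|y - mu| <= (1 - h) * r e -> hit e y) /\
    (hit e y -> `|y - mu| <= (1 + h) * r e) by near: e.
have hb : forall w,
  (forall k, (m_ e <= k)%N -> `|sample_mean Xs k w - mu| <= g1) ->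
  exists n, [/\ size_ e w = Some n, (m_ e <= n)%N, (1 - h) * N e <= n%:R &
                n%:R <= (1 + 2 * h) * N e] by near: e.
have K1m : (K1 <= m_ e)%N by near: e; exact: m_ge.
have m1 : (1 <= m_ e)%N by near: e; exact: m_ge.
have NK : 2 * K.+1%:R <= N e by near: e; exact: N_ge.
have N1 : 1 / h <= N e by near: e; exact: N_ge.
have {}N1 : 1 <= h * N e by rewrite mulrC -ler_pdivrMr.
have N0 : 0 < N e by apply: lt_le_trans NK; rewrite mulr_gt0// ltr0n.
(* The stopped index lies between [a] and [a + D]: the window has length [3 * h * N e], and the
   rounding of [a] is paid by [1 <= h * N e]. *)
pose a := Num.truncn ((1 - h) * N e); pose D := Num.truncn (4 * h * N e).
have aN : a%:R <= (1 - h) * N e by rewrite truncn_le mulr_ge0 ?(ltW N0)// subr_ge0 ltW.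
have Na : (1 - h) * N e < a%:R + 1 by rewrite natr1; exact: truncnS_gt.
have DN : D%:R <= 4 * h * N e by rewrite truncn_le mulr_ge0 ?(ltW N0)// mulr_ge0// ltW.
have ND : 4 * h * N e < D.+1%:R by exact: truncnS_gt.
have Ka : (K < a)%N.
  rewrite truncn_ge_nat ?mulr_ge0 ?subr_ge0 ?(ltW N0) ?(ltW h_lt1)//.
  apply: (@le_trans _ _ (1 / 2 * N e)); last by rewrite ler_wpM2r ?(ltW N0).
  by rewrite div1r mulrC ler_pdivlMr// mulrC.
have a0 : 0 < (a%:R : R) by rewrite ltr0n (leq_trans _ Ka).
pose q := Num.sqrt (N e); have q0 : 0 < q by rewrite sqrtr_gt0.
have qq : q ^+ 2 = N e by rewrite sqr_sqrtr// ltW.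
pose c := th * s * q.
have c0 : 0 < c by rewrite !mulr_gt0.
pose osc := [set w | exists2 i, (i <= D)%N & (2 * c <= `|csum Xs mu a (a + i) w|)%R].
pose far := \bigcup_(k in [set k | (m_ e <= k)%N]) mean_far Xs mu g k.
have mosc : measurable osc.
  rewrite (_ : osc = \bigcup_(i in [set i | (i <= D)%N])
      [set w | 2 * c <= `|csum Xs mu a (a + i) w|]).
    apply: bigcup_measurable => i _; apply: measurable_set_ler => //.
    apply: measurableT_comp => //; apply: (@samples_measurable_sub _ _ _ P Xs (ciid_indep H) setT).
    exact: samples_measurable_csum.
  by apply/seteqP; split => w [i]; exists i.
have mfar : measurable far.
  by apply: bigcup_measurable => k _; exact: measurable_mean_far.
have Posc : (P osc <= th%:E)%E.
  have sq : 0 < s ^+ 2 * N e by rewrite mulr_gt0 ?exprn_gt0.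
  have cE : c ^+ 2 = th ^+ 2 * (s ^+ 2 * N e) by rewrite /c -qq; ring.
  have Ds : 2 * (D%:R * s ^+ 2) <= th * c ^+ 2.
    rewrite [leRHS](_ : _ = h * 8 * (s ^+ 2 * N e)); last by rewrite hE cE; ring.
    apply: (@le_trans _ _ (2 * (4 * h * N e * s ^+ 2))).
      by rewrite ler_pM2l// ler_pM2r// exprn_gt0.
    by rewrite (_ : 2 * _ = h * 8 * (s ^+ 2 * N e))//; ring.
  apply: (le_trans (ottaviani H _ c0 _)); last first.
    by rewrite lee_fin mulrA ler_pdivrMr ?exprn_gt0.
  by apply: (le_trans Ds); rewrite ler_piMl ?sqr_ge0// ltW.
have Pfar : (P far <= th%:E)%E.
  apply: le_trans (hK1 _ K1m); apply: measure_sigma_subadditive_tail => //.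
    by move=> k; exact: measurable_mean_far.
  by move=> w [k mk Bk]; exists k => //=; rewrite ltnNge mk.
have fixed w : ~ far w -> ~ osc w -> exists n, [/\ size_ e w = Some n, (0 < n)%N,
    `|sample_mean Xs n w - mu| <= g2, (1 - h) * N e <= n%:R <= (1 + 2 * h) * N e &
    `|csum Xs mu 0 n w - csum Xs mu 0 a w| <= 2 * (th * s * q)].
  move=> nfar nosc.
  have hw k : (m_ e <= k)%N -> `|sample_mean Xs k w - mu| <= g.
    by move=> mk; rewrite leNgt; apply/negP => gk; apply: nfar; exists k.
  have [|n [nE mn n1 n2]] := hb w.
    by move=> k /hw /le_trans; apply; rewrite ge_min lexx.
  exists n; split => //.
  - exact: leq_trans mn.
  - by apply: (le_trans (hw _ mn)); rewrite ge_min lexx orbT.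
  - by rewrite n1.
  have an : (a <= n)%N by rewrite -(ler_nat R); exact: le_trans n1.
  have nD : (n - a <= D)%N.
    rewrite leq_subLR -ltnS -addnS -(ltr_nat R) natrD; apply: (le_lt_trans n2).
    rewrite (_ : (1 + 2 * h) * N e = (1 - h) * N e + (4 * h * N e - h * N e)); last by ring.
    apply: (lt_le_trans (ltr_leD Na (lerB (ltW ND) N1))).
    by rewrite addrACA subrr addr0.
  rewrite csum_sub// leNgt; apply/negP => /ltW cs; apply: nosc.
  by exists (n - a)%N => //; rewrite subnKC.
exists a, (far `|` osc); split.
- exact: ltnW.
- exact: measurableU.
- apply: (le_trans (measureU2 _ _ _)) => //.
  by rewrite mulr_natl mulr2n EFinD; exact: leeD.
- move=> w [[n nE hn] /not_orP[nfar nosc]] /=.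
  have [n' [n'E n'0 n'g /andP[n'1 n'2] n'S]] := fixed _ nfar nosc.
  move: n'E n'0 n'g n'1 n'2 n'S; rewrite nE => -[<-] n0 ng n1 n2 nS.
  have nr : (0 : R) < n%:R by rewrite ltr0n.
  apply: (stopped_sum_le s0 Z0 th01 q0 qq h01 (r_scale e0) nr nS) => //.
    rewrite (_ : (1 - 2 * h) * N e = (1 - h) * N e - h * N e); last by ring.
    by rewrite lerBlDr (le_trans (ltW Na))// lerD2l.
  by rewrite -sample_mean_csum//; have [_] := he2 _ ng; exact.
- move=> w [/= Wa /not_orP[nfar nosc]].
  have [n [nE n0 ng /andP[n1 n2] nS]] := fixed _ nfar nosc.
  have nr : (0 : R) < n%:R by rewrite ltr0n.
  exists n => //; have [+ _] := he2 _ ng; apply; rewrite sample_mean_csum//.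
  have aN' : a%:R <= N e by apply: (le_trans aN); rewrite ler_piMl ?(ltW N0)// gerBl ltW.
  exact: (stopped_sum_ge s0 Z0 th01 q0 qq h01 (r_scale e0) nr nS a0 aN' n1 Wa).
Unshelve. all: by end_near. Qed.

End stopping_asymptotics.

(** * Limit of the coverage probability *)

Section coverage.
Context d (T : measurableType d) (R : realType) (P : probability T R).
Variables (Xs : nat -> {mfun T >-> R}) (mu s beta : R).
Hypothesis H : centered_iid P Xs mu s beta.

Lemma coverage_cvg (B : R -> set T) (Z : R) : 0 < Z ->
  (forall e, 0 < e -> measurable (B e)) ->
  (forall (th : R) (K : nat), 0 < th <= 1 / 2 ->
    \forall e \near 0^'+, exists a bad, [/\ (K <= a)%N, measurable bad,
    (P bad <= (2 * th)%:E)%E,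
    B e `\` bad `<=`
      [set w | `|normalized_sum Xs mu s a w| <= Z + (4 * Z + 4) * th]%R &
    [set w | `|normalized_sum Xs mu s a w| < Z - (4 * Z + 4) * th]%R `\` bad
      `<=` B e]) ->
  P (B e) @[e --> 0^'+] --> (normal_ball Z)%:E.
Proof.
move=> Z0 mB hB.
have fB e : 0 < e -> P (B e) \is a fin_num by move=> /mB mBe; exact: fin_num_measure.
apply/fine_cvgP; split; first by near=> e; apply: fB; near: e; exact: nbhs_right_gt.
apply/cvgrPdist_le => t t0.
pose c := 4 * Z + 4; have c0 : 0 < c by rewrite /c; lra.
pose p := 2 * normal_peak (1 : R).
have p0 : 0 <= p by rewrite mulr_ge0// normal_peak_ge0.
(* Total error per unit of [th]: [p * c] for changing the radius by [c * th], 1 for the central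
   limit theorem and 2 for the exceptional set. *)
pose C := p * c + 3; have C0 : 0 < C by rewrite /C ltr_wpDl// mulr_ge0// ltW.
(* The bound [Z / (2 * c)] keeps the inner radius [Z - c * th] positive. *)
pose th := Num.min (1 / 2) (Num.min (Z / (2 * c)) (t / C)).
have th1 : th <= 1 / 2 by rewrite ge_min lexx.
have th2 : th * (2 * c) <= Z by rewrite -ler_pdivlMr ?mulr_gt0// !ge_min lexx orbT.
have th3 : th * C <= t by rewrite -ler_pdivlMr// !ge_min lexx !orbT.
have th0 : 0 < th by rewrite !lt_min; apply/and3P; split; [lra|rewrite divr_gt0 ?mulr_gt0|rewrite divr_gt0].
clearbody th.
have tc0 : 0 < c * th by rewrite mulr_gt0.
have tp0 : 0 <= Z + c * th by lra.
have tm0 : 0 < Z - c * th by nra.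
have [K1 hK1] := near_ooP (clt_upper H tp0 th0).
have [K2 hK2] := near_ooP (clt_lower H tm0 th0).
have th01 : 0 < th <= 1 / 2 by rewrite th0.
have nB := hB th (maxn K1 K2) th01.
have bZ : normal_ball Z <= normal_ball (Z - c * th) + p * (c * th).
  by apply: le_trans (normal_ball_lip (ltW tm0) _) _; [lra|rewrite -/p; lra].
have Zb : normal_ball (Z + c * th) <= normal_ball Z + p * (c * th).
  by apply: le_trans (normal_ball_lip (ltW Z0) _) _; [lra|rewrite -/p; lra].
have CE : th * C = p * (c * th) + 3 * th by rewrite /C; ring.
near=> e.
have e0 : 0 < e by near: e; exact: nbhs_right_gt.
have : exists a bad, [/\ (maxn K1 K2 <= a)%N, measurable bad,
    (P bad <= (2 * th)%:E)%E,
    B e `\` bad `<=`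
      [set w | `|normalized_sum Xs mu s a w| <= Z + c * th]%R &
    [set w | `|normalized_sum Xs mu s a w| < Z - c * th]%R `\` bad `<=` B e].
  by near: e.
move=> [a [bad [Ka mbad Pbad hup hlow]]].
move: Ka; rewrite geq_max => /andP[/hK1 up /hK2 low].
have mW : measurable_fun setT (fun w => `|normalized_sum Xs mu s a w|).
  by apply: measurableT_comp => //; exact: (measurable_normalized_sum H).
have mWu : measurable [set w | `|normalized_sum Xs mu s a w| <= Z + c * th]%R.
  exact: measurable_set_ler.
have mWl : measurable [set w | `|normalized_sum Xs mu s a w| < Z - c * th]%R.
  exact: measurable_set_ltr.
have mBe := mB _ e0.
have u1 : (P (B e) <= (normal_ball (Z + c * th) + th + 2 * th)%:E)%E.
  rewrite EFinD; apply: le_trans (leeD up Pbad); apply: le_trans (measureU2 _ _ _) => //.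
  apply: le_measure; rewrite ?inE//; first exact: measurableU.
  by move=> w Bw; have [bw|nbw] := pselect (bad w); [right|left; apply: hup].
have l1 : ((normal_ball (Z - c * th) - th)%:E <= P (B e) + (2 * th)%:E)%E.
  apply: (le_trans low); apply: le_trans (leeD2l _ Pbad); apply: le_trans (measureU2 _ _ _) => //.
  apply: le_measure; rewrite ?inE//; first exact: measurableU.
  by move=> w Ww; have [bw|nbw] := pselect (bad w); [right|left; apply: hlow].
rewrite /=.
move: u1 l1; rewrite -(fineK (fB _ e0)) -EFinD !lee_fin => u1 l1.
by rewrite ler_norml; apply/andP; split; lra.
Unshelve. all: by end_near. Qed.

End coverage.

(** * From identically distributed samples to common moments *)

Section identically_distributed.
Context d (T : measurableType d) (R : realType) (P : probability T R).
Variables X X' : {mfun T >-> R}.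
Hypothesis eqd : forall A : set R, measurable A ->
  distribution P X' A = distribution P X A.
Local Notation intg f := (P.-integrable [set: T] (EFin \o (f : T -> R))).

Lemma ge0_eqd_integral (f : R -> \bar R) : measurable_fun setT f ->
  (forall y, 0 <= f y)%E -> (\int[P]_w f (X' w) = \int[P]_w f (X w))%E.
Proof.
move=> mf f0; rewrite -[LHS]/(\int[P]_w (f \o X') w)%E -[RHS]/(\int[P]_w (f \o X) w)%E.
rewrite -!ge0_integral_distribution//.
by apply: eq_measure_integral => A mA _; exact: eqd.
Qed.

Lemma eqd_integrable (f : R -> R) : measurable_fun setT f ->
  intg (fun w => f (X w)) -> intg (fun w => f (X' w)).
Proof.
move=> mf /integrableP[_ iX]; apply/integrableP; split.
  by apply/measurable_EFinP; exact: measurableT_comp.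
rewrite (ge0_eqd_integral (f := fun y => `|(f y)%:E|%E))//.
by apply: measurableT_comp => //; exact/measurable_EFinP.
Qed.

Lemma eqd_Rintegral (f : R -> R) : measurable_fun setT f ->
  intg (fun w => f (X w)) -> \int[P]_w f (X' w) = \int[P]_w f (X w).
Proof.
move=> mf iX; rewrite /Rintegral; congr fine.
rewrite -[LHS]/(\int[P]_w ((EFin \o f) \o X') w)%E -[RHS]/(\int[P]_w ((EFin \o f) \o X) w)%E.
have mf' : measurable_fun setT (EFin \o f) by exact/measurable_EFinP.
rewrite -!integral_distribution//; last exact: eqd_integrable.
by apply: eq_measure_integral => A mA _; exact: eqd.
Qed.

End identically_distributed.

Section iid_centered.
Context d (T : measurableType d) (R : realType) (P : probability T R).
Variables (X : {mfun T >-> R}) (Xs : nat -> {mfun T >-> R}) (mu : R).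
Hypothesis iid : iid_samples P X Xs.
Hypothesis mean : ('E_P[X] = mu%:E)%E.
Hypothesis moment3 : ('E_P[(fun w => `|X w| ^+ 3)%R] < +oo)%E.
Hypothesis var_gt0 : (0 < variance P X)%E.
Local Notation intg f := (P.-integrable [set: T] (EFin \o (f : T -> R))).

Let cX : cube_integrable P X.
Proof.
split => //; apply/integrableP; split.
  by apply/measurable_EFinP; apply: measurable_funX; exact: measurableT_comp.
move: moment3; rewrite unlock; congr (_ < _)%E; apply: eq_integral => w _.
by rewrite /= normrX normr_id.
Qed.

Let cXmu : cube_integrable P (fun w => X w - mu).
Proof. exact: (cube_integrableD cX (cube_integrable_cst P (- mu))). Qed.

Lemma iid_varianceE : variance P X = (\int[P]_w ((X w - mu) ^+ 2))%:E.
Proof.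
rewrite /variance unlock mean/= unlock.
rewrite /Rintegral fineK; last exact: integrable_fin_num (cube_integrable2 cXmu).
by apply: eq_integral => w _; rewrite expr2.
Qed.

Lemma iid_centered : centered_iid P Xs mu (Num.sqrt (fine (variance P X)))
  (\int[P]_w (`|X w - mu| ^+ 3)).
Proof.
have v0 : 0 < \int[P]_w ((X w - mu) ^+ 2).
  by rewrite -lte_fin -iid_varianceE.
have mc : measurable_fun setT (fun x : R => x - mu) by exact: measurable_funB.
have m2 : measurable_fun setT (fun x : R => (x - mu) ^+ 2) by exact: measurable_funX.
have m3 : measurable_fun setT (fun x : R => `|x - mu| ^+ 3).
  by apply: measurable_funX; exact: measurableT_comp.
have [eqd ind] := iid; split => //.
- by rewrite iid_varianceE sqrtr_gt0.
- move=> i; split; first exact: measurable_funB.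
  exact: (eqd_integrable (eqd i) m3 cXmu.2).
- move=> i; rewrite (eqd_Rintegral (eqd i) mc (cube_integrable1 cXmu)).
  rewrite RintegralB//=; last 2 first.
  + exact: cube_integrable1 cX.
  + exact: finite_measure_integrable_cst.
  rewrite Rintegral_cst1 /Rintegral; move: mean; rewrite unlock => -> /=.
  by rewrite subrr.
- move=> i; rewrite (eqd_Rintegral (eqd i) m2 (cube_integrable2 cXmu)).
  by rewrite iid_varianceE sqr_sqrtr// ltW.
- by move=> i; rewrite (eqd_Rintegral (eqd i) m3 cXmu.2).
Qed.

End iid_centered.

Lemma continuous_section (R : realType) (F : R -> R -> R) (y e : R) :
  {for (y, e), continuous (fun p => F p.1 p.2)} -> {for y, continuous (F ^~ e)}.
Proof.
move=> cF.
have ye : (x, e) @[x --> y] --> (y, e).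
  exact: (@cvg_pair R R R (nbhs y) (nbhs y) (nbhs e) _ _ _ id (fun=> e) cvg_id (cvg_cst e)).
exact: (cvg_comp _ (fun p => F p.1 p.2) ye cF).
Qed.

Section variance_fun.
Context d (T : measurableType d) (R : realType) (Theta : set R).
Variables (Pr : R -> probability T R) (X : {mfun T >-> R}).
Hypothesis cv : {within Theta, continuous (fun t => fine (variance (Pr t) X))}.
Local Notation V := (variance_fun Theta Pr X).

(** In the interior, [V] agrees with the variance on a whole neighbourhood, so its extension by 0 is
    not seen. *)
Lemma variance_fun_continuous (mu : R) : Theta° mu -> {for mu, continuous V}.
Proof.
move=> Tmu; have Vmu : V mu = fine (variance (Pr mu) X).
  by rewrite /variance_fun mem_set//; exact: interior_subset.
have cmu : fine (variance (Pr t) X) @[t --> mu] --> fine (variance (Pr mu) X).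
  by rewrite (nbhs_subspace_interior Tmu); exact: cv.
rewrite /prop_for /continuous_at Vmu; apply: cvg_trans cmu; apply: near_eq_cvg.
by apply: filterS Tmu => t Tt; rewrite /variance_fun mem_set.
Qed.

Lemma measurable_variance_fun : is_interval Theta -> measurable_fun setT V.
Proof.
move=> iT; have mT : measurable Theta := is_interval_measurable iT.
apply: (@measurable_fun_if _ _ _ _ _ _ _ measurableT (fun t => t \in Theta)) => //.
- by apply: (measurable_fun_bool true); rewrite setTI preimage_mem_true.
- rewrite setTI preimage_mem_true.
  exact: subspace_continuous_measurable_fun.
Qed.

End variance_fun.

Section coverage_window.
Context (R : realType) (cL cU : R -> R -> R) (mu kap : R).
Hypothesis kap0 : 0 < kap.
Hypothesis L_cvg : (p.1 - cL p.1 p.2) / p.2 @[p --> (nbhs mu, 0^'+)] --> kap.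
Hypothesis U_cvg : (cU p.1 p.2 - p.1) / p.2 @[p --> (nbhs mu, 0^'+)] --> kap.

Lemma coverage_window (eta : R) : 0 < eta < 1 ->
  exists2 g : R, 0 < g & \forall e \near 0^'+, forall y, `|y - mu| <= g ->
    (`|y - mu| <= (1 - eta) * (kap * e) -> cL y e < mu < cU y e) /\
    (cL y e < mu < cU y e -> `|y - mu| <= (1 + eta) * (kap * e)).
Proof.
move=> /andP[eta0 eta1].
(* Half of the margin absorbs the error on the half-widths; the other half provides the strict
   inequalities of the open interval. *)
pose t := eta * kap / 2; have t0 : 0 < t by rewrite divr_gt0// mulr_gt0.
have tE : eta * kap = 2 * t by rewrite /t; field.
move/cvgrPdist_le : L_cvg => /(_ _ t0) /near_pair_at_right0P[g1 [e1 [g10 e10 h1]]].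
move/cvgrPdist_le : U_cvg => /(_ _ t0) /near_pair_at_right0P[g2 [e2 [g20 e20 h2]]].
exists (Num.min g1 g2); first by rewrite lt_min g10.
near=> e => y; rewrite le_min => /andP[y1 y2].
have e0 : 0 < e by near: e; exact: nbhs_right_gt.
have ee1 : 0 < e < e1 by rewrite e0; near: e; exact: nbhs_right_lt.
have ee2 : 0 < e < e2 by rewrite e0; near: e; exact: nbhs_right_lt.
have /ler_normlP[l1 l2] := h1 y e y1 ee1; have /ler_normlP[u1 u2] := h2 y e y2 ee2.
rewrite /= in l1 l2 u1 u2.
have {l2}L2 : kap * e - t * e <= y - cL y e by rewrite -mulrBl -ler_pdivlMr//; lra.
have {l1}L1 : y - cL y e <= kap * e + t * e by rewrite -mulrDl -ler_pdivrMr//; lra.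
have {u2}U2 : kap * e - t * e <= cU y e - y by rewrite -mulrBl -ler_pdivlMr//; lra.
have {u1}U1 : cU y e - y <= kap * e + t * e by rewrite -mulrDl -ler_pdivrMr//; lra.
have te : 0 < t * e by rewrite mulr_gt0.
rewrite mulrBl mulrDl mul1r mulrA tE -mulrA.
split=> [/ler_normlP[a1 a2]|/andP[a1 a2]]; last first.
  by rewrite ler_norml; apply/andP; split; lra.
by apply/andP; split; lra.
Unshelve. all: by end_near. Qed.

End coverage_window.

Theorem theorem3 (R : realType) (d : measure_display) (T : measurableType d)
    (Theta : set R) (Pr : R -> probability T R)
    (X : {mfun T >-> R}) (Xs : nat -> {mfun T >-> R})
    (kappa : R -> R) (L U cL cU : R -> R -> R)
    (delta rho : R) (delta_ : nat -> R) (m_ : R -> nat)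
    (Theta_itv : is_interval Theta)
    (samples : forall t, Theta t -> iid_samples (Pr t) X Xs)
    (mean : forall t, Theta t -> ('E_(Pr t)[X] = t%:E)%E)
    (moment3 : forall t, Theta t ->
       ('E_(Pr t)[(fun w => `|X w| ^+ 3)%R] < +oo)%E)
    (variance_gt0 : forall t, Theta t -> (0 < variance (Pr t) X)%E)
    (variance_cont :
       {within Theta, continuous (fun t => fine (variance (Pr t) X))})
    (kappa_gt0 : forall t, Theta t -> 0 < kappa t)
    (kappa_cont : {within Theta, continuous kappa})
    (LU_class : bounds_class Theta kappa L U)
    (cLU_cvg : bounds_cvg Theta kappa cL cU)
    (cLU_meas : forall e, 0 < e ->
       measurable_fun [set: R] (cL ^~ e) /\ measurable_fun [set: R] (cU ^~ e))
    (delta01 : 0 < delta < 1)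
    (delta_01 : forall n, 0 < delta_ n < 1)
    (delta_cvg :
       Phi (Num.sqrt (ln (1 / delta_ n))) @[n --> \oo] --> 1 - delta / 2)
    (rho01 : 0 <= rho <= 1)
    (m_gt0 : forall e, 0 < e -> (0 < m_ e)%N)
    (m_cvg : m_ e @[e --> 0^'+] --> \oo)
    (m_small : e ^+ 2 * (m_ e)%:R @[e --> 0^'+] --> (0 : R)) :
  let Z := Phi_inv (1 - delta / 2) in
  let V := variance_fun Theta Pr X in
  let Y := sample_mean Xs in
  let n_ := sample_size V rho delta_ L U m_ Y in
  forall mu, Theta° mu ->
  let P := Pr mu in
  let NN := target_size Z (kappa mu) (V mu) in
  let finite_size e :=
    P [set w | (index_ereal R (n_ e w) < +oo)%E] = 1%E /\
    (\int[P]_w index_ereal R (n_ e w) < +oo)%E in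
  [/\ (\forall e \near 0^'+, finite_size e) /\
      (forall e, 0 < e ->
         bounded_near V (nbhs (mu + rho * (U mu e - mu))) ->
         bounded_near V (nbhs (mu + rho * (L mu e - mu))) ->
         finite_size e),
      {ae P, forall w,
         (index_ereal R (n_ e w) / (NN e)%:E)%E @[e --> 0^'+] --> 1%E},
      P (covered (n_ e) Y cL cU e mu) @[e --> 0^'+] --> (1 - delta)%:E &
      ((\int[P]_w index_ereal R (n_ e w)) / (NN e)%:E)%E
        @[e --> 0^'+] --> 1%E].

Proof.
move=> Z V Y n_ mu Tmu0 P NN finite_size.
have Tmu : Theta mu := interior_subset Tmu0.
have p01 : 1 / 2 < 1 - delta / 2 < 1 by move/andP: delta01 => [d0 d1]; apply/andP; split; lra.
have Z0 : 0 < Z by exact: Phi_inv_gt0.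
have lnZ := ln_inv_cvg delta_01 p01 delta_cvg; rewrite -/Z in lnZ.
have H := iid_centered (samples _ Tmu) (mean _ Tmu) (moment3 _ Tmu) (variance_gt0 _ Tmu).
have VE : V mu = fine (variance P X) by rewrite /V /variance_fun mem_set.
rewrite -/P -VE in H.
have V0 : 0 < V mu by rewrite -sqrtr_gt0; exact: ciid_sd_gt0 H.
have cV : {for mu, continuous V} := variance_fun_continuous variance_cont Tmu0.
have mV : measurable_fun setT V := measurable_variance_fun variance_cont Theta_itv.
have k0 := kappa_gt0 _ Tmu.
have [LUc LUle LUmu LUcvg] := LU_class.
have [Lcvg Ucvg] := LUcvg _ Tmu; have [cLcvg cUcvg] := cLU_cvg _ Tmu.
have contL e : 0 < e -> continuous (L ^~ e).
  move=> e0 y; have [cLe _] := LUc y e e0; exact: continuous_section.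
have contU e : 0 < e -> continuous (U ^~ e).
  move=> e0 y; have [_ cUe] := LUc y e e0; exact: continuous_section.
have maccepts (F : R -> R) k : continuous F ->
    measurable [set y | accepts V rho delta_ F y k].
  move=> cF; have mF := continuous_measurable_fun cF.
  have mD : measurable_fun setT (fun y => F y - y) by exact: measurable_funB.
  apply: measurable_set_ler.
    apply: measurableT_comp => //; apply: measurable_funD => //.
    exact: measurable_funM.
  apply: measurable_funM => //; apply: measurable_funM => //.
  exact: measurable_funX.
have mstop e k : 0 < e -> measurable [set y | stop_rule V rho delta_ L U e y k].
  move=> e0; under eq_set do rewrite stop_rule_accepts.
  rewrite (_ : [set _ | _] = [set y | accepts V rho delta_ (U ^~ e) y k] `&`
    [set y | accepts V rho delta_ (L ^~ e) y k]); last first.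
    by apply/seteqP; split => y /= => [/andP[]|[-> ->]].
  by apply: measurableI; apply: maccepts; [exact: contU|exact: contL].
have window eta (eta01 : 0 < eta < 1) :=
  stop_rule_window rho01 delta_01 lnZ Z0 V0 cV k0 Lcvg Ucvg m_cvg eta01.
have m_le := min_size_target Z0 V0 k0 m_small.
have N_cvg := target_size_cvgy Z0 V0 k0.
split.
- split; first exact: (stopping_size_fin_near H mstop window).
  (* For a given [e] the rule evaluates [V] near points that may be far from [mu], possibly at an
     end of [Theta] where the variance is unbounded; [bU] and [bL] exclude this. *)
  move=> e e0 bU bL.
  have [g [K [g0 h]]] := stop_rule_bounded delta_01 lnZ Z0 (contU e e0 mu) (contL e e0 mu)
    (LUmu e e0 _ Tmu) bU bL.
  exact: (stopping_size_fin H m_ mstop e0 g0 h).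
- exact: (stopping_ratio_ae H window m_cvg m_le N_cvg).
(* [2 * Phi Z - 1 = 2 * (1 - delta / 2) - 1]. *)
- have -> : 1 - delta = normal_ball Z.
    by rewrite normal_ball_Phi ?(ltW Z0)// Phi_invK//; lra.
  have mhit e : 0 < e -> measurable [set y | cL y e < mu < cU y e].
    move=> e0; have [mL mU] := cLU_meas e e0.
    rewrite (_ : [set _ | _] = [set y | cL y e < mu] `&` [set y | mu < cU y e]); last first.
      by apply/seteqP; split => y /= => [/andP[]|[-> ->]].
    by apply: measurableI; exact: measurable_set_ltr.
  (* This identity is what selects the target size: the half-width [kappa mu * e] is [Z] standard
     deviations of a mean of [NN e] samples. *)
  have scale e : 0 < e -> kappa mu * e * Num.sqrt (NN e) = Num.sqrt (V mu) * Z.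
    move=> e0; have ke : 0 < kappa mu * e by rewrite mulr_gt0.
    rewrite (_ : NN e = V mu * (Z / (kappa mu * e)) ^+ 2); last first.
      by rewrite expr_div_n mulrA.
    rewrite sqrtrM ?(ltW V0)// sqrtr_sqr.
    rewrite gtr0_norm ?divr_gt0// mulrCA; congr (_ * _).
    by rewrite mulrC divfK// gt_eqF.
  apply: (coverage_cvg H Z0 (measurable_hits Xs m_ mstop mhit)) => th K th01.
  exact: (hits_comparison H window m_cvg m_le N_cvg Z0 scale
    (coverage_window k0 cLcvg cUcvg)).
- exact: (stopping_mean_ratio H mstop window m_cvg m_le N_cvg).
Qed.
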